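(* Assume the strong 3SUM-hardness assumption (stated in the context). Consider the jumbled indexing problem with text size $s$ over an alphabet of size $r \ge 4$. Then for any fixed $\epsilon > 0$, any algorithm for jumbled indexing satisfies at least one of the following: (1) its preprocessing time is $\Omega(s^{2-\frac{2}{r-1}-\epsilon})$, or (2) its query time is $\Omega(s^{1-\frac{1}{r-1}-\epsilon})$.
   Context: Model: Word RAM with words of $O(\log n)$ bits. The Parikh vector of a string $S$ over alphabet $\Sigma=\{\sigma_1,\dots,\sigma_{|\Sigma|}\}$ is $\psi(S)=(c_1(S),\dots,c_{|\Sigma|}(S))$, where $c_i(S)$ is the number of occurrences of $\sigma_i$ in $S$. Jumbled indexing: preprocess a text $S$ of length $s$ over alphabet $\Sigma$ so that, given a query vector $\psi\in\mathbb{N}^{|\Sigma|}$, one can decide whether some substring $S'$ of $S$ has Parikh vector $\psi(S')=\psi$. Convolution-3SUM: given integers $x_1,\dots,x_n$, decide whether there exist distinct indices $i,j$ with $x_i - x_j = x_{i-j}$. Strong 3SUM-hardness assumption: any (possibly randomized) algorithm for Convolution-3SUM requires $n^{2-o(1)}$ expected time to decide, for input $\{x_1,\dots,x_n\}\subset\{-n,\dots,n\}$, whether there is a pair $x_i,x_j$ with $x_i-x_j=x_{i-j}$. *)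

(* Defs.v *)
From Stdlib Require Export Reals ZArith List.
From Coquelicot Require Export Rbar Lub Lim_seq Hierarchy Rcomplements.
Export ListNotations.
Open Scope R_scope.

(** * Randomized Word RAM *)

(* [wrap w] is reduction modulo 2^w to the two's complement range
   [-2^(w-1), 2^(w-1)). *)
Definition wrap (w : nat) (z : Z) : Z :=
  let h := (2 ^ (Z.of_nat w - 1))%Z in
  ((z + h) mod (2 ^ Z.of_nat w) - h)%Z.

(* "Words of O(log n) bits": the constant [c] belongs to the algorithm. *)
Definition word_size (c n : nat) : nat := (c * (Nat.log2 n + 1))%nat.

Inductive binop := Add | Sub | Mul | Div | Mod | And | Or | Xor | Shl | Shr.

Definition eval_binop (o : binop) : Z -> Z -> Z :=
  match o with
  | Add => Z.add | Sub => Z.sub | Mul => Z.mul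
  | Div => Z.div | Mod => Z.modulo
  | And => Z.land | Or => Z.lor | Xor => Z.lxor
  | Shl => Z.shiftl | Shr => Z.shiftr
  end.

Inductive instr :=
| Const (d : nat) (z : Z)               (* R[d] := z *)
| Op (o : binop) (d a b : nat)          (* R[d] := R[a] o R[b] *)
| Read (d a : nat)                      (* R[d] := M[R[a]] *)
| Write (a b : nat)                     (* M[R[a]] := R[b] *)
| Flip (d : nat)                        (* R[d] := fair coin in {0,1} *)
| BranchEq (a b l : nat)                (* if R[a] = R[b] goto l *)
| BranchLt (a b l : nat).               (* if R[a] < R[b] goto l *)

Definition program := list instr.

(* Registers are indexed by program constants, so a program uses finitely many
   of them; memory is addressed by words. *)
Record config := Config { pc : nat; regs : nat -> Z; mem : Z -> Z }.

Definition upd_reg (f : nat -> Z) (i : nat) (v : Z) : nat -> Z :=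
  fun j => if Nat.eqb j i then v else f j.

Definition upd_mem (f : Z -> Z) (a v : Z) : Z -> Z :=
  fun b => if Z.eqb b a then v else f b.

(* A run halts when it leaves the program. *)
Definition halted (P : program) (c : config) : bool :=
  Nat.leb (length P) (pc c).

(* Every step receives a fresh coin [b], which only [Flip] looks at. *)
Definition step (P : program) (w : nat) (b : bool) (c : config) : config :=
  let R := regs c in
  let M := mem c in
  let set d v := Config (S (pc c)) (upd_reg R d v) M in
  match nth_error P (pc c) with
  | None => c
  | Some (Const d z) => set d (wrap w z)
  | Some (Op o d x y) => set d (wrap w (eval_binop o (R x) (R y)))
  | Some (Read d x) => set d (M (R x))
  | Some (Write x y) => Config (S (pc c)) R (upd_mem M (R x) (R y))
  | Some (Flip d) => set d (if b then 1%Z else 0%Z)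
  | Some (BranchEq x y l) =>
      Config (if Z.eqb (R x) (R y) then l else S (pc c)) R M
  | Some (BranchLt x y l) =>
      Config (if Z.ltb (R x) (R y) then l else S (pc c)) R M
  end.

(* The run on the coins [bs], cut off after [length bs] steps. *)
Fixpoint exec (P : program) (w : nat) (bs : list bool) (c : config) : config :=
  match bs with
  | [] => c
  | b :: bs' => if halted P c then c else exec P w bs' (step P w b c)
  end.

Fixpoint steps (P : program) (w : nat) (bs : list bool) (c : config) : nat :=
  match bs with
  | [] => 0%nat
  | b :: bs' => if halted P c then 0%nat else S (steps P w bs' (step P w b c))
  end.

(* Expectation of [f] over [t] independent fair coins. *)
Fixpoint coin_mean (t : nat) (f : list bool -> R) : R :=
  match t with
  | O => f []
  | S t' => (coin_mean t' (fun bs => f (true :: bs)) +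
             coin_mean t' (fun bs => f (false :: bs))) / 2
  end.

(* E[T] = sup_t E[min(T, t)], equal to +oo if it diverges or if the run fails
   to halt with positive probability. *)
Definition expected_time (P : program) (w : nat) (c : config) : Rbar :=
  Sup_seq (fun t => Finite (coin_mean t (fun bs => INR (steps P w bs c)))).

Definition start (R : nat -> Z) (M : Z -> Z) : config := Config 0 R M.

(* Input sequence in cells 0, 1, ..., all other cells 0. *)
Definition input_mem (l : list Z) : Z -> Z :=
  fun a => if Z.leb 0 a then nth (Z.to_nat a) l 0%Z else 0%Z.

(* Input length in register 0, all other registers 0. *)
Definition input_config (l : list Z) : config :=
  start (upd_reg (fun _ => 0%Z) 0 (Z.of_nat (length l))) (input_mem l).

Definition accepts (c : config) : Prop := regs c 0%nat <> 0%Z.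

Definition worst_case {A : Type} (input : A -> Prop) (cost : A -> Rbar) : Rbar :=
  Rbar_lub (fun y => exists a, input a /\ y = cost a).

(** * Convolution-3SUM *)

Definition conv3sum (xs : list Z) : Prop :=
  let x i := nth (i - 1) xs 0%Z in
  exists i j : nat,
    (1 <= j)%nat /\ (j < i)%nat /\ (i <= length xs)%nat /\
    (x i - x j)%Z = x (i - j)%nat.

Definition conv3sum_input (n : nat) (xs : list Z) : Prop :=
  length xs = n /\
  Forall (fun z => (- Z.of_nat n <= z <= Z.of_nat n)%Z) xs.

Record algorithm := Algorithm { code : program; word_const : nat }.

(* Zero-error randomized algorithms.  [2 <= word_const A] makes the input fit
   into words. *)
Definition solves_conv3sum (A : algorithm) : Prop :=
  (2 <= word_const A)%nat /\
  forall (n : nat) (xs : list Z) (bs : list bool),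
    conv3sum_input n xs ->
    let c := exec (code A) (word_size (word_const A) n) bs (input_config xs) in
    halted (code A) c = true -> (accepts c <-> conv3sum xs).

Definition conv3sum_time (A : algorithm) (n : nat) : Rbar :=
  worst_case (conv3sum_input n)
    (fun xs => expected_time (code A) (word_size (word_const A) n)
                 (input_config xs)).

(* "Requires n^(2-o(1)) time": as for any worst-case lower bound, no algorithm
   is faster for all large n, i.e. the bound is met for infinitely many n. *)
Definition strong_3SUM_hardness : Prop :=
  forall A : algorithm, solves_conv3sum A ->
  exists h : nat -> R, is_lim_seq h 0 /\
    forall n0 : nat, exists n : nat, (n0 <= n)%nat /\
      Rbar_le (Finite (Rpower (INR n) (2 - h n))) (conv3sum_time A n).

(** * Jumbled indexing *)

Definition text (r s : nat) (S : list nat) : Prop :=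
  length S = s /\ Forall (fun a => (a < r)%nat) S.

Definition parikh (r : nat) (S : list nat) : list nat :=
  map (count_occ Nat.eq_dec S) (seq 0 r).

Definition substring (S' S : list nat) : Prop :=
  exists U V : list nat, S = U ++ S' ++ V.

Definition jumbled_match (r : nat) (S psi : list nat) : Prop :=
  exists S' : list nat, substring S' S /\ parikh r S' = psi.

Record index_algorithm := IndexAlgorithm
  { pre_code : program; query_code : program; index_word_const : nat }.

(* r is constant, so this is O(log s); adding r makes letters fit even when s
   is small. *)
Definition index_word_size (r : nat) (J : index_algorithm) (s : nat) : nat :=
  word_size (index_word_const J) (s + r).

Definition query_vector (r : nat) (J : index_algorithm) (s : nat) (psi : list nat) : Prop :=
  length psi = r /\
  Forall (fun k => (Z.of_nat k < 2 ^ (Z.of_nat (index_word_size r J s) - 1))%Z) psi.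

Definition pre_config (S : list nat) : config :=
  input_config (map Z.of_nat S).

(* A query finds its vector in registers 0, ..., r-1 and the index in the
   memory left by preprocessing. *)
Definition query_config (c : config) (psi : list nat) : config :=
  start (fun i => Z.of_nat (nth i psi 0%nat)) (mem c).

Definition solves_jumbled_indexing (r : nat) (J : index_algorithm) : Prop :=
  (2 <= index_word_const J)%nat /\
  forall (s : nat) (S psi : list nat) (bs bs' : list bool),
    text r s S -> query_vector r J s psi ->
    let w := index_word_size r J s in
    let c := exec (pre_code J) w bs (pre_config S) in
    halted (pre_code J) c = true ->
    let c' := exec (query_code J) w bs' (query_config c psi) in
    halted (query_code J) c' = true ->
    (accepts c' <-> jumbled_match r S psi).

Definition preprocessing_time (r : nat) (J : index_algorithm) (s : nat) : Rbar :=
  worst_case (text r s)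
    (fun S => expected_time (pre_code J) (index_word_size r J s) (pre_config S)).

(* Expectation over the coins of both preprocessing and query. *)
Definition expected_query_time (r : nat) (J : index_algorithm) (s : nat) (S psi : list nat) : Rbar :=
  let w := index_word_size r J s in
  Sup_seq (fun t => Finite (coin_mean t (fun bs =>
    let c := exec (pre_code J) w bs (pre_config S) in
    if halted (pre_code J) c then
      coin_mean t (fun bs' => INR (steps (query_code J) w bs' (query_config c psi)))
    else 0))).

Definition query_time (r : nat) (J : index_algorithm) (s : nat) : Rbar :=
  worst_case (fun p => text r s (fst p) /\ query_vector r J s (snd p))
    (fun p => expected_query_time r J s (fst p) (snd p)).

(* f is not o(g).  The "for all large s" variant of Omega would make the
   dichotomy false: an index may preprocess everything for even s and nothing
   for odd s, so that neither time is large for all large s. *)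
Definition is_Omega (f : nat -> Rbar) (g : nat -> R) : Prop :=
  exists k : R, 0 < k /\
    forall s0 : nat, exists s : nat, (s0 <= s)%nat /\
      Rbar_le (Finite (k * g s)) (f s).

(* Main.v *)
(** An index for alphabet size [r = k + 3] is turned into a program for
    Convolution-3SUM.  Write the numbers in a base [B] of size about
    [n^(1/(k+1))] with [k + 1] digits.  The text has a block for each pair of
    consecutive inputs [x], [y]: letter [a] occurs [y_a - x_a + 3B] times in
    it, a filler letter pads the block to a fixed length, and a separator ends
    it.  Digit differences telescope along consecutive blocks, so [h] blocks
    starting at [x_j] encode the digits of [x_(j+h)] and [x_j]; the condition
    [x_(j+h) - x_j = x_h] holds iff they differ by the digits of [x_h] for one
    of the [2^k] possible carry vectors.  Prescribing the length and the number
    of separators of a substring forces it to consist of whole blocks, hence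
    [O(n)] queries to a text of length [O(n^(1+1/(k+1)))] decide the instance.

    The program simulates the index on its longer words.  A query may destroy
    the index, so its writes go to a time-stamped overlay.  Linearity of
    expectation bounds the expected time by that of the preprocessing plus that
    of the queries, up to a constant factor and the time to write the text. *)

Require Import Defs.
From Stdlib Require Import Lia Lra Psatz Classical.
Set Bullet Behavior "Strict Subproofs".

(** Expected time is a supremum of means of running times cut off after [t] coins, so every estimate
    is made at a fixed [t] and only finite averages occur. One [t] serves the reduction, the
    preprocessing and all queries: a simulated step takes at least one step of the simulating
    machine, so [t] real steps contain at most [t] simulated ones. Query times are bounded only on
    average over the coins of preprocessing, never for a fixed index. They can still be summed,
    since the list of queries is fixed in advance and asked in full: no answer influences a later
    query. The exponents balance as follows. With m = k + 1 = r - 2 digits the text has length about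
    n^b, where b = (m + 1) / m, and b (2 - 2/(r-1)) = 2 while b (1 - 1/(r-1)) = 1. So preprocessing
    faster than the claimed bound, and n queries faster than theirs, both stay below n^2 by a power
    of n. *)

(** * Means over coins and truncated running times *)

Lemma coin_mean_le (t : nat) (f g : list bool -> R) :
  (forall bs, f bs <= g bs) -> coin_mean t f <= coin_mean t g.
Proof.
  revert f g; induction t as [|t IH]; intros f g H; simpl; [apply H|].
  pose proof (IH (fun bs => f (true :: bs)) (fun bs => g (true :: bs))
                 (fun bs => H (true :: bs))).
  pose proof (IH (fun bs => f (false :: bs)) (fun bs => g (false :: bs))
                 (fun bs => H (false :: bs))).
  lra.
Qed.

Lemma coin_mean_ext (t : nat) (f g : list bool -> R) :
  (forall bs, f bs = g bs) -> coin_mean t f = coin_mean t g.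
Proof.
  intros H; apply Rle_antisym; apply coin_mean_le; intros bs; rewrite H; lra.
Qed.

Lemma coin_mean_const (t : nat) (a : R) : coin_mean t (fun _ => a) = a.
Proof. induction t as [|t IH]; simpl; [reflexivity | rewrite IH; lra]. Qed.

Lemma coin_mean_plus (t : nat) (f g : list bool -> R) :
  coin_mean t (fun bs => f bs + g bs) = coin_mean t f + coin_mean t g.
Proof.
  revert f g; induction t as [|t IH]; intros f g; simpl; [reflexivity|].
  rewrite !IH; lra.
Qed.

Lemma coin_mean_scal (t : nat) (a : R) (f : list bool -> R) :
  coin_mean t (fun bs => a * f bs) = a * coin_mean t f.
Proof.
  revert f; induction t as [|t IH]; intros f; simpl; [reflexivity|].
  rewrite !IH; lra.
Qed.

Lemma coin_mean_nonneg (t : nat) (f : list bool -> R) :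
  (forall bs, 0 <= f bs) -> 0 <= coin_mean t f.
Proof. intros H; rewrite <- (coin_mean_const t 0); now apply coin_mean_le. Qed.

(** This is E[min(T, t)]; its supremum over [t] is [expected_time]. *)
Definition mean_steps (P : program) (w t : nat) (c : config) : R :=
  coin_mean t (fun bs => INR (steps P w bs c)).

Definition fair (f : bool -> R) : R := (f true + f false) / 2.

Lemma mean_steps_halted P w t c : halted P c = true -> mean_steps P w t c = 0.
Proof.
  intros H; unfold mean_steps.
  rewrite (coin_mean_ext _ _ (fun _ => 0)); [apply coin_mean_const|].
  intros [|b bs]; simpl; [|rewrite H]; reflexivity.
Qed.

Lemma mean_steps_S P w t c :
  halted P c = false ->
  mean_steps P w (S t) c = 1 + fair (fun b => mean_steps P w t (step P w b c)).
Proof.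
  intros H; unfold mean_steps, fair; simpl coin_mean; rewrite H.
  assert (E : forall b, coin_mean t (fun bs => INR (S (steps P w bs (step P w b c))))
                = 1 + coin_mean t (fun bs => INR (steps P w bs (step P w b c)))).
  { intros b; transitivity (coin_mean t (fun bs => 1 + INR (steps P w bs (step P w b c))));
      [|now rewrite coin_mean_plus, coin_mean_const].
    apply coin_mean_ext; intros bs; rewrite S_INR; lra. }
  rewrite !E; lra.
Qed.

Lemma mean_steps_nonneg P w t c : 0 <= mean_steps P w t c.
Proof. apply coin_mean_nonneg; intros bs; apply pos_INR. Qed.

Lemma mean_steps_succ P w t c : mean_steps P w t c <= mean_steps P w (S t) c.
Proof.
  revert c; induction t as [|t IH]; intros c.
  - replace (mean_steps P w 0 c) with 0 by reflexivity; apply mean_steps_nonneg.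
  - destruct (halted P c) eqn:H; [rewrite !mean_steps_halted by easy; lra|].
    rewrite !(mean_steps_S _ _ _ _ H); unfold fair.
    pose proof (IH (step P w true c)); pose proof (IH (step P w false c)); lra.
Qed.

Lemma mean_steps_mono P w t t' c :
  (t <= t')%nat -> mean_steps P w t c <= mean_steps P w t' c.
Proof.
  induction 1 as [|t' _ IH]; [lra|].
  pose proof (mean_steps_succ P w t' c); lra.
Qed.

(** * Deterministic stretches; cost and correctness of runs *)

Lemma halted_at P p R M i :
  nth_error P p = Some i -> halted P (Config p R M) = false.
Proof.
  intros H; apply Nat.leb_gt; simpl.
  apply nth_error_Some; rewrite H; discriminate.
Qed.

(** A stretch of steps that ignore their coins, so its cost [k] is the same on every coin sequence
    and nothing has to be averaged. *)
Inductive reach (P : program) (w : nat) : nat -> config -> config -> Prop :=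
| reach_refl c : reach P w 0 c c
| reach_step k c c1 c2 :
    halted P c = false -> (forall b, step P w b c = c1) ->
    reach P w k c1 c2 -> reach P w (S k) c c2.

Lemma reach_trans P w k1 k2 c1 c2 c3 :
  reach P w k1 c1 c2 -> reach P w k2 c2 c3 -> reach P w (k1 + k2) c1 c3.
Proof. induction 1; intros; simpl; [easy | econstructor; eauto]. Qed.

(* [good P w A t c v]: from [c], the mean of the running time cut off at [t]
   is at most [v], and all halting runs of length at most [t] decide [A]. *)
Definition good (P : program) (w : nat) (A : Prop) (t : nat) (c : config) (v : R) : Prop :=
  mean_steps P w t c <= v /\
  forall bs, (length bs <= t)%nat -> halted P (exec P w bs c) = true ->
    (accepts (exec P w bs c) <-> A).

Lemma good_anti P w A t t' c v v' :
  (t' <= t)%nat -> v <= v' -> good P w A t c v -> good P w A t' c v'.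
Proof.
  intros Ht Hv [H1 H2]; split.
  - pose proof (mean_steps_mono P w t' t c Ht); lra.
  - intros bs Hl; apply H2; lia.
Qed.

Lemma good_0 P w A c v : halted P c = false -> 0 <= v -> good P w A 0 c v.
Proof.
  intros H Hv; split; [exact Hv|].
  intros [|b bs] Hl; simpl in *; [congruence | lia].
Qed.

Lemma good_fair P w A t c v :
  halted P c = false -> (forall b, good P w A t (step P w b c) (v b)) ->
  good P w A (S t) c (1 + fair v).
Proof.
  intros H G; split.
  - rewrite mean_steps_S by easy; unfold fair.
    destruct (G true) as [G1 _], (G false) as [G2 _]; lra.
  - intros [|b bs] Hl; simpl in *; [congruence|].
    rewrite H; apply (G b); lia.
Qed.

(** The cutoff stays [t] although [k] steps are spent: each of them would let it grow by one, and
    [good_anti] gives this growth away. Thus the cutoff need not be tracked through the program. *)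
Lemma good_reach P w A k t c c' v :
  reach P w k c c' -> 0 <= v -> good P w A t c' v -> good P w A t c (INR k + v).
Proof.
  intros Hr Hv; revert t; induction Hr as [c | k c c1 c2 H Hs Hr IH]; intros t G.
  - simpl; rewrite Rplus_0_l; exact G.
  - apply (good_anti P w A (S t) t c (1 + fair (fun _ => INR k + v)));
      [lia | rewrite S_INR; unfold fair; lra|].
    apply good_fair; [easy|]; intros b; rewrite Hs; auto.
Qed.

Lemma good_halted P w A t c :
  halted P c = true -> (accepts c <-> A) -> good P w A t c 0.
Proof.
  intros H HA; split; [rewrite mean_steps_halted by easy; lra|].
  intros [|b bs] _; simpl; [|rewrite H]; auto.
Qed.

(** * A structured language *)

Inductive test := TEq (a b : nat) | TLt (a b : nat).

Inductive cmd :=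
| Konst (d : nat) (z : Z)
| Bin (o : binop) (d a b : nat)
| Fetch (d a : nat)
| Store (a b : nat)
| Toss (d : nat)
| Nop
| Seq (c1 c2 : cmd)
| If (q : test) (c1 c2 : cmd)
| While (q : test) (c : cmd).

Infix ";;" := Seq (at level 60, right associativity).

Definition branch (q : test) (l : nat) : instr :=
  match q with TEq a b => BranchEq a b l | TLt a b => BranchLt a b l end.

(** The machine has no unconditional jump; comparing a register with itself supplies one. *)
Definition goto (l : nat) : instr := BranchEq 0 0 l.

Definition holds (q : test) (R : nat -> Z) : bool :=
  match q with TEq a b => Z.eqb (R a) (R b) | TLt a b => Z.ltb (R a) (R b) end.

Fixpoint size (C : cmd) : nat :=
  match C with
  | Nop => 0
  | Seq a b => size a + size b
  | If _ a b => size a + size b + 2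
  | While _ a => size a + 3
  | _ => 1
  end.

(** The machine jumps when a test succeeds and falls through when it fails. Hence the else part of
    [If] comes first, and in [While] the exit jump directly follows the test. *)
Fixpoint comp (p : nat) (C : cmd) : program :=
  match C with
  | Konst d z => [Const d z]
  | Bin o d a b => [Op o d a b]
  | Fetch d a => [Read d a]
  | Store a b => [Write a b]
  | Toss d => [Flip d]
  | Nop => []
  | Seq a b => comp p a ++ comp (p + size a) b
  | If q a b =>
      branch q (p + size b + 2) :: comp (p + 1) b ++
      goto (p + size a + size b + 2) :: comp (p + size b + 2) a
  | While q a =>
      branch q (p + 2) :: goto (p + size a + 3) :: comp (p + 2) a ++ [goto p]
  end.

(** Locates the compiled pieces inside an arbitrary program, so that a specification of a command
    holds at every offset where it is placed. *)
Fixpoint code_at (P : program) (p : nat) (C : cmd) : Prop :=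
  match C with
  | Nop => True
  | Seq a b => code_at P p a /\ code_at P (p + size a) b
  | If q a b =>
      nth_error P p = Some (branch q (p + size b + 2)) /\
      code_at P (p + 1) b /\
      nth_error P (p + 1 + size b) = Some (goto (p + size a + size b + 2)) /\
      code_at P (p + size b + 2) a
  | While q a =>
      nth_error P p = Some (branch q (p + 2)) /\
      nth_error P (p + 1) = Some (goto (p + size a + 3)) /\
      code_at P (p + 2) a /\
      nth_error P (p + 2 + size a) = Some (goto p)
  | Konst d z => nth_error P p = Some (Const d z)
  | Bin o d a b => nth_error P p = Some (Op o d a b)
  | Fetch d a => nth_error P p = Some (Read d a)
  | Store a b => nth_error P p = Some (Write a b)
  | Toss d => nth_error P p = Some (Flip d)
  end.

Lemma size_comp p C : length (comp p C) = size C.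
Proof.
  revert p; induction C; intros p; simpl; auto;
    repeat (rewrite length_app; simpl); repeat match goal with
    | H : forall p, length (comp p ?C) = _ |- _ => rewrite H; clear H end; lia.
Qed.

Lemma nth_error_mid {T : Type} (X Y : list T) (a : T) p :
  p = length X -> nth_error (X ++ a :: Y) p = Some a.
Proof. intros ->; rewrite nth_error_app2, Nat.sub_diag by lia; reflexivity. Qed.

Lemma comp_code_at P X Y C p :
  P = X ++ comp p C ++ Y -> p = length X -> code_at P p C.
Proof.
  revert P X Y p; induction C; intros P X Y p HP Hp; simpl in HP |- *;
    try (subst P; apply nth_error_mid; exact Hp); auto.
  - rewrite <- app_assoc in HP; split; [eapply IHC1; eauto|].
    eapply (IHC2 P (X ++ comp p C1) Y); [now rewrite <- app_assoc|].
    rewrite length_app, size_comp; lia.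
  - split; [subst P; apply nth_error_mid; exact Hp|].
    rewrite <- app_assoc in HP; simpl in HP.
    split; [|split].
    + eapply (IHC2 P (X ++ [branch q (p + size C2 + 2)])).
      * rewrite <- app_assoc; exact HP.
      * rewrite length_app; simpl; lia.
    + rewrite HP.
      change (?a :: ?l ++ ?y) with ((a :: l) ++ y); rewrite app_assoc.
      apply nth_error_mid; rewrite length_app; simpl; rewrite size_comp; lia.
    + eapply (IHC1 P (X ++ branch q (p + size C2 + 2) :: comp (p + 1) C2 ++
                        [goto (p + size C1 + size C2 + 2)]) Y).
      * rewrite HP, <- app_assoc; simpl; rewrite <- app_assoc; reflexivity.
      * rewrite length_app; simpl; rewrite length_app; simpl.
        rewrite size_comp; lia.
  - split; [subst P; apply nth_error_mid; exact Hp|].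
    rewrite <- app_assoc in HP; simpl in HP.
    split; [|split].
    + rewrite HP.
      change (X ++ ?a :: ?y) with (X ++ [a] ++ y); rewrite app_assoc.
      apply nth_error_mid; rewrite length_app; simpl; lia.
    + eapply (IHC P (X ++ [branch q (p + 2); goto (p + size C + 3)])).
      * rewrite <- app_assoc; exact HP.
      * rewrite length_app; simpl; lia.
    + rewrite HP.
      change (?a :: ?b :: ?l ++ ?y) with ((a :: b :: l) ++ y); rewrite app_assoc.
      apply nth_error_mid; rewrite length_app; simpl; rewrite size_comp; lia.
Qed.

Lemma comp_code_at_0 C : code_at (comp 0 C) 0 C.
Proof. apply (comp_code_at _ [] []); simpl; [now rewrite app_nil_r | reflexivity]. Qed.

(* Total correctness with a cost bound [n], for commands whose run does not
   reach a [Toss]. *)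
Definition runs (w : nat) (C : cmd) (R : nat -> Z) (M : Z -> Z) (n : nat)
    (Post : (nat -> Z) -> (Z -> Z) -> Prop) : Prop :=
  exists R' M' k, (k <= n)%nat /\ Post R' M' /\
    forall P p, code_at P p C ->
      reach P w k (Config p R M) (Config (p + size C) R' M').

Lemma runs_weaken w C R M n n' (Q Q' : _ -> _ -> Prop) :
  (n <= n')%nat -> (forall R' M', Q R' M' -> Q' R' M') ->
  runs w C R M n Q -> runs w C R M n' Q'.
Proof.
  intros Hn HQ (R' & M' & k & Hk & HP & H).
  exists R', M', k; repeat split; auto; lia.
Qed.

Lemma runs_le n w C R M n' (Q : _ -> _ -> Prop) :
  (n <= n')%nat -> runs w C R M n Q -> runs w C R M n' Q.
Proof. intros H; now apply runs_weaken. Qed.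

Lemma runs_nop w R M (Q : _ -> _ -> Prop) : Q R M -> runs w Nop R M 0 Q.
Proof.
  intros HQ; exists R, M, 0%nat; repeat split; auto.
  intros; simpl; rewrite Nat.add_0_r; constructor.
Qed.

Lemma runs_seq w C1 C2 R M n1 n2 (Q : _ -> _ -> Prop) :
  runs w C1 R M n1 (fun R1 M1 => runs w C2 R1 M1 n2 Q) ->
  runs w (C1 ;; C2) R M (n1 + n2) Q.
Proof.
  intros (R1 & M1 & k1 & Hk1 & (R2 & M2 & k2 & Hk2 & HQ & H2) & H1).
  exists R2, M2, (k1 + k2)%nat; repeat split; [lia | auto |].
  intros P p [Ha Hb]; simpl size; rewrite Nat.add_assoc.
  eapply reach_trans; eauto.
Qed.

Lemma reach_1 P w c c' :
  halted P c = false -> (forall b, step P w b c = c') -> reach P w 1 c c'.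
Proof. intros H1 H2; econstructor; eauto; constructor. Qed.

Lemma step_branch P w p q l R M b :
  nth_error P p = Some (branch q l) ->
  step P w b (Config p R M) = Config (if holds q R then l else S p) R M.
Proof. intros H; unfold step; simpl; rewrite H; destruct q; reflexivity. Qed.

Lemma step_goto P w p l R M b :
  nth_error P p = Some (goto l) -> step P w b (Config p R M) = Config l R M.
Proof. intros H; unfold step; simpl; rewrite H; simpl; rewrite Z.eqb_refl; reflexivity. Qed.

Ltac one_step :=
  intros P p H; simpl in H; apply reach_1;
  [eapply halted_at; eauto | intros ?; unfold step; simpl; rewrite H; simpl;
   rewrite Nat.add_1_r; reflexivity].

Lemma runs_konst w d z R M (Q : _ -> _ -> Prop) :
  Q (upd_reg R d (wrap w z)) M -> runs w (Konst d z) R M 1 Q.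
Proof.
  intros HQ; exists (upd_reg R d (wrap w z)), M, 1%nat; repeat split; auto; one_step.
Qed.

Lemma runs_bin w o d a b R M (Q : _ -> _ -> Prop) :
  Q (upd_reg R d (wrap w (eval_binop o (R a) (R b)))) M ->
  runs w (Bin o d a b) R M 1 Q.
Proof.
  intros HQ; eexists _, M, 1%nat; split; [|split]; [auto | exact HQ | one_step].
Qed.

Lemma runs_fetch w d a R M (Q : _ -> _ -> Prop) :
  Q (upd_reg R d (M (R a))) M -> runs w (Fetch d a) R M 1 Q.
Proof.
  intros HQ; eexists _, M, 1%nat; split; [|split]; [auto | exact HQ | one_step].
Qed.

Lemma runs_store w a b R M (Q : _ -> _ -> Prop) :
  Q R (upd_mem M (R a) (R b)) -> runs w (Store a b) R M 1 Q.
Proof.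
  intros HQ; eexists R, _, 1%nat; split; [|split]; [auto | exact HQ | one_step].
Qed.

(** The two extra steps are the test and the jump that ends the else part. *)
Lemma runs_if w q C1 C2 R M n (Q : _ -> _ -> Prop) :
  (if holds q R then runs w C1 R M n Q else runs w C2 R M n Q) ->
  runs w (If q C1 C2) R M (n + 2) Q.
Proof.
  destruct (holds q R) eqn:Hq; intros (R' & M' & k & Hk & HQ & H).
  - exists R', M', (S k); repeat split; [lia | auto |].
    intros P p (Ha & Hb & Hc & Hd); simpl.
    econstructor; [eapply halted_at; eauto | |].
    + intros b; rewrite (step_branch _ _ _ _ _ _ _ _ Ha), Hq; reflexivity.
    + replace (p + (size C1 + size C2 + 2))%nat with (p + size C2 + 2 + size C1)%nat by lia.
      auto.
  - exists R', M', (S (k + 1)); repeat split; [lia | auto |].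
    intros P p (Ha & Hb & Hc & Hd); simpl.
    econstructor; [eapply halted_at; eauto | |].
    + intros b; rewrite (step_branch _ _ _ _ _ _ _ _ Ha), Hq; reflexivity.
    + replace (S p) with (p + 1)%nat by lia; eapply reach_trans; [apply H, Hb|].
      apply reach_1; [eapply halted_at; eauto|].
      intros b; rewrite (step_goto _ _ _ _ _ _ _ Hc); f_equal; lia.
Qed.

(** The index of [I] is the number of rounds still to come. A round also pays the test and the jump
    back; the final 2 steps are the failed test and the exit jump. *)
Lemma runs_while w q C (I : nat -> (nat -> Z) -> (Z -> Z) -> Prop) n j R M
    (Q : _ -> _ -> Prop) :
  I j R M ->
  (forall i R M, I (S i) R M -> holds q R = true /\ runs w C R M n (I i)) ->
  (forall R M, I 0%nat R M -> holds q R = false /\ Q R M) ->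
  runs w (While q C) R M (j * (n + 2) + 2) Q.
Proof.
  intros HI HS H0; revert R M HI; induction j as [|j IH]; intros R M HI.
  - destruct (H0 R M HI) as [Hq HQ].
    exists R, M, 2%nat; repeat split; [simpl; lia | auto |].
    intros P p (Ha & Hb & Hc & Hd).
    econstructor; [eapply halted_at; eauto | |].
    + intros b; rewrite (step_branch _ _ _ _ _ _ _ _ Ha), Hq; reflexivity.
    + replace (S p) with (p + 1)%nat by lia; apply reach_1; [eapply halted_at; eauto|].
      intros b; rewrite (step_goto _ _ _ _ _ _ _ Hb); simpl; f_equal; lia.
  - destruct (HS j R M HI) as (Hq & R1 & M1 & k1 & Hk1 & HI1 & H1).
    destruct (IH R1 M1 HI1) as (R2 & M2 & k2 & Hk2 & HQ & H2).
    exists R2, M2, (S (k1 + (1 + k2))); repeat split; [simpl; lia | auto |].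
    intros P p Hp; pose proof Hp as (Ha & Hb & Hc & Hd).
    econstructor; [eapply halted_at; eauto | |].
    + intros b; rewrite (step_branch _ _ _ _ _ _ _ _ Ha), Hq; reflexivity.
    + eapply reach_trans; [apply H1, Hc|].
      eapply reach_trans; [|apply H2, Hp].
      apply reach_1; [eapply halted_at; eauto|].
      intros b; apply (step_goto _ _ _ _ _ _ _ Hd).
Qed.

Lemma good_runs P w A t p C R M n v (Q : _ -> _ -> Prop) :
  runs w C R M n Q -> code_at P p C -> 0 <= v ->
  (forall R' M', Q R' M' -> good P w A t (Config (p + size C) R' M') v) ->
  good P w A t (Config p R M) (INR n + v).
Proof.
  intros (R' & M' & k & Hk & HQ & H) Hp Hv HG.
  apply (good_anti P w A t t _ (INR k + v)); [lia | apply le_INR in Hk; lra|].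
  eapply good_reach; [apply H, Hp | exact Hv | auto].
Qed.

(** * Simulating a word RAM with shorter words *)

Definition fits (W : nat) (z : Z) : Prop :=
  (- 2 ^ (Z.of_nat W - 1) <= z < 2 ^ (Z.of_nat W - 1))%Z.

Lemma pow2_half (W : nat) :
  (1 <= W)%nat -> (2 ^ Z.of_nat W = 2 * 2 ^ (Z.of_nat W - 1) /\ 0 < 2 ^ (Z.of_nat W - 1))%Z.
Proof.
  intros H; split; [|apply Z.pow_pos_nonneg; lia].
  rewrite <- Z.pow_succ_r by lia; f_equal; lia.
Qed.

Lemma wrap_fits W z : (1 <= W)%nat -> fits W (wrap W z).
Proof.
  intros H; destruct (pow2_half W H) as [E Hp]; unfold fits, wrap.
  pose proof (Z.mod_pos_bound (z + 2 ^ (Z.of_nat W - 1)) (2 ^ Z.of_nat W)); lia.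
Qed.

Lemma wrap_id W z : (1 <= W)%nat -> fits W z -> wrap W z = z.
Proof.
  intros H Hz; destruct (pow2_half W H) as [E Hp]; unfold fits, wrap in *.
  rewrite Z.mod_small; lia.
Qed.

Lemma wrap_eq W z : exists q, wrap W z = (z - 2 ^ Z.of_nat W * q)%Z.
Proof.
  unfold wrap; exists ((z + 2 ^ (Z.of_nat W - 1)) / 2 ^ Z.of_nat W)%Z.
  rewrite Z.mod_eq; [lia|]; apply Z.pow_nonzero; lia.
Qed.

(* The reduction modulo 2^w performed by the simulating machine is invisible
   after reduction modulo 2^W, so every operation is simulated alike. *)
Lemma wrap_wrap W w z : (1 <= W)%nat -> (W + 1 <= w)%nat ->
  wrap w (wrap w (wrap w (wrap w z + 2 ^ (Z.of_nat W - 1)) mod 2 ^ Z.of_nat W)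
          - 2 ^ (Z.of_nat W - 1)) = wrap W z.
Proof.
  intros HW Hw; destruct (pow2_half W ltac:(lia)) as [E Hp].
  set (h := (2 ^ (Z.of_nat W - 1))%Z) in *.
  set (Q := (2 ^ Z.of_nat W)%Z) in *.
  (* A residue modulo [Q] fits into the longer word, so the two outer wraps are the identity; the
     two inner ones vanish modulo [Q], which divides [2^w]. *)
  assert (HB : (Q <= 2 ^ (Z.of_nat w - 1))%Z)
    by (apply Z.pow_le_mono_r; lia).
  assert (Em : (wrap w (wrap w z + h) mod Q = (z + h) mod Q)%Z).
  { destruct (wrap_eq w (wrap w z + h)) as [a ->].
    destruct (wrap_eq w z) as [b ->].
    replace (2 ^ Z.of_nat w)%Z with (Q * 2 ^ (Z.of_nat w - Z.of_nat W))%Z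
      by (unfold Q; rewrite <- Z.pow_add_r by lia; f_equal; lia).
    set (e := (2 ^ (Z.of_nat w - Z.of_nat W))%Z).
    replace (z - Q * e * b + h - Q * e * a)%Z with (z + h + (- (e * b) - e * a) * Q)%Z by ring.
    apply Z.mod_add; lia. }
  rewrite Em.
  pose proof (Z.mod_pos_bound (z + h) Q ltac:(lia)).
  rewrite (wrap_id w ((z + h) mod Q)) by (try lia; unfold fits; lia).
  rewrite wrap_id by (try lia; unfold fits; lia).
  reflexivity.
Qed.

Lemma upd_same R d v : upd_reg R d v d = v.
Proof. unfold upd_reg; now rewrite Nat.eqb_refl. Qed.

Lemma upd_diff R d v i : i <> d -> upd_reg R d v i = R i.
Proof. intros H; unfold upd_reg; destruct (Nat.eqb_spec i d); congruence. Qed.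

Lemma updm_same M a v : upd_mem M a v a = v.
Proof. unfold upd_mem; now rewrite Z.eqb_refl. Qed.

Lemma updm_diff M a v b : b <> a -> upd_mem M a v b = M b.
Proof. intros H; unfold upd_mem; destruct (Z.eqb_spec b a); congruence. Qed.

Ltac rs := repeat (rewrite upd_same || rewrite upd_diff by lia).

(* Registers below 20 are left alone by the simulation, register [40 + i]
   holds register [i] of the simulated machine, and register 20 its program
   counter, with all halting values identified. *)
Notation rQ := 8%nat.
Notation rH := 9%nat.
Notation rStamp := 15%nat.
Notation rLen := 19%nat.
Notation rPc := 20%nat.
Notation rCoin := 21%nat.
Notation jreg i := (40 + i)%nat.

(** The formula of [wrap W], computed with 2^W and 2^(W-1) taken from registers. *)
Definition reduce (d : nat) : cmd :=
  Bin Add 22 22 rH ;; Bin Mod 22 22 rQ ;; Bin Sub d 22 rH.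

(* With [ov = true], memory writes go to an overlay, where an entry is valid if
   it carries the current time stamp: this leaves the index intact for the next
   query without a rollback. *)
Definition sim_instr (ov : bool) (len i : nat) (I : instr) : cmd :=
  match I with
  | Const d z => Konst 22 z ;; reduce (jreg d) ;; Konst rPc (Z.of_nat (i + 1))
  | Op o d a b =>
      Bin o 22 (jreg a) (jreg b) ;; reduce (jreg d) ;; Konst rPc (Z.of_nat (i + 1))
  | Read d a =>
      (if ov then
         Bin Add 22 (jreg a) rQ ;; Fetch 23 22 ;;
         If (TEq 23 rStamp)
           (Bin Add 22 22 rQ ;; Fetch (jreg d) 22)
           (Fetch (jreg d) (jreg a))
       else Fetch (jreg d) (jreg a)) ;; Konst rPc (Z.of_nat (i + 1))
  | Write a b =>
      (if ov then
         Bin Add 22 (jreg a) rQ ;; Store 22 rStamp ;;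
         Bin Add 22 22 rQ ;; Store 22 (jreg b)
       else Store (jreg a) (jreg b)) ;; Konst rPc (Z.of_nat (i + 1))
  | Flip d => Bin And (jreg d) rCoin rCoin ;; Konst rPc (Z.of_nat (i + 1))
  | BranchEq a b l =>
      If (TEq (jreg a) (jreg b)) (Konst rPc (Z.of_nat (Nat.min l len)))
         (Konst rPc (Z.of_nat (i + 1)))
  | BranchLt a b l =>
      If (TLt (jreg a) (jreg b)) (Konst rPc (Z.of_nat (Nat.min l len)))
         (Konst rPc (Z.of_nat (i + 1)))
  end.

(** A linear search for the current instruction; its cost depends only on the length of the
    simulated program, a constant of the reduction. *)
Fixpoint dispatch (ov : bool) (len i : nat) (J : program) : cmd :=
  match J with
  | [] => Nop
  | ins :: J' =>
      Konst 22 (Z.of_nat i) ;;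
      If (TEq rPc 22) (sim_instr ov len i ins) (dispatch ov len (S i) J')
  end.

(** A coin is tossed before every simulated instruction, whether or not it is a [Flip], because
    [step] receives a coin each time. The simulated run thus consumes coins exactly as [exec]
    does. *)
Definition sim_loop (ov : bool) (J : program) : cmd :=
  While (TLt rPc rLen) (Toss rCoin ;; dispatch ov (length J) 0 J).

Definition instr_regs (I : instr) : list nat :=
  match I with
  | Const d _ | Flip d => [d]
  | Op _ d a b => [d; a; b]
  | Read a b | Write a b | BranchEq a b _ | BranchLt a b _ => [a; b]
  end.

Definition uses_regs (nr : nat) (J : program) : Prop :=
  Forall (fun I => Forall (fun i => (i < nr)%nat) (instr_regs I)) J.

(** [Mb] is the memory before the simulation, [Mj] that of the simulated machine, [M] the actual
    one. As Q = 2H, the stamps fill [H, 3H) and the overlay values [3H, 5H); every other cell keeps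
    its content from [Mb]. No stamp exceeds the current one, which makes the next one fresh. *)
Definition memrel (ov : bool) (W : nat) (stamp : Z) (Mb Mj M : Z -> Z) : Prop :=
  let H := (2 ^ (Z.of_nat W - 1))%Z in
  let Q := (2 ^ Z.of_nat W)%Z in
  if ov then
    (forall a, fits W a ->
       Mj a = if Z.eqb (M (a + Q)%Z) stamp then M (a + 2 * Q)%Z else Mb a) /\
    (forall a, (a < H \/ 5 * H <= a)%Z -> M a = Mb a) /\
    (forall a, fits W a -> (0 <= M (a + Q) <= stamp)%Z)
  else
    (forall a, fits W a -> M a = Mj a) /\
    (forall a, ~ fits W a -> M a = Mb a).

Record sim (ov : bool) (nr W len : nat) (g : nat -> Z) (Mb : Z -> Z)
    (cj : config) (R : nat -> Z) (M : Z -> Z) : Prop := Sim {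
  sim_glob : forall i, (i < 20)%nat -> R i = g i;
  sim_pc : R rPc = Z.of_nat (Nat.min (pc cj) len);
  sim_reg : forall i, (i < nr)%nat -> R (jreg i) = regs cj i;
  sim_rfits : forall i, fits W (regs cj i);
  sim_mfits : forall a, fits W a -> fits W (mem cj a);
  sim_mem : memrel ov W (g rStamp) Mb (mem cj) M }.

(** * Simulation of one step and of a whole run *)

Section Simulation.

Variables (ov : bool) (nr W w : nat) (g : nat -> Z) (J : program) (Mb : Z -> Z).
Let len := length J.
Hypothesis HW : (2 <= W)%nat.
Hypothesis Hw : (W + 4 <= w)%nat.
Hypothesis Hlen : (Z.of_nat len < 2 ^ (Z.of_nat w - 1))%Z.
Hypothesis Hregs : uses_regs nr J.
Hypothesis HgQ : g rQ = (2 ^ Z.of_nat W)%Z.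
Hypothesis HgH : g rH = (2 ^ (Z.of_nat W - 1))%Z.
Hypothesis Hgl : g rLen = Z.of_nat len.
Hypothesis Hgs : ov = true -> (0 <= g rStamp)%Z.

Lemma sim_big : (8 * 2 ^ Z.of_nat W <= 2 ^ (Z.of_nat w - 1))%Z.
Proof.
  change 8%Z with (2 ^ 3)%Z; rewrite <- Z.pow_add_r by lia.
  apply Z.pow_le_mono_r; lia.
Qed.

Lemma fits_up z : fits W z -> fits w z.
Proof.
  pose proof sim_big; destruct (pow2_half W ltac:(lia)); unfold fits; lia.
Qed.

Lemma konst_pc k : (k <= len)%nat -> wrap w (Z.of_nat k) = Z.of_nat k.
Proof. intros H; apply wrap_id; [lia|]; unfold fits; lia. Qed.

Lemma runs_reduce d z R M (Q : _ -> _ -> Prop) :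
  (forall i, (i < 20)%nat -> R i = g i) -> R 22%nat = wrap w z ->
  (forall R', R' d = wrap W z -> (forall i, i <> d -> i <> 22%nat -> R' i = R i) -> Q R' M) ->
  runs w (reduce d) R M 3 Q.
Proof.
  intros Hg HR HQ; unfold reduce.
  apply (runs_le (1 + (1 + 1))); [simpl; lia|].
  apply runs_seq, runs_bin, runs_seq, runs_bin, runs_bin.
  apply HQ; [|intros i Hi Hi2; now rs].
  rs; rewrite HR, !Hg, HgQ, HgH by lia.
  simpl eval_binop; apply wrap_wrap; lia.
Qed.

Lemma sim_instr_runs cj R M I (b : bool) :
  nth_error J (pc cj) = Some I ->
  sim ov nr W len g Mb cj R M -> R rCoin = (if b then 1 else 0)%Z ->
  runs w (sim_instr ov len (pc cj) I) R M 8 (sim ov nr W len g Mb (step J W b cj)).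
Proof.
  intros HI [Sg Sp Sr Sf Sm Sy] HC; pose proof Hgs as Hgs'.
  assert (Hpc : (pc cj < len)%nat) by (apply nth_error_Some; congruence).
  assert (HF : Forall (fun i => (i < nr)%nat) (instr_regs I)).
  { unfold uses_regs in Hregs; rewrite Forall_forall in Hregs.
    apply Hregs; eapply nth_error_In; eauto. }
  pose proof sim_big as Hbig; destruct (pow2_half W ltac:(lia)) as [E2 Hp2].
  assert (Epc : wrap w (Z.of_nat (pc cj + 1)) = Z.of_nat (Nat.min (S (pc cj)) len))
    by (rewrite konst_pc by lia; f_equal; lia).
  unfold step; rewrite HI; destruct I as [d z|o d x y|d x|x y|d|x y l|x y l];
    cbn [instr_regs] in HF; rewrite ?Forall_cons_iff in HF; cbn [sim_instr].
  - destruct HF as [Hd _].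
    apply (runs_le (1 + (3 + 1))); [simpl; lia|].
    apply runs_seq, runs_konst, runs_seq.
    apply (runs_reduce _ z); [intros; rs; auto | now rs |].
    intros R' E1 E3; apply runs_konst; constructor; cbn [pc regs mem].
    + intros i Hi; rs; rewrite E3 by lia; rs; auto.
    + rs; exact Epc.
    + intros i Hi; rs; unfold upd_reg at 1.
      destruct (Nat.eqb_spec i d) as [->|Hne]; [exact E1|].
      rewrite E3 by lia; rs; auto.
    + intros i; unfold upd_reg; destruct (Nat.eqb i d); [apply wrap_fits; lia | auto].
    + auto.
    + auto.
  - destruct HF as (Hd & Hx & Hy & _).
    apply (runs_le (1 + (3 + 1))); [simpl; lia|].
    apply runs_seq, runs_bin, runs_seq.
    apply (runs_reduce _ (eval_binop o (regs cj x) (regs cj y)));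
      [intros; rs; auto | rs; rewrite !Sr by lia; reflexivity |].
    intros R' E1 E3; apply runs_konst; constructor; cbn [pc regs mem].
    + intros i Hi; rs; rewrite E3 by lia; rs; auto.
    + rs; exact Epc.
    + intros i Hi; rs; unfold upd_reg at 1.
      destruct (Nat.eqb_spec i d) as [->|Hne]; [exact E1|].
      rewrite E3 by lia; rs; auto.
    + intros i; unfold upd_reg; destruct (Nat.eqb i d); [apply wrap_fits; lia | auto].
    + auto.
    + auto.
  - destruct HF as (Hd & Hx & _).
    pose proof (Sf x) as Hfx.
    apply (runs_le (7 + 1)); [simpl; lia|].
    apply runs_seq.
    apply (runs_weaken w _ R M 7 7 (fun (R' : nat -> Z) (M' : Z -> Z) => M' = M /\ R' (jreg d) = mem cj (regs cj x) /\
       (forall i, i <> jreg d -> i <> 22%nat -> i <> 23%nat -> R' i = R i)));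
      [lia | |].
    { intros R' M' (-> & E1 & E3); apply runs_konst; constructor; cbn [pc regs mem].
      + intros i Hi; rs; rewrite E3 by lia; auto.
      + rs; exact Epc.
      + intros i Hi; rs; unfold upd_reg.
        destruct (Nat.eqb_spec i d) as [->|Hne]; [exact E1|].
        rewrite E3 by lia; auto.
      + intros i; unfold upd_reg; destruct (Nat.eqb i d); auto.
      + auto.
      + auto. }
    destruct ov; cbn [memrel] in Sy.
    + destruct Sy as (Y1 & Y2 & Y3).
      apply (runs_le (1 + (1 + (3 + 2)))); [simpl; lia|].
      apply runs_seq, runs_bin, runs_seq, runs_fetch, runs_if.
      cbn [holds]; rs; rewrite !Sr, !Sg, HgQ by lia.
      cbn [eval_binop].
      rewrite (wrap_id w (_ + _)) by (try lia; unfold fits in *; lia).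
      pose proof (Y1 _ Hfx) as Y1x.
      destruct (Z.eqb_spec (M (regs cj x + 2 ^ Z.of_nat W)%Z) (g 15%nat)).
      * apply (runs_le (1 + 1)); [simpl; lia|].
        apply runs_seq, runs_bin, runs_fetch; cbn [eval_binop]; rs.
        rewrite Sg, HgQ by lia.
        rewrite (wrap_id w (_ + _)) by (try lia; unfold fits in *; lia).
        repeat split; [|intros; now rs].
        rewrite Y1x; f_equal; lia.
      * apply (runs_le 1); [simpl; lia|].
        apply runs_fetch; rs.
        repeat split; [|intros; now rs].
        rewrite Y1x, Sr by lia; apply Y2; unfold fits in *; lia.
    + destruct Sy as (Y1 & Y2).
      apply (runs_le 1); [simpl; lia|].
      apply runs_fetch; rs; rewrite Sr by lia.
      repeat split; [auto | intros; now rs].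
  - destruct HF as (Hx & Hy & _).
    pose proof (Sf x) as Hfx.
    apply (runs_le (4 + 1)); [simpl; lia|].
    apply runs_seq.
    apply (runs_weaken w _ R M 4 4 (fun R' M' =>
       memrel ov W (g 15%nat) Mb (upd_mem (mem cj) (regs cj x) (regs cj y)) M' /\
       (forall i, i <> 22%nat -> R' i = R i)));
      [lia | |].
    { intros R' M' (E1 & E3); apply runs_konst; constructor; cbn [pc regs mem].
      + intros i Hi; rs; rewrite E3 by lia; auto.
      + rs; exact Epc.
      + intros i Hi; rs; rewrite E3 by lia; auto.
      + auto.
      + intros a Ha; unfold upd_mem; destruct (Z.eqb a (regs cj x)); auto.
      + exact E1. }
    destruct ov; cbn [memrel] in Sy |- *.
    + destruct Sy as (Y1 & Y2 & Y3).
      apply (runs_le (1 + (1 + (1 + 1)))); [simpl; lia|].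
      apply runs_seq, runs_bin, runs_seq, runs_store, runs_seq, runs_bin, runs_store.
      cbn [eval_binop]; rs; rewrite !Sr, !Sg, HgQ by lia.
      rewrite (wrap_id w (regs cj x + _)) by (try lia; unfold fits in *; lia).
      rewrite (wrap_id w (regs cj x + _ + _)) by (try lia; unfold fits in *; lia).
      split; [|intros; now rs].
      split; [|split].
      * intros a Ha; destruct (Z.eq_dec a (regs cj x)) as [->|Hne].
        -- rewrite updm_same, (updm_diff _ _ _ (_ + 2 ^ _)%Z), updm_same, Z.eqb_refl
             by (unfold fits in *; lia).
           replace (regs cj x + 2 * 2 ^ Z.of_nat W)%Z
             with (regs cj x + 2 ^ Z.of_nat W + 2 ^ Z.of_nat W)%Z by lia.
           now rewrite updm_same.
        (* Addresses of [W] bits differ by less than 2^W, so the stamp cell of one address is never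
           the value cell of another. *)
        -- rewrite !updm_diff by (unfold fits in *; lia).
           now apply Y1.
      * intros a Ha; rewrite !updm_diff by (unfold fits in *; lia); auto.
      * intros a Ha; rewrite updm_diff by (unfold fits in *; lia).
        destruct (Z.eq_dec a (regs cj x)) as [->|Hne].
        -- rewrite updm_same; specialize (Hgs' eq_refl); lia.
        -- rewrite updm_diff by lia; auto.
    + destruct Sy as (Y1 & Y2).
      apply (runs_le 1); [simpl; lia|].
      apply runs_store; rewrite !Sr by lia.
      repeat split.
      * intros a Ha; unfold upd_mem; destruct (Z.eqb a (regs cj x)); auto.
      * intros a Ha; rewrite updm_diff by congruence; auto.
  - destruct HF as (Hd & _).
    apply (runs_le (1 + 1)); [simpl; lia|].
    apply runs_seq, runs_bin, runs_konst.
    cbn [eval_binop]; rewrite HC, Z.land_diag.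
    (* This needs [2 <= W]: a signed word of one bit does not hold 1. *)
    assert (Hb : fits W (if b then 1 else 0)%Z).
    { assert (2 ^ 1 <= 2 ^ (Z.of_nat W - 1))%Z by (apply Z.pow_le_mono_r; lia).
      unfold fits; destruct b; lia. }
    rewrite wrap_id by (try lia; now apply fits_up).
    constructor; cbn [pc regs mem].
    + intros i Hi; rs; auto.
    + rs; exact Epc.
    + intros i Hi; destruct (Nat.eq_dec i d) as [->|Hn]; rs; auto.
    + intros i; unfold upd_reg; destruct (Nat.eqb i d); auto.
    + auto.
    + auto.
  - destruct HF as (Hx & Hy & _).
    apply (runs_le (1 + 2)); [simpl; lia|].
    apply runs_if; cbn [holds]; rewrite !Sr by lia.
    destruct (Z.eqb (regs cj x) (regs cj y)); apply runs_konst; constructor; cbn [pc regs mem]; (try assumption);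
      (try (intros i Hi; rs; now auto)); rs; first [exact Epc | apply konst_pc; lia].
  - destruct HF as (Hx & Hy & _).
    apply (runs_le (1 + 2)); [simpl; lia|].
    apply runs_if; cbn [holds]; rewrite !Sr by lia.
    destruct (Z.ltb (regs cj x) (regs cj y)); apply runs_konst; constructor; cbn [pc regs mem]; (try assumption);
      (try (intros i Hi; rs; now auto)); rs; first [exact Epc | apply konst_pc; lia].
Qed.

Lemma sim_coin cj R M d v :
  (20 < d < 40)%nat -> sim ov nr W len g Mb cj R M ->
  sim ov nr W len g Mb cj (upd_reg R d v) M.
Proof.
  intros Hd [Sg Sp Sr Sf Sm Sy]; constructor; auto; intros; rs; auto.
Qed.

Lemma dispatch_runs cj R M (b : bool) J1 J2 :
  J = J1 ++ J2 -> (length J1 <= pc cj < len)%nat ->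
  sim ov nr W len g Mb cj R M -> R rCoin = (if b then 1 else 0)%Z ->
  runs w (dispatch ov len (length J1) J2) R M (length J2 * 3 + 8)
    (sim ov nr W len g Mb (step J W b cj)).
Proof.
  revert R M J1; induction J2 as [|ins J2 IH]; intros R M J1 HJ Hpc HS HC.
  - rewrite app_nil_r in HJ; subst J1; fold len in Hpc; lia.
  - cbn [dispatch].
    apply (runs_le (1 + ((length J2 * 3 + 8) + 2))); [simpl; lia|].
    apply runs_seq, runs_konst, runs_if; cbn [holds]; rs.
    rewrite (sim_pc _ _ _ _ _ _ _ _ _ HS), konst_pc by lia.
    destruct (Z.eqb_spec (Z.of_nat (Nat.min (pc cj) len)) (Z.of_nat (length J1))) as [E|E].
    + apply (runs_le 8); [simpl; lia|].
      replace (length J1) with (pc cj) by lia.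
      apply sim_instr_runs; [|apply sim_coin; auto; lia | now rs].
      rewrite HJ; apply nth_error_mid; lia.
    + replace (S (length J1)) with (length (J1 ++ [ins])) by (rewrite length_app; simpl; lia).
      apply IH; [now rewrite <- app_assoc | rewrite length_app; simpl; lia | | now rs].
      apply sim_coin; auto; lia.
Qed.

Lemma halted_step_pc cj : halted J cj = false <-> (pc cj < len)%nat.
Proof. unfold halted, len; apply Nat.leb_gt. Qed.

(** [G] is the cost of what follows the loop; it is a function of the final simulated configuration
    and hence averaged over the coins leading there. A round costs at most [len * 3 + 11]: test,
    toss, dispatch and jump back. The 2 pays for leaving the loop. *)
Lemma sim_loop_good P A p t (G : config -> R) cj R M :
  code_at P p (sim_loop ov J) ->
  sim ov nr W len g Mb cj R M ->
  (forall c, 0 <= G c) ->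
  (forall bs R' M', let c := exec J W bs cj in
     halted J c = true -> sim ov nr W len g Mb c R' M' ->
     good P w A t (Config (p + size (sim_loop ov J)) R' M') (G c)) ->
  good P w A t (Config p R M)
    (INR (len * 3 + 11) * mean_steps J W t cj + 2 +
     coin_mean t (fun bs => let c := exec J W bs cj in
                            if halted J c then G c else 0)).
Proof.
  intros Hp HS HG; revert cj R M HS.
  pose proof Hp as (Ha & Hb & (Ht & Hd) & He).
  assert (HN : forall n c, 0 <= coin_mean n (fun bs =>
             if halted J (exec J W bs c) then G (exec J W bs c) else 0)).
  { intros n c; apply coin_mean_nonneg; intros bs.
    destruct (halted J (exec J W bs c)); [apply HG | lra]. }
  induction t as [|t IH]; intros cj R M HS Hk.
  all: assert (Hq : holds (TLt rPc rLen) R = Z.ltb (Z.of_nat (Nat.min (pc cj) len)) (Z.of_nat len))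
    by (simpl; rewrite (sim_pc _ _ _ _ _ _ _ _ _ HS), (sim_glob _ _ _ _ _ _ _ _ _ HS), Hgl by lia;
        reflexivity).
  all: destruct (halted J cj) eqn:Hh.
  (* If the simulated machine has halted, [exec] stays put whatever the coins are, and only the exit
     of the loop is paid; this is the same for both cutoffs. *)
  1, 3: rewrite (mean_steps_halted _ _ _ _ Hh);
    rewrite (coin_mean_ext _ _ (fun _ => G cj)), coin_mean_const;
    [|intros [|b bs]; simpl; rewrite ?Hh; reflexivity];
    rewrite Rmult_0_r, Rplus_0_l; change 2 with (INR 2);
    apply (good_reach _ _ _ _ _ _ (Config (p + size (sim_loop ov J)) R M));
    [|apply HG | apply (Hk []); auto];
    (econstructor; [eapply halted_at; eauto | |]);
    [intros b; rewrite (step_branch _ _ _ _ _ _ _ _ Ha), Hq;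
       apply Nat.leb_le in Hh; fold len in Hh;
       rewrite (proj2 (Z.ltb_ge _ _)) by lia; reflexivity
    | apply reach_1;
      [eapply halted_at; rewrite <- Nat.add_1_r; eauto
      |intros b; rewrite <- Nat.add_1_r at 1; rewrite (step_goto _ _ _ _ _ _ _ Hb);
       unfold sim_loop; simpl size; f_equal; lia]].
  - apply good_0; [eapply halted_at; eauto|].
    simpl; rewrite Hh; unfold mean_steps; simpl; lra.
  - pose proof (proj1 (halted_step_pc cj) Hh) as Hpc.
    rewrite mean_steps_S by easy; simpl coin_mean; rewrite Hh.
    (* [V b] is the cost after the coin [b]: dispatch and jump back, then the bound of the induction
       hypothesis. *)
    set (V := fun b => INR (len * 3 + 9) +
      (INR (len * 3 + 11) * mean_steps J W t (step J W b cj) + 2 +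
       coin_mean t (fun bs => if halted J (exec J W bs (step J W b cj))
                              then G (exec J W bs (step J W b cj)) else 0))).
    apply (good_anti _ _ _ (S t) (S t) _ (INR 1 + (1 + fair V))); [lia | |].
    { unfold V, fair; rewrite !plus_INR; simpl; lra. }
    assert (HV : forall b, 0 <= V b).
    { intros b; unfold V.
      pose proof (mean_steps_nonneg J W t (step J W b cj)).
      pose proof (pos_INR (len * 3 + 11)); pose proof (pos_INR (len * 3 + 9)).
      pose proof (HN t (step J W b cj)).
      nra. }
    eapply good_reach; [apply reach_1; [eapply halted_at; eauto|] | |].
    { intros b; rewrite (step_branch _ _ _ _ _ _ _ _ Ha), Hq.
      rewrite (proj2 (Z.ltb_lt _ _)) by lia; reflexivity. }
    { unfold fair; pose proof (HV true); pose proof (HV false); lra. }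
    apply good_fair; [eapply halted_at; eauto|]; intros b.
    unfold step at 1; simpl; simpl in Ht; rewrite Ht.
    replace (S (p + 2)) with (p + 2 + 1)%nat by lia.
    unfold V.
    assert (HS' : sim ov nr W len g Mb cj
                    (upd_reg R rCoin (if b then 1 else 0)%Z) M)
      by (apply sim_coin; auto; lia).
    pose proof (dispatch_runs cj _ M b [] J eq_refl ltac:(simpl; lia) HS'
                  ltac:(now rs)) as Hrun.
    fold len in Hrun; simpl length in Hrun.
    replace (len * 3 + 9)%nat with (len * 3 + 8 + 1)%nat by lia.
    rewrite plus_INR, Rplus_assoc.
    simpl size in Hd, He.
    eapply good_runs; [exact Hrun | exact Hd | |].
    { specialize (HV b); unfold V in HV.
      replace (len * 3 + 9)%nat with (len * 3 + 8 + 1)%nat in HV by lia.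
      simpl INR at 1.
      pose proof (mean_steps_nonneg J W t (step J W b cj)).
      pose proof (pos_INR (len * 3 + 11)).
      pose proof (HN t (step J W b cj)).
      nra. }
    intros R' M' HS2.
    assert (He' : nth_error P (p + 2 + 1 + size (dispatch ov len 0 J)) = Some (goto p))
      by (rewrite <- He; f_equal; fold len; lia).
    eapply good_reach; [apply reach_1| |].
    { eapply halted_at, He'. }
    { intros b'; apply step_goto, He'. }
    { pose proof (mean_steps_nonneg J W t (step J W b cj)).
      pose proof (pos_INR (len * 3 + 11)).
      pose proof (HN t (step J W b cj)).
      nra. }
    apply IH; [exact HS2|].
    intros bs R2 M2 c Hc HS3.
    apply (good_anti _ _ _ (S t) t _ (G c)); [lia | lra|].
    (* Prepending [b] turns a run from the next configuration into a run from [cj], where the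
       continuation is known. *)
    pose proof (Hk (b :: bs) R2 M2) as Hk'; cbn [exec] in Hk'; rewrite Hh in Hk'.
    now apply Hk'.
Qed.

End Simulation.

(** * The text and the queries of the reduction *)

Local Open Scope Z_scope.

Notation count a l := (count_occ Nat.eq_dec l a).

Definition zsum (l : list Z) : Z := fold_right Z.add 0 l.

(* The number [x] has [k] digits in base [B], followed by one signed digit. *)
Fixpoint digits (B : Z) (k : nat) (x : Z) : list Z :=
  match k with
  | O => [x]
  | S k' => x mod B :: digits B k' (x / B)
  end.

Fixpoint digit_diffs (B c : Z) (k : nat) (x y : Z) : list Z :=
  match k with
  | O => [x - y + c]
  | S k' => x mod B - y mod B + c :: digit_diffs B c k' (x / B) (y / B)
  end.

(* Digitwise sum of [u] and [c], where the bits of [e] are the carries out of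
   the digits and [cin] is the carry into the first one. *)
Fixpoint carried (B c : Z) (k : nat) (u e cin : Z) : list Z :=
  match k with
  | O => [u + c + cin]
  | S k' => u mod B + c + cin - B * (e mod 2) :: carried B c k' (u / B) (e / 2) (e mod 2)
  end.

Lemma length_digit_diffs B c k x y : length (digit_diffs B c k x y) = S k.
Proof. revert x y; induction k; intros; simpl; auto. Qed.

Lemma length_carried B c k u e cin : length (carried B c k u e cin) = S k.
Proof. revert u e cin; induction k; intros; simpl; auto. Qed.

Lemma nth_digit_diffs B c k x y a : (a <= k)%nat ->
  nth a (digit_diffs B c k x y) 0 = nth a (digits B k x) 0 - nth a (digits B k y) 0 + c.
Proof.
  revert x y a; induction k as [|k IH]; intros x y [|a] Ha; simpl; try lia.
  apply IH; lia.
Qed.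

(** The digits determine the carries: the carry out of the lowest digit is x/B - y/B - u/B, and it
    is 0 or 1 because remainders lie in [0, B). The shift [c] cancels. Nothing is carried out of the
    leading digit, so [k] bits suffice. *)
Lemma carried_digit_diffs B c k u x y cin : 0 < B -> 0 <= cin <= 1 ->
  (exists e, 0 <= e < 2 ^ Z.of_nat k /\ carried B c k u e cin = digit_diffs B c k x y) <->
  x - y = u + cin.
Proof.
  intros HB; revert u x y cin; induction k as [|k IH]; intros u x y cin Hc.
  - simpl; split; [intros (e & He & E); injection E; lia|].
    intros E; exists 0; split; [lia | f_equal; lia].
  - rewrite Nat2Z.inj_succ, Z.pow_succ_r by lia; cbn [carried digit_diffs].
    pose proof (Z.div_mod x B ltac:(lia)); pose proof (Z.mod_pos_bound x B HB).
    pose proof (Z.div_mod y B ltac:(lia)); pose proof (Z.mod_pos_bound y B HB).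
    pose proof (Z.div_mod u B ltac:(lia)); pose proof (Z.mod_pos_bound u B HB).
    split.
    + intros (e & He & E); injection E as E1 E2.
      pose proof (Z.mod_pos_bound e 2 ltac:(lia)).
      assert (E3 : x / B - y / B = u / B + e mod 2).
      { apply IH; [lia|]; exists (e / 2); split; [|exact E2].
        pose proof (Z.div_mod e 2 ltac:(lia)); lia. }
      nia.
    + intros E.
      assert (Hb : exists b, 0 <= b <= 1 /\ x mod B = y mod B + u mod B + cin - B * b /\
                              x / B - y / B = u / B + b).
      { exists ((x / B) - (y / B) - (u / B)).
        assert (Eb : B * (x / B - y / B - u / B) = cin + y mod B + u mod B - x mod B)
          by nia.
        split; [|split]; nia. }
      destruct Hb as (b & Hb & E1 & E2).
      destruct (proj2 (IH (u / B) (x / B) (y / B) b Hb) E2) as (e & He & E3).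
      (* The lowest bit is the carry out of the lowest digit. *)
      exists (2 * e + b).
      assert (Em : (2 * e + b) mod 2 = b)
        by (rewrite (Z.add_comm (2 * e)), (Z.mul_comm 2 e), Z.mod_add by lia;
            apply Z.mod_small; lia).
      assert (Ed : (2 * e + b) / 2 = e)
        by (pose proof (Z.div_mod (2 * e + b) 2 ltac:(lia)); lia).
      rewrite Em, Ed, E3; split; [lia | f_equal; lia].
Qed.

(** The range is closed because an input may have absolute value n = B^(k+1); the leading signed
    digit then lies in [-B, B]. *)
Definition bounded (B : Z) (k : nat) (x : Z) : Prop :=
  - B ^ Z.of_nat (S k) <= x <= B ^ Z.of_nat (S k).

Lemma bounded_div B k x : 0 < B -> bounded B (S k) x -> bounded B k (x / B).
Proof.
  unfold bounded; intros HB; rewrite (Nat2Z.inj_succ (S k)), Z.pow_succ_r by lia.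
  set (q := B ^ Z.of_nat (S k)); intros H.
  replace (- q) with (- (B * q) / B) by (rewrite <- Z.mul_opp_r, Z.mul_comm; apply Z.div_mul; lia).
  replace q with (B * q / B) at 2 by (rewrite Z.mul_comm; apply Z.div_mul; lia).
  split; apply Z.div_le_mono; lia.
Qed.

Lemma bounded_0 B x : bounded B 0 x -> - B <= x <= B.
Proof. unfold bounded; change (Z.of_nat 1) with 1; rewrite Z.pow_1_r; auto. Qed.

(** Leading digits differ by at most 2B and the others by less than B; the shift 3B makes all
    entries usable as letter counts. *)
Lemma digit_diffs_range B k x y : 0 < B -> bounded B k x -> bounded B k y ->
  Forall (fun z => 0 <= z <= 5 * B) (digit_diffs B (3 * B) k x y).
Proof.
  intros HB; revert x y; induction k as [|k IH]; intros x y Hx Hy;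
    cbn [digit_diffs]; constructor; auto.
  - apply bounded_0 in Hx; apply bounded_0 in Hy; lia.
  - pose proof (Z.mod_pos_bound x B HB); pose proof (Z.mod_pos_bound y B HB); lia.
  - apply IH; now apply bounded_div.
Qed.

(** As [1 <= h], the shift 3Bh absorbs both a negative leading digit and the B subtracted for a
    carry. *)
Lemma carried_range B h k u e cin : 0 < B -> 1 <= h -> bounded B k u -> 0 <= cin <= 1 ->
  Forall (fun z => 0 <= z <= 5 * B * h) (carried B (3 * B * h) k u e cin).
Proof.
  intros HB Hh; revert u e cin; induction k as [|k IH]; intros u e cin Hu Hc;
    cbn [carried]; constructor; auto.
  - apply bounded_0 in Hu; nia.
  - pose proof (Z.mod_pos_bound u B HB); pose proof (Z.mod_pos_bound e 2 ltac:(lia)); nia.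
  - apply IH; [now apply bounded_div|]; pose proof (Z.mod_pos_bound e 2 ltac:(lia)); lia.
Qed.

Lemma zsum_range l c : Forall (fun z => 0 <= z <= c) l -> 0 <= zsum l <= c * Z.of_nat (length l).
Proof.
  induction 1; cbn [zsum fold_right length]; [lia|]; fold (zsum l); lia.
Qed.

(** * Construction of the text and its letter counts *)

Fixpoint spell (a : nat) (l : list Z) : list nat :=
  match l with
  | [] => []
  | z :: l' => repeat a (Z.to_nat z) ++ spell (S a) l'
  end.

Lemma count_repeat a b n : count a (repeat b n) = if Nat.eqb a b then n else 0%nat.
Proof.
  destruct (Nat.eqb_spec a b) as [->|H]; [now apply count_occ_repeat_eq|].
  apply count_occ_repeat_neq; congruence.
Qed.

Lemma count_spell a l c : (a <= c)%nat -> count c (spell a l) = Z.to_nat (nth (c - a) l 0).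
Proof.
  revert a; induction l as [|z l IH]; intros a Hc; simpl.
  - destruct (c - a)%nat; reflexivity.
  - rewrite count_occ_app, count_repeat.
    destruct (Nat.eqb_spec c a) as [->|Hn].
    + rewrite Nat.sub_diag.
      assert (E : forall l b, (a < b)%nat -> count a (spell b l) = 0%nat).
      { clear; intros l; induction l as [|z l IH]; intros b Hb; simpl; auto.
        rewrite count_occ_app, count_repeat, IH by lia.
        destruct (Nat.eqb_spec a b); lia. }
      rewrite E; lia.
    + rewrite IH by lia; replace (c - a)%nat with (S (c - S a)) by lia; reflexivity.
Qed.

Lemma length_spell a l : Forall (fun z => 0 <= z) l -> Z.of_nat (length (spell a l)) = zsum l.
Proof.
  intros H; revert a; induction H; intros a; simpl; [reflexivity|].
  rewrite length_app, repeat_length, Nat2Z.inj_add, IHForall; fold (zsum l); lia.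
Qed.

Lemma spell_range a l : Forall (fun c => (a <= c < a + length l)%nat) (spell a l).
Proof.
  revert a; induction l as [|z l IH]; intros a; simpl; [constructor|].
  apply Forall_app; split.
  - apply Forall_forall; intros c Hc; apply repeat_spec in Hc; lia.
  - eapply Forall_impl; [|apply IH]; cbv beta; intros; lia.
Qed.

(** Each of the k + 1 digit letters occurs at most 5B times in a block, so there is always room for
    the filler. *)
Definition body_length (B : Z) (k : nat) : Z := 6 * (Z.of_nat k + 1) * B.

Definition block (B : Z) (k : nat) (x y : Z) : list nat :=
  let d := digit_diffs B (3 * B) k y x in
  spell 0 d ++ repeat (k + 1)%nat (Z.to_nat (body_length B k - zsum d)) ++ [(k + 2)%nat].

Definition sum_text (B : Z) (k : nat) (xs : list Z) (j : nat) : list nat :=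
  flat_map (fun i => block B k (nth i xs 0) (nth (S i) xs 0)) (seq 0 j).

(** Describes [h] blocks without the last separator, hence [h - 1] separators. The index [h - 1]
    into [xs] is x_h of the 1-based problem. *)
Definition sum_query (B : Z) (k : nat) (xs : list Z) (h : nat) (e : Z) : list Z :=
  let d := carried B (3 * B * Z.of_nat h) k (nth (h - 1) xs 0) e 0 in
  d ++ [body_length B k * Z.of_nat h - zsum d; Z.of_nat h - 1].

Lemma sum_text_S B k xs j :
  sum_text B k xs (S j) = sum_text B k xs j ++ block B k (nth j xs 0) (nth (S j) xs 0).
Proof.
  unfold sum_text; rewrite seq_S, flat_map_app; simpl; now rewrite app_nil_r.
Qed.

Lemma sum_text_app B k xs j i : exists V, sum_text B k xs (j + i) = sum_text B k xs j ++ V.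
Proof.
  unfold sum_text; rewrite seq_app, flat_map_app; eauto.
Qed.

Lemma parikh_sum r l : Forall (fun a => (a < r)%nat) l ->
  list_sum (parikh r l) = length l.
Proof.
  intros H; unfold parikh; induction H as [|a l Ha Hl IH].
  - simpl; induction (seq 0 r); simpl; auto.
  - simpl length; rewrite <- IH; clear IH.
    (* Over any interval of letters the new letter adds 1 iff it lies in the interval; the left end
       has to vary in the induction. *)
    assert (E : forall n s, (list_sum (map (count_occ Nat.eq_dec (a :: l)) (seq s n)) =
      list_sum (map (count_occ Nat.eq_dec l) (seq s n)) +
      (if andb (Nat.leb s a) (Nat.ltb a (s + n)) then 1 else 0))%nat).
    { induction n as [|n IHn]; intros s.
      - destruct (Nat.leb_spec s a), (Nat.ltb_spec a (s + 0)); simpl; lia.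
      - cbn [seq map]; unfold list_sum in *; cbn [fold_right]; rewrite IHn; simpl count_occ at 1.
        destruct (Nat.leb_spec s a), (Nat.ltb_spec a (s + S n)),
          (Nat.leb_spec (S s) a), (Nat.ltb_spec a (S s + n)),
          (Nat.eq_dec a s); simpl; lia. }
    rewrite (E r 0%nat); destruct (Nat.ltb_spec a (0 + r)); simpl; lia.
Qed.

(** * Windows of the text and matches of a query *)

Section Text.

Variables (B : Z) (k : nat) (xs : list Z).
Hypothesis HB : 0 < B.
Hypothesis Hxs : forall i, bounded B k (nth i xs 0).

Let x i := nth i xs 0.
Let T := sum_text B k xs.
Let L := Z.to_nat (body_length B k).
Let M := S L.

Lemma body_length_pos : 0 < body_length B k.
Proof. unfold body_length; nia. Qed.

Lemma L_pos : (1 <= L)%nat.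
Proof. pose proof body_length_pos; unfold L; lia. Qed.

Lemma diffs_nonneg i :
  Forall (fun z => 0 <= z) (digit_diffs B (3 * B) k (x (S i)) (x i)).
Proof.
  eapply Forall_impl; [|apply digit_diffs_range; auto; apply Hxs]; cbv beta; intros; lia.
Qed.

Lemma diffs_sum i :
  0 <= zsum (digit_diffs B (3 * B) k (x (S i)) (x i)) <= body_length B k.
Proof.
  pose proof (zsum_range _ _ (digit_diffs_range B k (x (S i)) (x i) HB (Hxs _) (Hxs _))) as H.
  rewrite length_digit_diffs in H; unfold body_length; nia.
Qed.

Lemma block_shape i : exists b, block B k (x i) (x (S i)) = b ++ [(k + 2)%nat] /\
  length b = L /\ Forall (fun a => (a < k + 2)%nat) b.
Proof.
  unfold block; rewrite app_assoc; eexists; split; [reflexivity|]; split.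
  - rewrite length_app, repeat_length.
    pose proof (length_spell 0 _ (diffs_nonneg i)).
    pose proof (diffs_sum i); unfold L; lia.
  - apply Forall_app; split.
    + eapply Forall_impl; [|apply spell_range]; simpl; intros a Ha.
      rewrite length_digit_diffs in Ha; lia.
    + apply Forall_forall; intros c Hc; apply repeat_spec in Hc; lia.
Qed.

Lemma length_T j : length (T j) = (j * M)%nat.
Proof.
  induction j as [|j IH]; [reflexivity|].
  unfold T in *; rewrite sum_text_S, length_app, IH.
  destruct (block_shape j) as (b & E & Hb & _); unfold x in E.
  rewrite E, length_app, Hb; unfold M; simpl; lia.
Qed.

Lemma T_letters j : Forall (fun a => (a < k + 3)%nat) (T j).
Proof.
  induction j as [|j IH]; [constructor|].
  unfold T in *; rewrite sum_text_S; apply Forall_app; split; [exact IH|].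
  destruct (block_shape j) as (b & E & _ & Hb); unfold x in E; rewrite E.
  apply Forall_app; split; [|repeat constructor; lia].
  eapply Forall_impl; [|exact Hb]; cbv beta; intros; lia.
Qed.

Lemma count_T a j : (a <= k)%nat ->
  Z.of_nat (count a (T j)) =
  nth a (digits B k (x j)) 0 - nth a (digits B k (x 0)) 0 + 3 * B * Z.of_nat j.
Proof.
  intros Ha; induction j as [|j IH]; [simpl; lia|].
  unfold T in *; rewrite sum_text_S, count_occ_app, Nat2Z.inj_add, IH.
  unfold block; rewrite !count_occ_app, count_spell, count_repeat by lia.
  rewrite Nat.sub_0_r.
  destruct (Nat.eqb_spec a (k + 1)); [lia|].
  simpl count_occ; destruct (Nat.eq_dec (k + 2) a); [lia|].
  assert (H : 0 <= nth a (digit_diffs B (3 * B) k (x (S j)) (x j)) 0).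
  { pose proof (diffs_nonneg j) as H; rewrite Forall_forall in H; apply H, nth_In.
    rewrite length_digit_diffs; lia. }
  rewrite nth_digit_diffs in H by lia.
  rewrite nth_digit_diffs by lia; fold (x j) (x (S j)); lia.
Qed.

Lemma count_sep_T j : count (k + 2)%nat (T j) = j.
Proof.
  induction j as [|j IH]; [reflexivity|].
  unfold T in *; rewrite sum_text_S, count_occ_app, IH.
  destruct (block_shape j) as (b & E & _ & Hb); unfold x in E; rewrite E, count_occ_app.
  rewrite (proj1 (count_occ_not_In Nat.eq_dec b (k + 2)%nat)).
  - simpl; destruct (Nat.eq_dec (k + 2) (k + 2)); lia.
  - intros Hi; rewrite Forall_forall in Hb; specialize (Hb _ Hi); lia.
Qed.

(** A block of length [M] has its only separator at its end, so a prefix contains one per completed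
    block. *)
Lemma count_sep_prefix j p : (p <= j * M)%nat ->
  count (k + 2)%nat (firstn p (T j)) = (p / M)%nat.
Proof.
  induction j as [|j IH]; intros Hp.
  - replace p with 0%nat by lia; reflexivity.
  - assert (ET : T (S j) = T j ++ block B k (x j) (x (S j))) by apply sum_text_S.
    rewrite ET, firstn_app, count_occ_app, length_T.
    destruct (Nat.le_gt_cases p (j * M)) as [Hle|Hgt].
    + replace (p - j * M)%nat with 0%nat by lia.
      rewrite firstn_O, IH by lia; apply Nat.add_0_r.
    + rewrite firstn_all2 by (rewrite length_T; lia).
      rewrite count_sep_T.
      destruct (block_shape j) as (b & E & Hl & Hb); rewrite E.
      assert (Hb0 : forall q, count (k + 2)%nat (firstn q b) = 0%nat).
      { intros q; apply count_occ_not_In; intros Hi.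
        rewrite Forall_forall in Hb; specialize (Hb (k + 2)%nat).
        rewrite <- (firstn_skipn q b), in_app_iff in Hb; intuition lia. }
      destruct (Nat.eq_dec p (S j * M)) as [->|Hne].
      * rewrite firstn_all2 by (rewrite length_app, Hl; unfold M in *; cbn [length]; nia).
        rewrite count_occ_app, <- (firstn_all b), Hb0.
        rewrite Nat.div_mul by (unfold M; lia).
        simpl; destruct (Nat.eq_dec (k + 2) (k + 2)); lia.
      * rewrite firstn_app, Hl, count_occ_app, Hb0.
        replace (p - j * M - L)%nat with 0%nat by (unfold M in *; nia).
        rewrite firstn_O; simpl count_occ; rewrite !Nat.add_0_r.
        apply Nat.div_unique with (p - j * M)%nat; unfold M in *; nia.
Qed.

Lemma firstn_T nb j : (j <= nb)%nat -> firstn (j * M) (T nb) = T j.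
Proof.
  intros H; replace nb with (j + (nb - j))%nat by lia.
  destruct (sum_text_app B k xs j (nb - j)) as [V HV]; unfold T; rewrite HV.
  rewrite firstn_app; fold T; rewrite length_T, Nat.sub_diag, <- length_T, firstn_all.
  apply app_nil_r.
Qed.

(* One letter before the end of a block the number of separators has not yet
   increased, so the letter dropped is a separator. *)
Lemma count_before_sep nb j a : (1 <= j <= nb)%nat -> (a <= k)%nat ->
  count a (firstn (j * M - 1) (T nb)) = count a (T j).
Proof.
  intros Hj Ha.
  pose proof (firstn_T nb j ltac:(lia)) as E.
  assert (Hlen : (j * M - 1 < length (T nb))%nat) by (rewrite length_T; unfold M in *; nia).
  destruct (nth_error (T nb) (j * M - 1)) as [c|] eqn:Ec;
    [|apply nth_error_None in Ec; lia].
  assert (E1 : firstn (j * M) (T nb) = firstn (j * M - 1) (T nb) ++ [c]).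
  { replace (j * M)%nat with (S (j * M - 1)) at 1 by (unfold M in *; nia).
    clear -Ec; revert Ec; generalize (j * M - 1)%nat; generalize (T nb).
    induction l as [|y l IH]; intros [|n] Ec; simpl in *; try discriminate.
    - now injection Ec as ->.
    - f_equal; now apply IH. }
  assert (Hs : count (k + 2)%nat (firstn (j * M - 1) (T nb)) = (j - 1)%nat).
  { rewrite count_sep_prefix by (unfold M in *; nia).
    symmetry; apply Nat.div_unique with L; unfold M; nia. }
  pose proof (count_sep_T j) as Hs2; rewrite <- E, E1, count_occ_app, Hs in Hs2.
  rewrite <- E, E1, count_occ_app; simpl in Hs2 |- *.
  destruct (Nat.eq_dec c (k + 2)) as [->|]; [|lia].
  destruct (Nat.eq_dec (k + 2) a); lia.
Qed.

(** A difference of two prefix counts: [j + h] blocks without the final separator, minus [j]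
    blocks. *)
Lemma count_window nb U S' V j h a :
  T nb = U ++ S' ++ V -> length U = (j * M)%nat -> length S' = (h * M - 1)%nat ->
  (1 <= h)%nat -> (a <= k)%nat ->
  Z.of_nat (count a S') = nth a (digit_diffs B (3 * B * Z.of_nat h) k (x (j + h)) (x j)) 0.
Proof.
  intros E HU HS Hh Ha.
  assert (Hn : (j + h <= nb)%nat).
  { apply (f_equal (@length nat)) in E; rewrite !length_app, length_T, HU, HS in E.
    pose proof L_pos; unfold M in *; nia. }
  assert (E1 : count a (firstn ((j + h) * M - 1) (T nb)) = (count a U + count a S')%nat).
  { rewrite E, app_assoc.
    replace ((j + h) * M - 1)%nat with (length (U ++ S'))
      by (rewrite length_app, HU, HS; unfold M in *; nia).
    rewrite firstn_app, Nat.sub_diag, firstn_all; simpl.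
    rewrite app_nil_r; apply count_occ_app. }
  assert (E2 : U = T j).
  { rewrite <- (firstn_T nb j) by lia; rewrite E, <- HU.
    rewrite firstn_app, Nat.sub_diag, firstn_all; simpl; now rewrite app_nil_r. }
  rewrite count_before_sep in E1 by lia.
  apply (f_equal Z.of_nat) in E1; rewrite Nat2Z.inj_add, E2, !count_T in E1 by lia.
  rewrite nth_digit_diffs by lia; lia.
Qed.

Lemma count_sep_window nb U S' V :
  T nb = U ++ S' ++ V ->
  count (k + 2)%nat S' = ((length U + length S') / M - length U / M)%nat.
Proof.
  intros E.
  pose proof (f_equal (@length nat) E) as El; rewrite !length_app, length_T in El.
  pose proof (count_sep_prefix nb (length U) ltac:(lia)) as H1.
  pose proof (count_sep_prefix nb (length U + length S') ltac:(lia)) as H2.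
  rewrite E in H1, H2.
  rewrite firstn_app, Nat.sub_diag, firstn_all, firstn_O, app_nil_r in H1.
  rewrite app_assoc, <- length_app, firstn_app, Nat.sub_diag, firstn_all,
    firstn_O, app_nil_r, count_occ_app, length_app in H2.
  rewrite <- H1, <- H2; lia.
Qed.

Lemma sum_query_range h e : (1 <= h)%nat ->
  Forall (fun z => 0 <= z <= body_length B k * Z.of_nat h) (sum_query B k xs h e).
Proof.
  intros Hh; unfold sum_query.
  pose proof (carried_range B (Z.of_nat h) k (nth (h - 1) xs 0) e 0 HB ltac:(lia)
                (Hxs _) ltac:(lia)) as Hr.
  pose proof (zsum_range _ _ Hr) as Hz; rewrite length_carried in Hz.
  assert (H1 : 1 * Z.of_nat h <= B * Z.of_nat h) by (apply Z.mul_le_mono_nonneg_r; lia).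
  assert (H2 : 0 <= Z.of_nat k * (B * Z.of_nat h)) by nia.
  replace (body_length B k * Z.of_nat h)
    with (6 * (Z.of_nat k * (B * Z.of_nat h)) + 6 * (B * Z.of_nat h))
    by (unfold body_length; ring).
  replace (5 * B * Z.of_nat h * Z.of_nat (S k))
    with (5 * (Z.of_nat k * (B * Z.of_nat h)) + 5 * (B * Z.of_nat h)) in Hz
    by (rewrite Nat2Z.inj_succ; ring).
  apply Forall_app; split; [|repeat constructor; lia].
  eapply Forall_impl; [|exact Hr]; cbv beta; intros; lia.
Qed.

Lemma list_sum_to_nat l : Forall (fun z => 0 <= z) l ->
  Z.of_nat (list_sum (map Z.to_nat l)) = zsum l.
Proof.
  induction 1; [reflexivity|]; unfold list_sum, zsum in *; simpl.
  rewrite Nat2Z.inj_add; lia.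
Qed.

Lemma zsum_app l l' : zsum (l ++ l') = zsum l + zsum l'.
Proof. induction l as [|z l IH]; simpl in *; [reflexivity | unfold zsum in *; lia]. Qed.

Lemma nth_parikh r l a : (a < r)%nat -> nth a (parikh r l) 0%nat = count a l.
Proof.
  intros H; unfold parikh.
  rewrite (nth_indep _ 0%nat (count 0%nat l)) by (rewrite length_map, length_seq; lia).
  rewrite (map_nth (fun a => count a l)), seq_nth by lia; reflexivity.
Qed.

Lemma nth_sum_query h e a : (a <= k)%nat ->
  nth a (sum_query B k xs h e) 0 =
  nth a (carried B (3 * B * Z.of_nat h) k (nth (h - 1) xs 0) e 0) 0.
Proof. intros Ha; unfold sum_query; apply app_nth1; rewrite length_carried; lia. Qed.

Lemma nth_map_to_nat l a : nth a (map Z.to_nat l) 0%nat = Z.to_nat (nth a l 0).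
Proof. change 0%nat with (Z.to_nat 0); apply map_nth. Qed.

Lemma length_sum_query h e : length (sum_query B k xs h e) = (k + 3)%nat.
Proof. unfold sum_query; rewrite length_app, length_carried; simpl; lia. Qed.

(** A window of length h M - 1 contains h - 1 separators if it starts at a block boundary, and h
    otherwise. This is why the last separator is left out: the vector of the query then forces
    alignment. *)
Lemma sum_query_match nb h : (1 <= h)%nat ->
  (exists e, 0 <= e < 2 ^ Z.of_nat k /\
     jumbled_match (k + 3) (T nb) (map Z.to_nat (sum_query B k xs h e))) <->
  (exists j, (j + h <= nb)%nat /\ x (j + h) - x j = x (h - 1)).
Proof.
  intros Hh; split.
  - intros (e & He & S' & (U & V & E) & EP).
    pose proof (T_letters nb) as HT; rewrite E in HT.
    apply Forall_app in HT; destruct HT as [_ HT]; apply Forall_app in HT.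
    destruct HT as [HT _].
    assert (Hnn : Forall (fun z => 0 <= z) (sum_query B k xs h e))
      by (eapply Forall_impl; [|apply sum_query_range; exact Hh]; cbv beta; intros; lia).
    (* The filler entry completes the digit entries to [body_length B k * h], so the entries of the
       query sum to a length independent of the digits. *)
    assert (HlS : length S' = (h * M - 1)%nat).
    { rewrite <- (parikh_sum _ _ HT), EP; apply Nat2Z.inj.
      rewrite list_sum_to_nat by exact Hnn.
      unfold sum_query; rewrite zsum_app; unfold M, L.
      pose proof body_length_pos.
      set (z := zsum (carried _ _ _ _ _ _)); cbn [zsum fold_right].
      rewrite Nat2Z.inj_sub, Nat2Z.inj_mul, Nat2Z.inj_succ, Z2Nat.id by nia; ring. }
    pose proof (count_sep_window nb U S' V E) as Hs.
    rewrite <- (nth_parikh (k + 3)), EP, nth_map_to_nat in Hs by lia.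
    assert (Eq2 : nth (k + 2) (sum_query B k xs h e) 0 = Z.of_nat h - 1).
    { unfold sum_query; rewrite app_nth2; rewrite length_carried; [|lia].
      replace (k + 2 - S k)%nat with 1%nat by lia; reflexivity. }
    rewrite Eq2, HlS in Hs.
    set (p := length U) in *.
    assert (HM : M <> 0%nat) by (unfold M; lia).
    pose proof (Nat.div_mod p M HM) as Dp; pose proof (Nat.mod_upper_bound p M HM).
    assert (Hr : (p mod M = 0)%nat).
    { destruct (Nat.eq_dec (p mod M) 0) as [|Hne]; [assumption|exfalso].
      assert (D2 : ((p + (h * M - 1)) / M = p / M + h)%nat)
        by (symmetry; apply Nat.div_unique with (p mod M - 1)%nat; nia).
      rewrite D2 in Hs; lia. }
    exists (p / M)%nat.
    assert (Hp : p = (p / M * M)%nat) by lia.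
    split.
    { pose proof (f_equal (@length nat) E) as El; rewrite !length_app, length_T in El.
      fold p in El; rewrite HlS in El; pose proof L_pos; unfold M in *; nia. }
    replace (x (h - 1)) with (x (h - 1) + 0) by lia.
    apply (carried_digit_diffs B (3 * B * Z.of_nat h) k); [exact HB | lia|].
    exists e; split; [exact He|].
    apply (nth_ext _ _ 0 0); [now rewrite length_carried, length_digit_diffs|].
    intros a Ha; rewrite length_carried in Ha.
    rewrite <- (count_window nb U S' V (p / M) h a E Hp HlS Hh ltac:(lia)).
    rewrite <- (nth_parikh (k + 3)), EP, nth_map_to_nat, nth_sum_query by lia.
    rewrite Z2Nat.id; [reflexivity|].
    rewrite <- nth_sum_query by lia.
    rewrite Forall_forall in Hnn; apply Hnn, nth_In; rewrite length_sum_query; lia.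
  - intros (j & Hj & E).
    replace (x (h - 1)) with (x (h - 1) + 0) in E by lia.
    apply (carried_digit_diffs B (3 * B * Z.of_nat h) k) in E; [|exact HB | lia].
    destruct E as (e & He & Ee); exists e; split; [exact He|].
    assert (HM : M <> 0%nat) by (unfold M; lia).
    set (U := firstn (j * M) (T nb)).
    set (S' := firstn (h * M - 1) (skipn (j * M) (T nb))).
    set (V := skipn (h * M - 1) (skipn (j * M) (T nb))).
    assert (ET : T nb = U ++ S' ++ V) by (unfold U, S', V; now rewrite !firstn_skipn).
    assert (HU : length U = (j * M)%nat)
      by (unfold U; rewrite length_firstn, length_T; nia).
    assert (HS : length S' = (h * M - 1)%nat)
      by (unfold S'; rewrite length_firstn, length_skipn, length_T; nia).
    exists S'; split; [exists U, V; exact ET|].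
    assert (HT : Forall (fun a => (a < k + 3)%nat) S').
    { pose proof (T_letters nb) as HT; rewrite ET in HT.
      apply Forall_app in HT; destruct HT as [_ HT]; now apply Forall_app in HT. }
    pose proof (parikh_sum _ _ HT) as Hsum.
    assert (Hnn : Forall (fun z => 0 <= z) (sum_query B k xs h e))
      by (eapply Forall_impl; [|apply sum_query_range; exact Hh]; cbv beta; intros; lia).
    assert (Hlow : forall a, (a <= k)%nat -> nth a (parikh (k + 3) S') 0%nat =
              Z.to_nat (nth a (sum_query B k xs h e) 0)).
    { intros a Ha; rewrite nth_parikh, nth_sum_query by lia; fold (x (h - 1)).
      rewrite Ee, <- (count_window nb U S' V j h a ET HU HS Hh Ha); lia. }
    assert (Hsep : nth (k + 2) (parikh (k + 3) S') 0%nat = (h - 1)%nat).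
    { rewrite nth_parikh by lia.
      rewrite (count_sep_window nb U S' V ET), HU, HS.
      rewrite Nat.div_mul by exact HM.
      replace ((j * M + (h * M - 1)) / M)%nat with (j + h - 1)%nat; [lia|].
      apply Nat.div_unique with L; unfold M in *; nia. }
    assert (Elow : firstn (k + 1) (parikh (k + 3) S') =
                   map Z.to_nat (carried B (3 * B * Z.of_nat h) k (nth (h - 1) xs 0) e 0)).
    { apply (nth_ext _ _ 0%nat 0%nat).
      - rewrite length_firstn, length_map, length_carried; unfold parikh.
        rewrite length_map, length_seq; lia.
      - intros a Ha; rewrite length_firstn in Ha.
        rewrite nth_map_to_nat, <- nth_sum_query by lia.
        rewrite nth_firstn, <- Hlow by lia.
        destruct (Nat.ltb_spec a (k + 1)); [reflexivity | lia]. }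
    assert (Hshape : forall l, length l = (k + 3)%nat ->
       l = firstn (k + 1) l ++ [nth (k + 1) l 0%nat; nth (k + 2) l 0%nat]).
    { clear; intros l Hl; rewrite <- (firstn_skipn (k + 1) l) at 1; f_equal.
      apply (nth_ext _ _ 0%nat 0%nat); [rewrite length_skipn; simpl; lia|].
      intros [|[|n]] Hn; rewrite nth_skipn; simpl; try (f_equal; lia).
      rewrite length_skipn in Hn; lia. }
    assert (Hpl : length (parikh (k + 3) S') = (k + 3)%nat)
      by (unfold parikh; rewrite length_map, length_seq; reflexivity).
    (* Digit letters and separators agree by now; the filler count, the only entry left, is fixed by
       the length of [S']. *)
    rewrite (Hshape _ Hpl), Elow, Hsep in Hsum |- *.
    rewrite list_sum_app in Hsum.
    unfold sum_query; rewrite map_app; f_equal; cbn [map].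
    apply Forall_app in Hnn; destruct Hnn as [Hn1 Hn2].
    pose proof (list_sum_to_nat _ Hn1) as Hz.
    apply Forall_cons_iff in Hn2; destruct Hn2 as [Hz1 _].
    set (ls := list_sum (map Z.to_nat _)) in Hsum, Hz.
    cbn [list_sum fold_right] in Hsum.
    f_equal; [|f_equal; lia].
    pose proof body_length_pos.
    rewrite HS in Hsum; apply Nat2Z.inj; rewrite Z2Nat.id by exact Hz1.
    apply (f_equal Z.of_nat) in Hsum; unfold M, L in Hsum.
    rewrite !Nat2Z.inj_add, Hz, !Nat2Z.inj_sub, Nat2Z.inj_mul, Nat2Z.inj_succ
      in Hsum by nia.
    lia.
Qed.

End Text.

Local Open Scope Z_scope.

(** * The program *)

(** This and the next rules are in continuation style, with operands given by equations, so that
    straight-line code is executed symbolically instruction by instruction. *)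
Lemma do_konst w d z v C R M n Q :
  wrap w z = v -> runs w C (upd_reg R d v) M n Q ->
  runs w (Konst d z ;; C) R M (S n) Q.
Proof.
  intros <- H; apply (runs_seq _ _ _ _ _ 1); now apply runs_konst.
Qed.

Lemma do_bin w o d a b x y v C R M n Q :
  R a = x -> R b = y -> wrap w (eval_binop o x y) = v ->
  runs w C (upd_reg R d v) M n Q ->
  runs w (Bin o d a b ;; C) R M (S n) Q.
Proof.
  intros <- <- <- H; apply (runs_seq _ _ _ _ _ 1); now apply runs_bin.
Qed.

Lemma do_fetch w d a x v C R M n Q :
  R a = x -> M x = v -> runs w C (upd_reg R d v) M n Q ->
  runs w (Fetch d a ;; C) R M (S n) Q.
Proof.
  intros <- <- H; apply (runs_seq _ _ _ _ _ 1); now apply runs_fetch.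
Qed.

Lemma do_store w a b x v C R M n Q :
  R a = x -> R b = v -> runs w C R (upd_mem M x v) n Q ->
  runs w (Store a b ;; C) R M (S n) Q.
Proof.
  intros <- <- H; apply (runs_seq _ _ _ _ _ 1); now apply runs_store.
Qed.

Lemma do_seq w C1 C2 R M n1 n2 (Q1 Q : _ -> _ -> Prop) :
  runs w C1 R M n1 Q1 -> (forall R' M', Q1 R' M' -> runs w C2 R' M' n2 Q) ->
  runs w (C1 ;; C2) R M (n1 + n2) Q.
Proof.
  intros H1 H2; apply runs_seq; eapply runs_weaken; [reflexivity | exact H2 | exact H1].
Qed.

Definition glob (g R : nat -> Z) : Prop := forall i, (i < 20)%nat -> R i = g i.

Definition frame (l : list nat) (R R' : nat -> Z) : Prop :=
  forall i, ~ In i l -> R' i = R i.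

Ltac lk :=
  rs; first
    [ match goal with
      | |- ?f ?i = _ => is_var f;
          first [ eassumption
                | match goal with Hg : glob _ f |- _ => rewrite Hg by lia; eassumption end ]
      end
    | reflexivity ].

(** Every result is shown to lie in the word range, so the registers hold the true integers. *)
Ltac wr := cbn [eval_binop]; apply wrap_id; [lia | unfold fits; try lia; try nia].

Ltac bin := eapply do_bin; [lk | lk | wr | ].
Ltac konst := eapply do_konst; [wr | ].
Ltac fetch := eapply do_fetch; [lk | | ].
Ltac store := eapply do_store; [lk | lk | ].
Ltac nop := apply runs_nop.
Ltac fr := let i := fresh in let H := fresh in
  intros i H; cbn [In] in H; rs; auto.

(* Registers of the program: 0: [n], 1: [1], 2: [B], 3: [3B], 4: the block
   length without separator, 6: the number of blocks, 7: the length of the text,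
   8 and 9: [2^W] and [2^(W-1)] for the word size [W] of the index, 10: the
   number of queries, 11: [2^k], 12: the address of the copied input, 13: the
   current query, 14: the answer, 16: [2], 17: [0].  The memory of the index
   occupies the addresses from [-2^(W-1)] to [2^(W-1) - 1]; the time stamp and
   the overlay value of address [a] are at [a + 2^W] and [a + 2 * 2^W]. *)
Fixpoint power (d b m : nat) : cmd :=
  match m with
  | O => Konst d 1 ;; Nop
  | S m' => power d b m' ;; Bin Mul d d b ;; Nop
  end.

(** Register 25 is the write position and 29 the number of copies. In the text phase 26 and 27 hold
    the two inputs of the block and 28 the filler it still needs. *)
Definition emit (a : nat) : cmd :=
  Konst 22 (Z.of_nat a) ;;
  While (TLt 17 29)
    (Store 25 22 ;; Bin Add 25 25 1 ;; Bin Sub 29 29 1 ;; Nop) ;; Nop.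

Fixpoint emit_digits (a k : nat) : cmd :=
  match k with
  | O =>
      Bin Sub 29 27 26 ;; Bin Add 29 29 3 ;; Bin Sub 28 28 29 ;; emit a ;; Nop
  | S k' =>
      Bin Mod 29 27 2 ;; Bin Mod 23 26 2 ;; Bin Sub 29 29 23 ;; Bin Add 29 29 3 ;;
      Bin Sub 28 28 29 ;; Bin Div 26 26 2 ;; Bin Div 27 27 2 ;; emit a ;;
      emit_digits (S a) k'
  end.

Fixpoint clear_regs (n : nat) : cmd :=
  match n with O => Nop | S n' => Konst (jreg n') 0 ;; clear_regs n' end.

(** Register 25 holds the remaining carry bits, 26 what remains of x_h, 27 the shift 3Bh, 28 the
    filler left, 30 the carry in and 31 the carry out. *)
Fixpoint query_digits (a k : nat) : cmd :=
  match k with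
  | O =>
      Bin Add 29 26 27 ;; Bin Add 29 29 30 ;; Bin Sub 28 28 29 ;;
      Bin Add (jreg a) 29 17 ;; Nop
  | S k' =>
      Bin Mod 31 25 16 ;; Bin Div 25 25 16 ;; Bin Mod 29 26 2 ;; Bin Div 26 26 2 ;;
      Bin Add 29 29 27 ;; Bin Add 29 29 30 ;; Bin Mul 32 2 31 ;; Bin Sub 29 29 32 ;;
      Bin Sub 28 28 29 ;; Bin Add (jreg a) 29 17 ;; Bin Add 30 31 17 ;;
      query_digits (S a) k'
  end.

(** The first loop finds the least base with B^(k+1) >= n. There is no logarithm instruction, so the
    second loop doubles until s + k + 3 is exceeded; the [cJ]-th power of the result is 2^W. The
    conditional gives n - 1 the value 0 at n = 0, as in [nat]. *)
Definition init_cmd (k cJ lp : nat) : cmd :=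
  Konst 1 1 ;; Konst 16 2 ;; Konst 17 0 ;; Konst 2 1 ;; Konst 22 1 ;;
  While (TLt 22 0) (Bin Add 2 2 1 ;; power 22 2 (S k)) ;;
  Konst 23 3 ;; Bin Mul 3 23 2 ;; Konst 23 (6 * (Z.of_nat k + 1)) ;; Bin Mul 4 23 2 ;;
  Bin Add 5 4 1 ;; Konst 6 0 ;; If (TLt 17 0) (Bin Sub 6 0 1 ;; Nop) Nop ;; Bin Mul 7 6 5 ;;
  Konst 23 (Z.of_nat (k + 4)) ;; Bin Add 23 7 23 ;; Konst 22 1 ;;
  While (TLt 22 23) (Bin Add 22 22 22 ;; Nop) ;;
  power 8 22 cJ ;; Bin Div 9 8 16 ;; Konst 23 3 ;; Bin Mul 12 8 23 ;;
  Konst 11 (2 ^ Z.of_nat k) ;; Bin Mul 10 6 11 ;; Konst 19 (Z.of_nat lp) ;; Nop.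

(** The inputs move to 3 * 2^W, beyond the overlay, and their old cells are zeroed, since
    preprocessing expects memory that is 0 outside the text. *)
Definition copy_cmd : cmd :=
  Konst 24 0 ;;
  While (TLt 24 0)
    (Fetch 22 24 ;; Bin Add 23 12 24 ;; Store 23 22 ;; Store 24 17 ;; Bin Add 24 24 1 ;; Nop) ;;
  Nop.

Definition text_cmd (k : nat) : cmd :=
  Konst 25 0 ;; Konst 24 0 ;;
  While (TLt 24 6)
    (Bin Add 22 12 24 ;; Fetch 26 22 ;; Bin Add 22 22 1 ;; Fetch 27 22 ;; Bin Add 28 4 17 ;;
     emit_digits 0 k ;; Bin Add 29 28 17 ;; emit (k + 1) ;; Konst 29 1 ;; emit (k + 2) ;;
     Bin Add 24 24 1 ;; Nop) ;;
  Nop.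

Definition pre_cmd (nr : nat) : cmd := clear_regs nr ;; Bin Add 40 7 17 ;; Konst 20 0 ;; Nop.

Definition mid_cmd (lq : nat) : cmd := Konst 13 0 ;; Konst 14 0 ;; Konst 19 (Z.of_nat lq) ;; Nop.

(** Query number (h - 1) 2^k + e encodes the number of blocks and the carries. Its stamp is the
    number plus 1, which differs from all earlier stamps and from the 0 of untouched cells. *)
Definition query_cmd (k nr : nat) : cmd :=
  Bin Add 15 13 1 ;; Bin Div 24 13 11 ;; Bin Add 24 24 1 ;; Bin Mod 25 13 11 ;;
  Bin Add 22 12 24 ;; Bin Sub 22 22 1 ;; Fetch 26 22 ;; Bin Mul 27 3 24 ;; Bin Mul 28 4 24 ;;
  clear_regs nr ;; Konst 30 0 ;; query_digits 0 k ;;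
  Bin Add (jreg (k + 1)) 28 17 ;; Bin Sub (jreg (k + 2)) 24 1 ;; Konst 20 0 ;; Nop.

Definition answer_cmd : cmd :=
  If (TEq 40 17) Nop (Konst 14 1 ;; Nop) ;; Bin Add 13 13 1 ;; Nop.

Definition conv_cmd (k cJ nr : nat) (pre qry : program) : cmd :=
  init_cmd k cJ (length pre) ;; copy_cmd ;; text_cmd k ;; pre_cmd nr ;;
  sim_loop false pre ;; mid_cmd (length qry) ;;
  While (TLt 13 10) (query_cmd k nr ;; sim_loop true qry ;; answer_cmd) ;;
  Bin Add 0 14 17.

(** Each image is 0 off its own cells, so the sum describes a memory holding both while their ranges
    are disjoint. *)
Definition mem_app (xs : list Z) (X : Z) (T : list nat) (M : Z -> Z) : Prop :=
  forall a, M a = input_mem (map Z.of_nat T) a + input_mem xs (a - X).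

Lemma input_mem_neg l a : a < 0 -> input_mem l a = 0.
Proof. intros H; unfold input_mem; destruct (Z.leb_spec 0 a); [lia | reflexivity]. Qed.

Lemma input_mem_big l a : Z.of_nat (length l) <= a -> input_mem l a = 0.
Proof.
  intros H; unfold input_mem; destruct (Z.leb_spec 0 a); [|reflexivity].
  apply nth_overflow; lia.
Qed.

Lemma input_mem_nth l i : input_mem l (Z.of_nat i) = nth i l 0.
Proof.
  unfold input_mem; destruct (Z.leb_spec 0 (Z.of_nat i)); [|lia].
  now rewrite Nat2Z.id.
Qed.

Lemma input_mem_rcons l z a :
  input_mem (l ++ [z]) a = if Z.eqb a (Z.of_nat (length l)) then z else input_mem l a.
Proof.
  destruct (Z.eqb_spec a (Z.of_nat (length l))) as [->|Hn].
  - rewrite input_mem_nth, app_nth2, Nat.sub_diag by lia; reflexivity.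
  - unfold input_mem; destruct (Z.leb_spec 0 a); [|reflexivity].
    destruct (Nat.lt_ge_cases (Z.to_nat a) (length l)).
    + now apply app_nth1.
    + rewrite !nth_overflow; rewrite ?length_app; simpl; lia.
Qed.

Lemma Sup_seq_ub (u : nat -> R) (t : nat) :
  Rbar_le (Finite (u t)) (Sup_seq (fun t => Finite (u t))).
Proof. apply (Sup_seq_minor_le (fun t => Finite (u t)) _ t), Rbar_le_refl. Qed.

Lemma worst_case_ub {A : Type} (input : A -> Prop) (cost : A -> Rbar) (a : A) :
  input a -> Rbar_le (cost a) (worst_case input cost).
Proof.
  intros Ha; unfold worst_case, Rbar_lub.
  destruct (Rbar_ex_lub _) as [l [Hl Hl2]]; apply Hl; eauto.
Qed.

Lemma worst_case_le {A : Type} (input : A -> Prop) (cost : A -> Rbar) (b : Rbar) :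
  (forall a, input a -> Rbar_le (cost a) b) -> Rbar_le (worst_case input cost) b.
Proof.
  intros Hb; unfold worst_case, Rbar_lub.
  destruct (Rbar_ex_lub _) as [l [Hl2 Hl]]; apply Hl.
  intros y (a & Ha & Ey); rewrite Ey; auto.
Qed.

(** * Correctness and cost of the phases of the program *)

Section Phases.

Variables (k cJ w : nat) (xs : list Z) (B U : Z).
Let n := length xs.
Let nb := (n - 1)%nat.
Let L := body_length B k.
Let s := (nb * S (Z.to_nat L))%nat.
Let lg := Nat.log2 (s + (k + 3)).
Let W := (cJ * (lg + 1))%nat.
Let Q := 2 ^ Z.of_nat W.
Let H := 2 ^ (Z.of_nat W - 1).

Hypothesis Hw : (1 <= w)%nat.
Hypothesis HcJ : (2 <= cJ)%nat.
Hypothesis HB : 0 < B.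
Hypothesis HBn : Z.of_nat n <= B ^ Z.of_nat (S k).
Hypothesis HBmin : forall b, 1 <= b < B -> b ^ Z.of_nat (S k) < Z.of_nat n.
Hypothesis Hxs : Forall (fun z => - Z.of_nat n <= z <= Z.of_nat n) xs.
(** [U] is a common bound for the quantities of the program; the factor 16 leaves room for sums and
    small multiples, which keeps the overflow conditions simple. *)
Hypothesis HU1 : 8 <= U.
Hypothesis HU : 16 * U <= 2 ^ (Z.of_nat w - 1).
Hypothesis HUB : B ^ Z.of_nat (S k) <= U.
Hypothesis HUL : L + 1 <= U.
Hypothesis HUs : Z.of_nat s + Z.of_nat k + 4 <= U.
Hypothesis HUl : 2 ^ Z.of_nat (lg + 1) <= U.
Hypothesis HUQ : Q <= U.
Hypothesis HUt : Z.of_nat nb * 2 ^ Z.of_nat k <= U.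
Hypothesis HUk : 2 ^ Z.of_nat k <= U.
Hypothesis HUr : 6 * (Z.of_nat k + 1) <= U.

Record env (g : nat -> Z) : Prop := Env {
  g_n : g 0%nat = Z.of_nat n;
  g_one : g 1%nat = 1;
  g_B : g 2%nat = B;
  g_B3 : g 3%nat = 3 * B;
  g_L : g 4%nat = L;
  g_nb : g 6%nat = Z.of_nat nb;
  g_s : g 7%nat = Z.of_nat s;
  g_Q : g 8%nat = Q;
  g_H : g 9%nat = H;
  g_tot : g 10%nat = Z.of_nat nb * 2 ^ Z.of_nat k;
  g_E : g 11%nat = 2 ^ Z.of_nat k;
  g_X : g 12%nat = 3 * Q;
  g_two : g 16%nat = 2;
  g_zero : g 17%nat = 0 }.

(** The logarithm in [lg] gives s + k + 3 < 2^(lg+1), and [2 <= cJ] makes W at least lg + 2, which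
    leaves the sign bit free. *)
Lemma s_lt : Z.of_nat s + Z.of_nat k + 3 < H /\ Q = 2 * H /\ 0 < H /\ Z.of_nat n < H.
Proof.
  destruct (pow2_half W) as [E1 E2]; [unfold W; nia|].
  fold Q in E1; fold H in E1, E2.
  assert (E3 : Z.of_nat s + Z.of_nat k + 3 < H).
  { pose proof (Nat.log2_spec (s + (k + 3)) ltac:(lia)) as [_ E]; fold lg in E.
    apply Nat2Z.inj_lt in E; rewrite Nat2Z.inj_pow in E.
    assert (2 ^ Z.of_nat (S lg) <= H) by (apply Z.pow_le_mono_r; unfold W; nia).
    lia. }
  repeat split; auto.
  assert (nb <= s)%nat by (unfold s; nia).
  unfold nb in *; lia.
Qed.

Lemma B_le_U : B <= U.
Proof.
  assert (B ^ 1 <= B ^ Z.of_nat (S k)) by (apply Z.pow_le_mono_r; lia).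
  rewrite Z.pow_1_r in *; lia.
Qed.

Lemma nth_bounded i : bounded B k (nth i xs 0).
Proof.
  unfold bounded; destruct (Nat.lt_ge_cases i n) as [Hi|Hi].
  - rewrite Forall_forall in Hxs; specialize (Hxs _ (nth_In xs 0 Hi)); lia.
  - rewrite nth_overflow by exact Hi.
    assert (0 < B ^ Z.of_nat (S k)) by (apply Z.pow_pos_nonneg; lia); lia.
Qed.

Lemma power_runs d b m R M :
  d <> b -> 1 <= R b -> R b ^ Z.of_nat m <= U ->
  runs w (power d b m) R M (m + 1)
    (fun R' M' => M' = M /\ R' d = R b ^ Z.of_nat m /\ frame [d] R R').
Proof.
  intros Hd Hb; induction m as [|m IH]; intros Hm.
  - cbn [power]; konst; nop; repeat split; [now rs | fr].
  - rewrite Nat2Z.inj_succ, Z.pow_succ_r in * by lia.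
    assert (H0 : 0 < R b ^ Z.of_nat m) by (apply Z.pow_pos_nonneg; lia).
    cbn [power]; replace (S m + 1)%nat with (m + 1 + 1)%nat by lia.
    eapply do_seq; [apply IH; nia|].
    intros R' M' (-> & E & F); cbv beta.
    assert (Eb : R' b = R b) by (apply F; simpl; intuition).
    bin; nop; repeat split; [rs; lia | fr].
Qed.

Lemma emit_runs g a c T R M :
  env g -> glob g R -> Z.of_nat a <= U -> 0 <= c ->
  R 29%nat = c -> R 25%nat = Z.of_nat (length T) ->
  Z.of_nat (length T) + c <= H -> mem_app xs (3 * Q) T M ->
  runs w (emit a) R M (Z.to_nat c * 5 + 3)
    (fun R' M' => mem_app xs (3 * Q) (T ++ repeat a (Z.to_nat c)) M' /\
       R' 25%nat = Z.of_nat (length T) + c /\ frame [22%nat; 25%nat; 29%nat] R R').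
Proof.
  intros Hg HgR Ha Hc E29 E25 HT HM; pose proof s_lt as (Hs1 & Hs2 & Hs3 & Hs4).
  unfold emit; eapply runs_le; cycle 1.
  { konst; eapply do_seq; [|intros R' M' HI; nop; exact HI].
    apply (runs_while w (TLt 17 29) _ (fun j R' M' => exists i,
             (i + j = Z.to_nat c)%nat /\ R' 22%nat = Z.of_nat a /\
             R' 29%nat = Z.of_nat j /\ R' 25%nat = Z.of_nat (length T + i) /\
             frame [22%nat; 25%nat; 29%nat] R R' /\
             mem_app xs (3 * Q) (T ++ repeat a i) M') 3 (Z.to_nat c)).
    - exists 0%nat; repeat split; rs; try lia; [fr|].
      simpl; rewrite app_nil_r; exact HM.
    - intros j R1 M1 (i & Hi & F1 & F2 & F3 & F4 & F5).
      assert (HgR1 : glob g R1) by (intros b Hb; rewrite F4 by (cbn [In]; lia); auto).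
      pose proof (g_zero g Hg); pose proof (g_one g Hg).
      split.
      { cbn [holds]; rewrite HgR1, g_zero, F2 by (auto; lia); apply Z.ltb_lt; lia. }
      store; bin; bin; nop.
      exists (S i); repeat split; rs; try lia.
      + intros b Hb; cbn [In] in Hb; rs; apply F4; cbn [In]; tauto.
      + intros b; replace (S i) with (i + 1)%nat by lia.
        rewrite repeat_app, app_assoc, map_app; cbn [map repeat].
        rewrite input_mem_rcons, length_map, length_app, repeat_length.
        unfold upd_mem; destruct (Z.eqb_spec b (Z.of_nat (length T + i))) as [->|]; auto.
        rewrite input_mem_neg by lia; lia.
    - intros R1 M1 (i & Hi & F1 & F2 & F3 & F4 & F5).
      assert (HgR1 : glob g R1) by (intros b Hb; rewrite F4 by (cbn [In]; lia); auto).
      split.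
      { cbn [holds]; rewrite HgR1, g_zero, F2 by (auto; lia); reflexivity. }
      replace (Z.to_nat c) with i by lia; repeat split; auto; lia. }
  lia.
Qed.

Lemma glob_upd g R d v : (20 <= d)%nat -> glob g R -> glob g (upd_reg R d v).
Proof. intros Hd HR i Hi; rs; auto. Qed.

Lemma glob_frame g R R' l : Forall (fun i => (20 <= i)%nat) l -> frame l R R' ->
  glob g R -> glob g R'.
Proof.
  intros Hl F HR i Hi; rewrite F; auto.
  intros Hin; rewrite Forall_forall in Hl; specialize (Hl _ Hin); lia.
Qed.

Lemma emit_digits_runs g a m x y f T R M :
  env g -> glob g R -> Z.of_nat (a + m) <= U ->
  bounded B m x -> bounded B m y -> (m <= k)%nat ->
  R 26%nat = x -> R 27%nat = y -> R 28%nat = f -> R 25%nat = Z.of_nat (length T) ->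
  let d := digit_diffs B (3 * B) m y x in
  zsum d <= f <= U ->
  Z.of_nat (length T) + zsum d <= H -> mem_app xs (3 * Q) T M ->
  runs w (emit_digits a m) R M (Z.to_nat (zsum d) * 5 + 11 * (m + 1))
    (fun R' M' => mem_app xs (3 * Q) (T ++ spell a d) M' /\
       R' 25%nat = Z.of_nat (length T) + zsum d /\ R' 28%nat = f - zsum d /\
       frame [22%nat; 23%nat; 25%nat; 26%nat; 27%nat; 28%nat; 29%nat] R R').
Proof.
  intros Hg HgR Ha Hx Hy Hm E26 E27 E28 E25 d Hf HT HM.
  assert (HBm : B ^ Z.of_nat (S m) <= U).
  { assert (B ^ Z.of_nat (S m) <= B ^ Z.of_nat (S k)) by (apply Z.pow_le_mono_r; lia); lia. }
  pose proof B_le_U.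
  pose proof (g_one g Hg); pose proof (g_B g Hg); pose proof (g_B3 g Hg); pose proof (g_zero g Hg).
  revert a x y f T R M d HgR Ha Hx Hy E26 E27 E28 E25 Hf HT HM.
  induction m as [|m IH]; intros a x y f T R M d HgR Ha Hx Hy E26 E27 E28 E25 Hf HT HM;
    cbn [emit_digits].
  - apply bounded_0 in Hx; apply bounded_0 in Hy.
    subst d; cbn [digit_diffs zsum fold_right] in *; rewrite Z.add_0_r in *.
    eapply runs_le; cycle 1.
    { bin; bin; bin.
      eapply do_seq.
      { eapply (emit_runs g a (y - x + 3 * B) T); eauto; try (rs; lia).
        repeat apply glob_upd; auto; lia. }
      intros R' M' (F1 & F2 & F3); nop.
      cbn [spell]; rewrite app_nil_r; repeat split; auto.
      - rewrite F3 by (cbn [In]; lia); now rs.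
      - intros i Hi; cbn [In] in Hi; rewrite F3 by (cbn [In]; lia); now rs. }
    lia.
  - pose proof (Z.mod_pos_bound x B HB); pose proof (Z.mod_pos_bound y B HB).
    pose proof (bounded_div B m x HB Hx) as Hx'; pose proof (bounded_div B m y HB Hy) as Hy'.
    pose proof (zsum_range _ _ (digit_diffs_range B m (y / B) (x / B) HB Hy' Hx')) as Hz.
    assert (Hpm : B ^ Z.of_nat (S m) <= U).
    { assert (B ^ Z.of_nat (S m) <= B ^ Z.of_nat (S k)) by (apply Z.pow_le_mono_r; lia); lia. }
    subst d; cbn [digit_diffs spell] in *.
    set (d := digit_diffs B (3 * B) m (y / B) (x / B)) in *.
    cbn [zsum fold_right] in Hf, HT |- *; fold (zsum d) in *.
    unfold bounded in Hx', Hy'.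
    eapply runs_le; cycle 1.
    { bin; bin; bin; bin; bin; bin; bin.
      eapply do_seq.
      { eapply (emit_runs g a (y mod B - x mod B + 3 * B) T); eauto; try (rs; lia).
        repeat apply glob_upd; auto; lia. }
      intros R' M' (F1 & F2 & F3).
      eapply runs_weaken; [reflexivity | |
        eapply (IH ltac:(lia) ltac:(lia) (S a) (x / B) (y / B)
           (f - (y mod B - x mod B + 3 * B)) (T ++ repeat a _) R' M')]; auto.
      - cbv beta; intros R2 M2 (G1 & G2 & G3 & G4).
        fold d in G1, G2, G3; rewrite <- app_assoc in G1.
        rewrite length_app, repeat_length in G2.
        repeat split; [exact G1 | lia | lia |].
        intros i Hi; cbn [In] in Hi; rewrite G4, F3 by (cbn [In]; lia); now rs.
      - eapply glob_frame; [|exact F3|]; [repeat constructor; lia|].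
        repeat apply glob_upd; auto; lia.
      - lia.
      - rewrite F3 by (cbn [In]; lia); now rs.
      - rewrite F3 by (cbn [In]; lia); now rs.
      - rewrite F3 by (cbn [In]; lia); now rs.
      - rewrite F2, length_app, repeat_length; lia.
      - fold d; lia.
      - fold d; rewrite length_app, repeat_length; lia.
      - exact F1. }
    fold d; lia.
Qed.

Lemma init_runs lp R M :
  R 0%nat = Z.of_nat n -> Z.of_nat lp <= U ->
  runs w (init_cmd k cJ lp) R M ((k + 6) * Z.to_nat B + 3 * lg + cJ + 60)
    (fun R' M' => M' = M /\ env R' /\ R' 19%nat = Z.of_nat lp).
Proof.
  intros E0 Hlp; pose proof s_lt as (Hs1 & Hs2 & Hs3 & Hs4); pose proof B_le_U.
  assert (HL : 0 < L) by now apply body_length_pos.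
  assert (EsZ : Z.of_nat s = Z.of_nat nb * (L + 1))
    by (unfold s; rewrite Nat2Z.inj_mul, Nat2Z.inj_succ, Z2Nat.id by lia; reflexivity).
  unfold init_cmd; eapply runs_le; cycle 1.
  { konst; konst; konst; konst; konst.
    eapply do_seq.
    (* At base [b] there are B - b rounds left; minimality of [B] keeps the test true until b =
       B. *)
    { apply (runs_while w (TLt 22 0) _ (fun j R' M' => M' = M /\ exists b,
        1 <= b /\ b + Z.of_nat j = B /\ R' 2%nat = b /\ R' 22%nat = b ^ Z.of_nat (S k) /\
        R' 0%nat = Z.of_nat n /\ R' 1%nat = 1 /\ R' 16%nat = 2 /\ R' 17%nat = 0) (k + 3)
        (Z.to_nat (B - 1))
        _ _ (fun R' M' => M' = M /\ R' 2%nat = B /\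
        R' 0%nat = Z.of_nat n /\ R' 1%nat = 1 /\ R' 16%nat = 2 /\ R' 17%nat = 0)).
      - split; [reflexivity|]; exists 1; repeat split; rs; try lia.
        symmetry; apply Z.pow_1_l; lia.
      - intros j R1 M1 (-> & b & Hb1 & Hb2 & F2 & F22 & F0 & F1 & F16 & F17); split.
        { cbn [holds]; rewrite F22, F0; apply Z.ltb_lt, HBmin; lia. }
        assert (HbU : (b + 1) ^ Z.of_nat (S k) <= U).
        { assert ((b + 1) ^ Z.of_nat (S k) <= B ^ Z.of_nat (S k))
            by (apply Z.pow_le_mono_l; lia); lia. }
        eapply runs_le; cycle 1.
        { bin.
          eapply runs_weaken; [reflexivity | |
            apply (power_runs 22 2 (S k)); rs; try lia].
          cbv beta; intros R2 M2 (-> & G1 & G2); split; [reflexivity|].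
          exists (b + 1); rs; repeat split; try lia; try (rewrite G2 by (cbn [In]; lia); now rs).
          rewrite G1; now rs. }
        lia.
      - intros R1 M1 (-> & b & Hb1 & Hb2 & F2 & F22 & F0 & F1 & F16 & F17).
        assert (Eb : b = B) by lia; rewrite Eb in *; split; [|repeat split; auto].
        cbn [holds]; rewrite F22, F0; apply Z.ltb_ge; exact HBn. }
    intros R1 M1 (-> & F2 & F0 & F1 & F16 & F17).
    assert (HL' : 6 * (Z.of_nat k + 1) * B = L) by reflexivity.
    konst; bin; konst; bin; bin; konst.
    eapply (do_seq _ _ _ _ _ _ _ (fun R' M' => M' = M /\ R' 0%nat = Z.of_nat n /\ R' 1%nat = 1 /\
       R' 2%nat = B /\ R' 3%nat = 3 * B /\ R' 4%nat = L /\ R' 5%nat = L + 1 /\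
       R' 6%nat = Z.of_nat nb /\ R' 16%nat = 2 /\ R' 17%nat = 0)).
    { apply (runs_if w _ _ _ _ _ 1); cbn [holds]; rs; rewrite F17, F0.
      destruct (Z.ltb_spec 0 (Z.of_nat n)).
      - bin; nop; repeat split; rs; auto; unfold nb; lia.
      - apply (runs_le 0); [lia|]; nop; repeat split; rs; auto; unfold nb; lia. }
    intros R2 M2 (-> & G0 & G1 & G2 & G3 & G4 & G5 & G6 & G16 & G17).
    bin; konst; bin; konst.
    eapply do_seq.
    (* There are lg + 1 doublings, because 2^lg <= s + k + 3 < 2^(lg+1). *)
    { apply (runs_while w (TLt 22 23) _ (fun j R' M' => M' = M /\ exists i,
        (i + j = lg + 1)%nat /\ R' 22%nat = 2 ^ Z.of_nat i /\
        R' 23%nat = Z.of_nat s + Z.of_nat (k + 4) /\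
        R' 7%nat = Z.of_nat s /\ R' 0%nat = Z.of_nat n /\ R' 1%nat = 1 /\
        R' 2%nat = B /\ R' 3%nat = 3 * B /\ R' 4%nat = L /\
        R' 6%nat = Z.of_nat nb /\ R' 16%nat = 2 /\ R' 17%nat = 0) 1 (lg + 1)
        _ _ (fun R' M' => M' = M /\ R' 22%nat = 2 ^ Z.of_nat (lg + 1) /\
        R' 7%nat = Z.of_nat s /\ R' 0%nat = Z.of_nat n /\ R' 1%nat = 1 /\
        R' 2%nat = B /\ R' 3%nat = 3 * B /\ R' 4%nat = L /\
        R' 6%nat = Z.of_nat nb /\ R' 16%nat = 2 /\ R' 17%nat = 0)).
      - split; [reflexivity|]; exists 0%nat; repeat split; rs; auto; lia.
      - intros j R3 M3 (-> & i & Hi & I22 & I23 & I7 & I0 & I1 & I2 & I3 & I4 & I6 & I16 & I17).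
        pose proof (Nat.log2_spec (s + (k + 3)) ltac:(lia)) as [Hl _]; fold lg in Hl.
        apply Nat2Z.inj_le in Hl; rewrite Nat2Z.inj_pow in Hl.
        assert (2 ^ Z.of_nat i <= 2 ^ Z.of_nat lg) by (apply Z.pow_le_mono_r; lia).
        change (Z.of_nat 2) with 2 in Hl.
        assert (0 < 2 ^ Z.of_nat i) by (apply Z.pow_pos_nonneg; lia).
        split; [cbn [holds]; rewrite I22, I23; apply Z.ltb_lt; lia|].
        bin; nop; split; [reflexivity|]; exists (S i).
        rewrite Nat2Z.inj_succ, Z.pow_succ_r by lia.
        repeat split; rs; auto; lia.
      - intros R3 M3 (-> & i & Hi & I22 & I23 & I7 & I0 & I1 & I2 & I3 & I4 & I6 & I16 & I17).
        assert (i = lg + 1)%nat by lia; subst i.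
        split; [|repeat split; auto].
        pose proof (Nat.log2_spec (s + (k + 3)) ltac:(lia)) as [_ Hl]; fold lg in Hl.
        apply Nat2Z.inj_lt in Hl; rewrite Nat2Z.inj_pow in Hl.
        change (Z.of_nat 2) with 2 in Hl; replace (S lg) with (lg + 1)%nat in Hl by lia.
        cbn [holds]; rewrite I22, I23; apply Z.ltb_ge; lia. }
    intros R3 M3 (-> & I22 & I7 & I0 & I1 & I2 & I3 & I4 & I6 & I16 & I17).
    assert (EQ : (2 ^ Z.of_nat (lg + 1)) ^ Z.of_nat cJ = Q).
    { rewrite <- Z.pow_mul_r by lia; unfold Q, W; f_equal; lia. }
    eapply do_seq.
    { apply (power_runs 8 22 cJ); [lia| |]; rewrite I22; [|lia].
      assert (0 < 2 ^ Z.of_nat (lg + 1)) by (apply Z.pow_pos_nonneg; lia); lia. }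
    intros R4 M4 (-> & K8 & KF); cbv beta.
    rewrite I22, EQ in K8.
    rewrite <- KF in I7, I0, I1, I2, I3, I4, I6, I16, I17 by (cbn [In]; lia).
    assert (EH : Q / 2 = H) by (rewrite Hs2, Z.mul_comm; apply Z.div_mul; lia).
    assert (0 < 2 ^ Z.of_nat k) by (apply Z.pow_pos_nonneg; lia).
    bin; konst; bin; konst; bin; konst; nop.
    split; [reflexivity|]; split; [|now rs].
    constructor; rs; auto; lia. }
  nia.
Qed.

Lemma copy_runs g R M :
  env g -> glob g R -> (forall a, M a = input_mem xs a) ->
  runs w copy_cmd R M (n * 7 + 3)
    (fun R' M' => glob g R' /\ mem_app xs (3 * Q) [] M').
Proof.
  intros Hg HgR HM; pose proof s_lt as (Hs1 & Hs2 & Hs3 & Hs4).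
  pose proof (g_n g Hg); pose proof (g_one g Hg); pose proof (g_zero g Hg); pose proof (g_X g Hg).
  unfold copy_cmd; eapply runs_le; cycle 1.
  { konst; eapply do_seq; [|intros R' M' HI; nop; exact HI].
    (* In the invariant the first summand is the part not yet erased, the second the part already
       copied. *)
    apply (runs_while w (TLt 24 0) _ (fun j R' M' => exists i,
             (i + j = n)%nat /\ R' 24%nat = Z.of_nat i /\ glob g R' /\
             forall a, M' a = (if Z.leb (Z.of_nat i) a then input_mem xs a else 0) +
               (if Z.ltb a (3 * Q + Z.of_nat i) then input_mem xs (a - 3 * Q) else 0)) 5 n).
    - exists 0%nat; repeat split; rs; auto; [apply glob_upd; auto; lia|].
      intros a; rewrite HM; destruct (Z.leb_spec (Z.of_nat 0) a),
        (Z.ltb_spec a (3 * Q + Z.of_nat 0)); rewrite ?(input_mem_neg xs a) by lia;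
        rewrite ?(input_mem_neg xs (a - 3 * Q)) by lia; lia.
    - intros j R1 M1 (i & Hi & F1 & HgR1 & F2); split.
      { cbn [holds]; rewrite F1, HgR1, g_n by (auto; lia); apply Z.ltb_lt; lia. }
      fetch; [reflexivity|]; bin; store; store; bin; nop.
      exists (S i); repeat split; rs; try lia; [repeat apply glob_upd; auto; lia|].
      intros a; unfold upd_mem; rewrite !F2.
      destruct (Z.eqb_spec a (Z.of_nat i)) as [->|Hn1].
      + destruct (Z.leb_spec (Z.of_nat (S i)) (Z.of_nat i)); [lia|].
        destruct (Z.ltb_spec (Z.of_nat i) (3 * Q + Z.of_nat (S i))); [|lia].
        rewrite input_mem_neg; lia.
      + destruct (Z.eqb_spec a (3 * Q + Z.of_nat i)) as [->|Hn2].
        * destruct (Z.leb_spec (Z.of_nat i) (Z.of_nat i)); [|lia].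
          destruct (Z.ltb_spec (Z.of_nat i) (3 * Q + Z.of_nat i)); [|lia].
          destruct (Z.leb_spec (Z.of_nat (S i)) (3 * Q + Z.of_nat i)); [|lia].
          destruct (Z.ltb_spec (3 * Q + Z.of_nat i) (3 * Q + Z.of_nat (S i))); [|lia].
          rewrite (input_mem_neg xs (Z.of_nat i - 3 * Q)) by lia.
          rewrite (input_mem_big xs (3 * Q + Z.of_nat i)) by (fold n; lia).
          replace (3 * Q + Z.of_nat i - 3 * Q) with (Z.of_nat i) by lia; lia.
        * destruct (Z.leb_spec (Z.of_nat i) a), (Z.leb_spec (Z.of_nat (S i)) a),
            (Z.ltb_spec a (3 * Q + Z.of_nat i)), (Z.ltb_spec a (3 * Q + Z.of_nat (S i)));
            lia.
    - intros R1 M1 (i & Hi & F1 & HgR1 & F2); split.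
      { cbn [holds]; rewrite F1, HgR1, g_n by (auto; lia); apply Z.ltb_ge; lia. }
      split; [exact HgR1|]; intros a; rewrite F2.
      replace (input_mem (map Z.of_nat []) a) with 0
        by (symmetry; destruct (Z.leb_spec 0 a); [apply input_mem_big | apply input_mem_neg];
            simpl; lia).
      destruct (Z.leb_spec (Z.of_nat i) a), (Z.ltb_spec a (3 * Q + Z.of_nat i));
        rewrite ?(input_mem_big xs a) by (fold n; lia);
        rewrite ?(input_mem_big xs (a - 3 * Q)) by (fold n; lia); lia. }
  lia.
Qed.

Lemma mem_app_input T M i :
  mem_app xs (3 * Q) T M -> Z.of_nat (length T) <= 3 * Q ->
  M (3 * Q + Z.of_nat i) = nth i xs 0.
Proof.
  intros HM HT; rewrite HM, input_mem_big by (rewrite length_map; lia).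
  replace (3 * Q + Z.of_nat i - 3 * Q) with (Z.of_nat i) by lia.
  now rewrite input_mem_nth.
Qed.

Lemma text_runs g R M :
  env g -> glob g R -> mem_app xs (3 * Q) [] M ->
  runs w (text_cmd k) R M (nb * (Z.to_nat L * 5 + 11 * k + 40) + 4)
    (fun R' M' => glob g R' /\ mem_app xs (3 * Q) (sum_text B k xs nb) M').
Proof.
  intros Hg HgR HM; pose proof s_lt as (Hs1 & Hs2 & Hs3 & Hs4).
  assert (HL : 0 < L) by now apply body_length_pos.
  pose proof (length_T B k xs HB nth_bounded) as HlT; cbv zeta in HlT; fold L in HlT.
  pose proof (g_one g Hg); pose proof (g_zero g Hg); pose proof (g_X g Hg).
  pose proof (g_L g Hg); pose proof (g_nb g Hg).
  unfold text_cmd; eapply runs_le; cycle 1.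
  { konst; konst; eapply do_seq; [|intros R' M' HI; nop; exact HI].
    apply (runs_while w (TLt 24 6) _ (fun j R' M' => exists i,
             (i + j = nb)%nat /\ R' 24%nat = Z.of_nat i /\ glob g R' /\
             R' 25%nat = Z.of_nat (length (sum_text B k xs i)) /\
             mem_app xs (3 * Q) (sum_text B k xs i) M') (Z.to_nat L * 5 + 11 * k + 38) nb).
    - exists 0%nat; repeat split; rs; auto; repeat apply glob_upd; auto; lia.
    - intros j R1 M1 (i & Hi & F1 & HgR1 & F2 & F3); split.
      { cbn [holds]; rewrite F1, HgR1, g_nb by (auto; lia); apply Z.ltb_lt; lia. }
      assert (Hlen : Z.of_nat (length (sum_text B k xs i)) + L + 1 <= Z.of_nat s).
      { rewrite HlT; pose proof (Nat.mul_le_mono_r (i + 1) nb (S (Z.to_nat L)) ltac:(lia)).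
        unfold s; lia. }
      pose proof (diffs_sum B k xs HB nth_bounded i) as Hd; cbv zeta in Hd; fold L in Hd.
      pose proof (diffs_nonneg B k xs HB nth_bounded i) as Hdn; cbv zeta in Hdn.
      pose proof (length_spell 0 _ Hdn) as Hls.
      set (x := nth i xs 0) in *; set (y := nth (S i) xs 0) in *.
      set (d := digit_diffs B (3 * B) k y x) in *.
      eapply runs_le; cycle 1.
      { bin; fetch; [apply (mem_app_input _ _ _ F3); lia|].
        bin; fetch.
        { replace (3 * Q + Z.of_nat i + 1) with (3 * Q + Z.of_nat (S i)) by lia.
          apply (mem_app_input _ _ _ F3); lia. }
        fold x y; bin.
        eapply do_seq.
        { eapply (emit_digits_runs g 0 k x y L (sum_text B k xs i)); auto;
            try (rs; rewrite ?F2; lia); try apply nth_bounded; fold d; try lia.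
          repeat apply glob_upd; auto; lia. }
        fold d; intros R2 M2 (K1 & K2 & K3 & K4).
        assert (HgR2 : glob g R2).
        { eapply glob_frame; [|exact K4|]; [repeat constructor; lia|].
          repeat apply glob_upd; auto; lia. }
        bin; eapply do_seq.
        { eapply (emit_runs g (k + 1) (L - zsum d) (sum_text B k xs i ++ spell 0 d)); auto;
            try (rs; rewrite ?length_app; lia).
          repeat apply glob_upd; auto; lia. }
        intros R3 M3 (I1 & I2 & I3).
        assert (HgR3 : glob g R3).
        { eapply glob_frame; [|exact I3|]; [repeat constructor; lia|].
          repeat apply glob_upd; auto; lia. }
        konst; eapply do_seq.
        { eapply (emit_runs g (k + 2) 1 ((sum_text B k xs i ++ spell 0 d) ++
                    repeat (k + 1)%nat (Z.to_nat (L - zsum d)))); auto;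
            try (rs; rewrite ?length_app, ?repeat_length, ?I2, ?length_app; lia).
          repeat apply glob_upd; auto; lia. }
        intros R4 M4 (J1 & J2 & J3).
        assert (HgR4 : glob g R4).
        { eapply glob_frame; [|exact J3|]; [repeat constructor; lia|].
          repeat apply glob_upd; auto; lia. }
        assert (E24 : R4 24%nat = Z.of_nat i).
        { rewrite J3 by (cbn [In]; lia); rs; rewrite I3 by (cbn [In]; lia); rs.
          rewrite K4 by (cbn [In]; lia); now rs. }
        bin; nop.
        exists (S i).
        assert (ET : sum_text B k xs (S i) = ((sum_text B k xs i ++ spell 0 d) ++
                    repeat (k + 1)%nat (Z.to_nat (L - zsum d))) ++ repeat (k + 2)%nat (Z.to_nat 1)).
        { rewrite sum_text_S; unfold block; fold x y d L.
          rewrite <- !app_assoc; reflexivity. }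
        rewrite ET; repeat split; rs; auto; try lia.
        - repeat apply glob_upd; auto; lia.
        - rewrite J2, (length_app _ (repeat (k + 2)%nat _)), (repeat_length (k + 2)%nat); lia. }
      fold d; lia.
    - intros R1 M1 (i & Hi & F1 & HgR1 & F2 & F3); split.
      { cbn [holds]; rewrite F1, HgR1, g_nb by (auto; lia); apply Z.ltb_ge; lia. }
      replace nb with i by lia; auto. }
  lia.
Qed.

Lemma clear_regs_runs m R M :
  runs w (clear_regs m) R M m
    (fun R' M' => M' = M /\ (forall i, (i < m)%nat -> R' (jreg i) = 0) /\
       (forall i, (i < 40 \/ 40 + m <= i)%nat -> R' i = R i)).
Proof.
  revert R; induction m as [|m IH]; intros R; cbn [clear_regs].
  - nop; repeat split; intros; lia.
  - konst; eapply runs_weaken; [reflexivity | | apply IH].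
    cbv beta; intros R' M' (-> & F1 & F2); repeat split.
    + intros i Hi; destruct (Nat.eq_dec i m) as [->|]; [|apply F1; lia].
      rewrite F2 by lia; now rs.
    + intros i Hi; rewrite F2 by lia; now rs.
Qed.

Lemma pre_runs nr g R M :
  (1 <= nr)%nat -> env g -> glob g R ->
  runs w (pre_cmd nr) R M (nr + 2)
    (fun R' M' => M' = M /\ glob g R' /\ R' 20%nat = 0 /\
       forall i, (i < nr)%nat -> R' (jreg i) = upd_reg (fun _ => 0) 0 (Z.of_nat s) i).
Proof.
  intros Hnr Hg HgR; unfold pre_cmd.
  pose proof (g_s g Hg); pose proof (g_zero g Hg).
  eapply do_seq; [apply clear_regs_runs|].
  intros R1 M1 (-> & F1 & F2).
  assert (HgR1 : glob g R1) by (intros i Hi; rewrite F2 by lia; auto).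
  bin; konst; nop; repeat split.
  - repeat apply glob_upd; auto; lia.
  - intros [|i] Hi; [rs; lia|]; rs; apply F1; lia.
Qed.

Lemma query_digits_runs g a m u e h cin f R M :
  env g -> glob g R ->
  bounded B m u -> (m <= k)%nat -> 0 <= cin <= 1 -> 0 <= e <= U -> 1 <= h -> 3 * B * h <= U ->
  R 25%nat = e -> R 26%nat = u -> R 27%nat = 3 * B * h -> R 28%nat = f -> R 30%nat = cin ->
  let d := carried B (3 * B * h) m u e cin in
  zsum d <= f <= U ->
  runs w (query_digits a m) R M (11 * (m + 1))
    (fun R' M' => M' = M /\ R' 28%nat = f - zsum d /\
       (forall i, (i <= m)%nat -> R' (jreg (a + i)) = nth i d 0) /\
       (forall i, ~ In i [25%nat; 26%nat; 28%nat; 29%nat; 30%nat; 31%nat; 32%nat] ->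
          (i < jreg a \/ jreg (a + m) < i)%nat -> R' i = R i)).
Proof.
  intros Hg HgR Hu Hm Hc He Hh HBh E25 E26 E27 E28 E30 d Hf.
  pose proof B_le_U.
  pose proof (g_B g Hg); pose proof (g_zero g Hg); pose proof (g_two g Hg).
  revert a u e cin f R M d HgR Hu Hc He E25 E26 E27 E28 E30 Hf.
  induction m as [|m IH]; intros a u e cin f R M d HgR Hu Hc He E25 E26 E27 E28 E30 Hf;
    pose proof (carried_range B h _ u e cin HB Hh Hu Hc) as Hr; cbn [query_digits].
  - apply bounded_0 in Hu; subst d; cbn [carried zsum fold_right] in *.
    rewrite Z.add_0_r in *.
    apply Forall_cons_iff in Hr; destruct Hr as [Hr _].
    eapply runs_le; cycle 1.
    { bin; bin; bin; bin; nop; repeat split; rs; auto.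
      - intros i Hi; replace i with 0%nat by lia; rewrite Nat.add_0_r; rs; cbn [nth]; lia.
      - intros i Hi1 Hi2; cbn [In] in Hi1; rs; reflexivity. }
    lia.
  - pose proof (Z.mod_pos_bound u B HB); pose proof (Z.mod_pos_bound e 2 ltac:(lia)).
    pose proof (Z.div_mod e 2 ltac:(lia)).
    pose proof (bounded_div B m u HB Hu) as Hu'.
    assert (Hpm : B ^ Z.of_nat (S m) <= U).
    { assert (B ^ Z.of_nat (S m) <= B ^ Z.of_nat (S k)) by (apply Z.pow_le_mono_r; lia); lia. }
    pose proof (zsum_range _ _ (carried_range B h m (u / B) (e / 2) (e mod 2) HB Hh Hu' ltac:(lia)))
      as Hz.
    subst d; cbn [carried] in *.
    set (d := carried B (3 * B * h) m (u / B) (e / 2) (e mod 2)) in *.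
    cbn [zsum fold_right] in Hf |- *; fold (zsum d) in *.
    apply Forall_cons_iff in Hr; destruct Hr as [Hr _].
    assert (HBe : 0 <= B * (e mod 2) <= B).
    { assert (Hem : e mod 2 = 0 \/ e mod 2 = 1) by lia; destruct Hem as [-> | ->]; lia. }
    pose proof Hu' as Hu2; unfold bounded in Hu2.
    eapply runs_le; cycle 1.
    { bin; bin; bin; bin; bin; bin; bin; bin; bin; bin; bin.
      eapply runs_weaken; [reflexivity | |
        eapply (IH ltac:(lia) (S a) (u / B) (e / 2) (e mod 2)
           (f - (u mod B + 3 * B * h + cin - B * (e mod 2))))]; try (rs; lia); auto.
      - cbv beta; fold d; intros R2 M2 (-> & G1 & G2 & G3); repeat split; [lia | |].
        + intros [|i] Hi.
          * rewrite Nat.add_0_r, G3 by (cbn [In]; lia); rs; cbn [nth]; lia.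
          * replace (a + S i)%nat with (S a + i)%nat by lia; cbn [nth]; apply G2; lia.
        + intros i Hi1 Hi2; rewrite G3 by (auto; lia); cbn [In] in Hi1; rs; reflexivity.
      - repeat apply glob_upd; auto; lia.
      - fold d; lia. }
    lia.
Qed.

Lemma query_runs nr g idx R M :
  (k + 3 <= nr)%nat -> env g -> glob g R ->
  (forall i, M (3 * Q + Z.of_nat i) = nth i xs 0) ->
  g 13%nat = Z.of_nat idx -> Z.of_nat idx < Z.of_nat nb * 2 ^ Z.of_nat k ->
  let h := (idx / 2 ^ k + 1)%nat in
  let e := Z.of_nat idx mod 2 ^ Z.of_nat k in
  runs w (query_cmd k nr) R M (nr + 11 * k + 30)
    (fun R' M' => M' = M /\ glob (upd_reg g 15 (Z.of_nat idx + 1)) R' /\ R' 20%nat = 0 /\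
       forall i, (i < nr)%nat -> R' (jreg i) = nth i (sum_query B k xs h e) 0).
Proof.
  intros Hnr Hg HgR HM Hidx Hlt h e.
  pose proof s_lt as (Hs1 & Hs2 & Hs3 & Hs4).
  assert (HL : 0 < L) by now apply body_length_pos.
  assert (Hk : 0 < 2 ^ Z.of_nat k) by (apply Z.pow_pos_nonneg; lia).
  pose proof (Z.mod_pos_bound (Z.of_nat idx) _ Hk) as He; fold e in He.
  assert (Ed : Z.of_nat idx / 2 ^ Z.of_nat k + 1 = Z.of_nat h).
  { unfold h; rewrite Nat2Z.inj_add, Nat2Z.inj_div, Nat2Z.inj_pow; reflexivity. }
  assert (Hh : 1 <= Z.of_nat h <= Z.of_nat nb).
  { assert (Z.of_nat idx / 2 ^ Z.of_nat k < Z.of_nat nb) by (apply Z.div_lt_upper_bound; lia).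
    pose proof (Z.div_pos (Z.of_nat idx) _ ltac:(lia) Hk); lia. }
  assert (EsZ : Z.of_nat s = Z.of_nat nb * (L + 1))
    by (unfold s; rewrite Nat2Z.inj_mul, Nat2Z.inj_succ, Z2Nat.id by lia; reflexivity).
  assert (HLh : L * Z.of_nat h <= Z.of_nat s).
  { rewrite EsZ, Z.mul_comm; apply Z.mul_le_mono_nonneg; lia. }
  assert (HBh : 0 <= 3 * B * Z.of_nat h <= L * Z.of_nat h).
  { unfold L, body_length; split; [nia|]; apply Z.mul_le_mono_nonneg_r; nia. }
  pose proof (sum_query_range B k xs HB nth_bounded h e ltac:(lia)) as Hq.
  set (u := nth (h - 1) xs 0) in *.
  set (d := carried B (3 * B * Z.of_nat h) k u e 0).
  assert (Eq : sum_query B k xs h e = d ++ [L * Z.of_nat h - zsum d; Z.of_nat h - 1]) by reflexivity.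
  assert (Hz : 0 <= L * Z.of_nat h - zsum d <= L * Z.of_nat h).
  { rewrite Eq in Hq; apply Forall_app in Hq; destruct Hq as [_ Hq].
    apply Forall_cons_iff in Hq; destruct Hq as [Hq _]; exact Hq. }
  pose proof (length_carried B (3 * B * Z.of_nat h) k u e 0) as Hld; fold d in Hld.
  unfold query_cmd; eapply runs_le; cycle 1.
  { pose proof (g_one g Hg) as Hone; bin.
    (* From here on the new stamp counts among the fixed registers, and the updated assignment takes
       the place of [g]. *)
    assert (HgR' : glob (upd_reg g 15 (Z.of_nat idx + 1)) (upd_reg R 15 (Z.of_nat idx + 1)))
      by (intros i Hi; destruct (Nat.eq_dec i 15) as [->|]; rs; auto).
    assert (Hg' : env (upd_reg g 15 (Z.of_nat idx + 1)))
      by (destruct Hg; constructor; rs; assumption).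
    assert (Hidx' : upd_reg g 15 (Z.of_nat idx + 1) 13%nat = Z.of_nat idx) by now rs.
    clear Hg HgR Hidx Hone; revert HgR' Hg' Hidx'.
    generalize (upd_reg g 15 (Z.of_nat idx + 1)) (upd_reg R 15 (Z.of_nat idx + 1)).
    clear g R; intros g R HgR Hg Hidx.
    pose proof (g_one g Hg); pose proof (g_zero g Hg); pose proof (g_E g Hg);
      pose proof (g_X g Hg); pose proof (g_B3 g Hg); pose proof (g_L g Hg).
    bin; bin; bin; bin; bin; fetch.
    { rewrite Ed; replace (3 * Q + Z.of_nat h - 1) with (3 * Q + Z.of_nat (h - 1)) by lia.
      apply HM. }
    fold u e; rewrite Ed; bin; bin.
    eapply do_seq; [apply clear_regs_runs|].
    intros R1 M1 (-> & F1 & F2).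
    assert (HgR1 : glob g R1) by (intros i Hi; rewrite F2 by lia; rs; auto).
    konst.
    eapply do_seq.
    { eapply (query_digits_runs g 0 k u e (Z.of_nat h) 0 (L * Z.of_nat h)); fold d; auto; try lia;
        try apply nth_bounded; rs; rewrite ?F2 by lia; rs; try lia; auto.
      apply glob_upd; auto; lia. }
    fold d; intros R2 M2 (-> & K1 & K2 & K3).
    assert (HgR2 : glob g R2).
    { intros i Hi; rewrite K3 by (cbn [In]; lia); rs; auto. }
    assert (E24 : R2 24%nat = Z.of_nat h).
    { rewrite K3 by (cbn [In]; lia); rs; rewrite F2 by lia; now rs. }
    bin; bin; konst; nop; repeat split.
    - repeat apply glob_upd; auto; lia.
    - intros i Hi; rewrite Eq.
      destruct (Nat.le_gt_cases i k) as [Hi1|Hi1].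
      + rs; rewrite app_nth1 by lia; apply (K2 i); lia.
      + rewrite app_nth2, Hld by lia.
        destruct (Nat.eq_dec i (k + 1)) as [->|Hn1].
        { rs; replace (k + 1 - S k)%nat with 0%nat by lia; cbn [nth]; lia. }
        destruct (Nat.eq_dec i (k + 2)) as [->|Hn2].
        { rs; replace (k + 2 - S k)%nat with 1%nat by lia; cbn [nth]; lia. }
        (* Registers past the query vector must be 0, as [query_config] reads them with default
           0. *)
        rs; rewrite nth_overflow by (cbn [length]; lia).
        rewrite K3 by (cbn [In]; lia); rs; apply F1; lia. }
  lia.
Qed.

(** * The query loop and the total cost *)

Variables (J : index_algorithm) (nr : nat).
Let pre := pre_code J.
Let qry := query_code J.
Hypothesis HJc : index_word_const J = cJ.
Hypothesis HJ : solves_jumbled_indexing (k + 3) J.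
Hypothesis Hpre : uses_regs nr pre.
Hypothesis Hqry : uses_regs nr qry.
Hypothesis Hnr : (k + 3 <= nr)%nat.
Hypothesis HUp : Z.of_nat (length pre) <= U.
Hypothesis HUq : Z.of_nat (length qry) <= U.
Hypothesis HWw : (W + 4 <= w)%nat.

Let T := sum_text B k xs nb.
Let N := (nb * 2 ^ k)%nat.
Let P := comp 0 (conv_cmd k cJ nr pre qry).

Definition nth_query (idx : nat) : list nat :=
  map Z.to_nat (sum_query B k xs (idx / 2 ^ k + 1) (Z.of_nat idx mod 2 ^ Z.of_nat k)).

Lemma T_text : text (k + 3) s T.
Proof.
  split; [apply (length_T B k xs HB nth_bounded) | apply (T_letters B k xs HB nth_bounded)].
Qed.

Lemma N_Z : Z.of_nat N = Z.of_nat nb * 2 ^ Z.of_nat k.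
Proof. unfold N; rewrite Nat2Z.inj_mul, Nat2Z.inj_pow; reflexivity. Qed.

Lemma index_word : index_word_size (k + 3) J s = W.
Proof. unfold index_word_size, word_size; rewrite HJc; reflexivity. Qed.

Lemma query_index_le idx : (idx < N)%nat -> (1 <= idx / 2 ^ k + 1 <= nb)%nat.
Proof.
  intros Hi; assert (idx / 2 ^ k < nb)%nat; [|lia].
  apply Nat.Div0.div_lt_upper_bound; unfold N in Hi; lia.
Qed.

Lemma nth_query_range idx i : (idx < N)%nat ->
  0 <= nth i (sum_query B k xs (idx / 2 ^ k + 1) (Z.of_nat idx mod 2 ^ Z.of_nat k)) 0 < H.
Proof.
  intros Hi; pose proof (query_index_le idx Hi) as Hh; pose proof s_lt as (Hs1 & Hs2 & Hs3 & Hs4).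
  set (h := (idx / 2 ^ k + 1)%nat) in *.
  pose proof (sum_query_range B k xs HB nth_bounded h (Z.of_nat idx mod 2 ^ Z.of_nat k) ltac:(lia))
    as Hr; rewrite Forall_forall in Hr; fold L in Hr.
  destruct (Nat.lt_ge_cases i (length (sum_query B k xs h (Z.of_nat idx mod 2 ^ Z.of_nat k))))
    as [Hl|Hl]; [|rewrite nth_overflow by exact Hl; lia].
  specialize (Hr _ (nth_In _ 0 Hl)).
  assert (L * Z.of_nat h <= Z.of_nat s); [|lia].
  assert (HL : 0 < L) by now apply body_length_pos.
  unfold s; rewrite Nat2Z.inj_mul, Nat2Z.inj_succ, Z2Nat.id, Z.mul_comm by lia.
  apply Z.mul_le_mono_nonneg; lia.
Qed.

Lemma nth_query_vector idx : (idx < N)%nat -> query_vector (k + 3) J s (nth_query idx).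
Proof.
  intros Hi; split.
  - unfold nth_query; rewrite length_map; apply length_sum_query.
  - rewrite index_word; fold H; apply Forall_forall; intros z Hz.
    apply In_nth with (d := 0%nat) in Hz; destruct Hz as (i & _ & <-).
    unfold nth_query; rewrite nth_map_to_nat.
    pose proof (nth_query_range idx i Hi); lia.
Qed.

(** The difference i - j is the number of blocks, and the 1-based x_j sits at block j - 1. *)
Lemma conv3sum_iff :
  conv3sum xs <-> exists idx, (idx < N)%nat /\ jumbled_match (k + 3) T (nth_query idx).
Proof.
  assert (Hk : 0 < 2 ^ Z.of_nat k) by (apply Z.pow_pos_nonneg; lia).
  assert (Hkn : (2 ^ k <> 0)%nat) by (apply Nat.pow_nonzero; lia).
  split.
  - intros (i & j & Hj & Hji & Hi & E).
    destruct (proj2 (sum_query_match B k xs HB nth_bounded nb (i - j) ltac:(lia)))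
      as (e & He & Hm).
    { exists (j - 1)%nat; split; [unfold nb; fold n in Hi; lia|].
      replace (j - 1 + (i - j))%nat with (i - 1)%nat by lia; exact E. }
    exists ((i - j - 1) * 2 ^ k + Z.to_nat e)%nat.
    assert (Hen : (Z.to_nat e < 2 ^ k)%nat).
    { apply Nat2Z.inj_lt; rewrite Nat2Z.inj_pow, Z2Nat.id by lia; apply He. }
    split.
    { pose proof (Nat.mul_le_mono_r (i - j - 1 + 1) nb (2 ^ k)
                    ltac:(unfold nb; fold n in Hi; lia)); unfold N; lia. }
    unfold nth_query.
    replace (((i - j - 1) * 2 ^ k + Z.to_nat e) / 2 ^ k + 1)%nat with (i - j)%nat.
    2: { rewrite Nat.div_add_l, Nat.div_small by lia; lia. }
    replace (Z.of_nat ((i - j - 1) * 2 ^ k + Z.to_nat e) mod 2 ^ Z.of_nat k) with e; [exact Hm|].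
    rewrite Nat2Z.inj_add, Nat2Z.inj_mul, Nat2Z.inj_pow, Z2Nat.id, Z.add_comm, Z.mod_add by lia.
    symmetry; apply Z.mod_small; lia.
  - intros (idx & Hidx & Hm); pose proof (query_index_le idx Hidx) as Hh.
    set (h := (idx / 2 ^ k + 1)%nat) in *.
    destruct (proj1 (sum_query_match B k xs HB nth_bounded nb h ltac:(lia))) as (j & Hj & E).
    { exists (Z.of_nat idx mod 2 ^ Z.of_nat k); split; [now apply Z.mod_pos_bound | exact Hm]. }
    exists (j + h + 1)%nat, (j + 1)%nat; unfold nb in *; fold n.
    repeat split; try lia.
    replace (j + h + 1 - 1)%nat with (j + h)%nat by lia.
    replace (j + 1 - 1)%nat with j by lia.
    replace (j + h + 1 - (j + 1) - 1)%nat with (h - 1)%nat by lia; exact E.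
Qed.

Local Open Scope R_scope.

Definition query_steps (t : nat) (c : config) (idx : nat) : R :=
  mean_steps qry W t (query_config c (nth_query idx)).

Fixpoint queries_steps (t : nat) (c : config) (j idx : nat) : R :=
  match j with
  | O => 0
  | S j' => query_steps t c idx + queries_steps t c j' (S idx)
  end.

Lemma queries_steps_nonneg t c j idx : 0 <= queries_steps t c j idx.
Proof.
  revert idx; induction j as [|j IH]; intros idx; simpl; [lra|].
  pose proof (mean_steps_nonneg qry W t (query_config c (nth_query idx))).
  unfold query_steps; specialize (IH (S idx)); lra.
Qed.

(** Between queries only the overlay [H, 5H) may differ from the memory [Mb] left by preprocessing,
    and its stamps are at most [idx]. *)
Record query_inv (c : config) (Mb : Z -> Z) (idx : nat) (R : nat -> Z) (M : Z -> Z) : Prop := QInv {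
  q_env : env R;
  q_idx : R 13%nat = Z.of_nat idx;
  q_res : R 14%nat = 0%Z \/ R 14%nat = 1%Z;
  q_ans : R 14%nat <> 0%Z <-> exists i, (i < idx)%nat /\ jumbled_match (k + 3) T (nth_query i);
  q_len : R 19%nat = Z.of_nat (length qry);
  q_mem : forall a, (a < H \/ 5 * H <= a)%Z -> M a = Mb a;
  q_stamp : forall a, fits W a -> (0 <= M (a + Q) <= Z.of_nat idx)%Z }.

(** Covers the loop test, [query_cmd], the exit of the simulation, the answer and the jump back,
    rounded up. *)
Definition query_overhead : nat := (nr + 11 * k + 40)%nat.

Lemma fits_H a : fits W a <-> (- H <= a < H)%Z.
Proof. reflexivity. Qed.

(** The cost bound for the later queries does not depend on the coins of the current one, since the
    index survives unchanged. So [sim_loop_good] is used with a constant [G], and the bounds simply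
    add up. *)
Lemma query_loop_good t bs Mb p j idx R M :
  let c := exec pre W bs (pre_config T) in
  halted pre c = true ->
  code_at P p (While (TLt 13 10) (query_cmd k nr ;; sim_loop true qry ;; answer_cmd) ;;
               Bin Add 0 14 17) ->
  length P = (p + size (While (TLt 13 10) (query_cmd k nr ;; sim_loop true qry ;; answer_cmd) ;;
                        Bin Add 0 14 17))%nat ->
  (forall a, fits W a -> fits W (mem c a) /\ Mb a = mem c a) ->
  (forall i, Mb (3 * Q + Z.of_nat i)%Z = nth i xs 0%Z) ->
  (idx + j = N)%nat -> query_inv c Mb idx R M ->
  good P w (conv3sum xs) t (Config p R M)
    (INR (j * query_overhead) + INR (length qry * 3 + 11) * queries_steps t c j idx + 3).
Proof.
  intros c Hc Hcode HlP Hmem HX; pose proof Hcode as ((Ha & Hb & (Hc1 & Hc2 & Hc3) & Hd) & He).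
  pose proof s_lt as (Hs1 & Hs2 & Hs3 & Hs4).
  set (body := query_cmd k nr ;; sim_loop true qry ;; answer_cmd) in *.
  revert idx R M; induction j as [|j IH]; intros idx R M Hj [Qe Qi Qr Qa Ql Qm Qs].
  - assert (Hq : holds (TLt 13 10) R = false).
    { simpl; rewrite Qi, (g_tot R Qe), <- N_Z; apply Z.ltb_ge; lia. }
    cbn [queries_steps Nat.mul]; rewrite Rmult_0_r, Rplus_0_r; simpl INR.
    replace (0 + 3) with (INR 2 + (INR 1 + 0)) by (simpl; lra).
    eapply good_reach; [|simpl; lra|].
    { econstructor; [eapply halted_at; eauto | |].
      - intros b; rewrite (step_branch _ _ _ _ _ _ _ _ Ha), Hq; reflexivity.
      - replace (S p) with (p + 1)%nat by lia.
        apply reach_1; [eapply halted_at; eauto|].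
        intros b; apply (step_goto _ _ _ _ _ _ _ Hb). }
    cbn [size] in He, HlP; rewrite Nat.add_assoc in He.
    eapply good_runs.
    { apply (runs_bin w Add 0 14 17 R M
        (fun R' M' => R' 0%nat <> 0%Z <-> conv3sum xs)); rs.
      rewrite (g_zero R Qe); simpl eval_binop; rewrite Z.add_0_r.
      rewrite wrap_id by (try lia; unfold fits; lia).
      rewrite Qa, conv3sum_iff; replace idx with N by lia; reflexivity. }
    { exact He. }
    { lra. }
    intros R' M' HR; apply good_halted; [|exact HR].
    apply Nat.leb_le; cbn [pc]; rewrite HlP; cbn [size]; lia.
  - assert (Hq : holds (TLt 13 10) R = true).
    { simpl; rewrite Qi, (g_tot R Qe), <- N_Z; apply Z.ltb_lt; lia. }
    assert (Hidx : (idx < N)%nat) by lia.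
    pose proof (queries_steps_nonneg t c j (S idx)) as Hn1.
    pose proof (mean_steps_nonneg qry W t (query_config c (nth_query idx))) as Hn2.
    pose proof (pos_INR (length qry * 3 + 11)) as Hn3.
    pose proof (pos_INR (j * query_overhead)) as Hn4.
    cbn [queries_steps]; unfold query_steps.
    set (G := INR (j * query_overhead) +
              INR (length qry * 3 + 11) * queries_steps t c j (S idx) + 3) in *.
    assert (HG : 0 <= G) by (unfold G; nra).
    set (m := mean_steps qry W t (query_config c (nth_query idx))) in *.
    assert (HKm : 0 <= INR (length qry * 3 + 11) * m) by now apply Rmult_le_pos.
    pose proof (pos_INR 5) as HI5; pose proof (pos_INR 1) as HI1.
    apply (good_anti _ _ _ t t _ (INR 1 + (INR (nr + 11 * k + 30) +
        (INR (length qry * 3 + 11) * m + 2 + (INR 5 + (INR 1 + G)))))); [lia | |].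
    { unfold G.
      replace (S j * query_overhead)%nat with (10 + ((nr + 11 * k + 30) + j * query_overhead))%nat
        by (change (S j * query_overhead)%nat with (query_overhead + j * query_overhead)%nat;
            unfold query_overhead at 2; lia).
      rewrite (plus_INR 10), (plus_INR (nr + 11 * k + 30)).
      replace (INR 10) with 10 by (simpl; lra); replace (INR 5) with 5 by (simpl; lra).
      rewrite Rmult_plus_distr_l; simpl (INR 1); lra. }
    eapply good_reach; [apply reach_1; [eapply halted_at; eauto|] | |].
    { intros b; rewrite (step_branch _ _ _ _ _ _ _ _ Ha), Hq; reflexivity. }
    { pose proof (pos_INR (nr + 11 * k + 30)); lra. }
    eapply good_runs.
    { apply (query_runs nr R idx R M Hnr Qe); auto; [intros i Hi; reflexivity | | rewrite <- N_Z; lia].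
      intros i; rewrite Qm by lia; apply HX. }
    { exact Hc1. }
    { lra. }
    intros R1 M1 (-> & HgR & Hpc & Hreg).
    set (g := upd_reg R 15 (Z.of_nat idx + 1)%Z) in *.
    assert (Hnq : forall i, Z.of_nat (nth i (nth_query idx) 0%nat) =
       nth i (sum_query B k xs (idx / 2 ^ k + 1) (Z.of_nat idx mod 2 ^ Z.of_nat k)) 0%Z).
    { intros i; unfold nth_query; rewrite nth_map_to_nat, Z2Nat.id; [reflexivity|].
      apply nth_query_range; exact Hidx. }
    assert (Hsim : sim true nr W (length qry) g Mb (query_config c (nth_query idx)) R1 M).
    { constructor; unfold query_config, start; cbn [pc regs mem].
      - exact HgR.
      - rewrite Hpc; reflexivity.
      - intros i Hi; rewrite Hreg by lia; symmetry; apply Hnq.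
      - intros i; rewrite Hnq; apply fits_H; pose proof (nth_query_range idx i Hidx); lia.
      - intros a Hfa; now apply Hmem.
      (* The overlay starts out empty: old stamps are at most [idx], the current one is
         [idx + 1]. *)
      - unfold memrel; cbv zeta; fold Q; fold H; unfold g; rs; split; [|split].
        + intros a Hfa; pose proof (Qs a Hfa).
          destruct (Z.eqb_spec (M (a + Q)%Z) (Z.of_nat idx + 1)); [lia|].
          symmetry; now apply Hmem.
        + exact Qm.
        + intros a Hfa; pose proof (Qs a Hfa); lia. }
    eapply good_anti; [reflexivity | |
      eapply (sim_loop_good true nr W w g qry Mb) with
        (G := fun _ => INR 5 + (INR 1 + G)); [..|exact Hc2|exact Hsim| |]].
    + apply Rplus_le_compat_l.
      eapply Rle_trans; [|apply Req_le, (coin_mean_const t (INR 5 + (INR 1 + G)))].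
      apply coin_mean_le; intros bs'; cbv zeta.
      destruct (halted qry _); lra.
    + unfold W; nia.
    + exact HWw.
    + lia.
    + exact Hqry.
    + unfold g; rs; apply (g_Q R Qe).
    + unfold g; rs; apply (g_H R Qe).
    + unfold g; rs; exact Ql.
    + intros _; unfold g; rs; lia.
    + intros _; lra.
    + intros bs' R2 M2 c' Hc' [Sg Sp Sr Sf Sm Sy].
      (* With zero error the answer is right for all coins, so no error accumulates over the
         queries. *)
      pose proof (proj2 HJ s T (nth_query idx) bs bs' T_text (nth_query_vector idx Hidx)) as Hcor.
      rewrite index_word in Hcor; cbv zeta in Hcor.
      specialize (Hcor Hc Hc').
      fold c in Hcor; fold c' in Hcor; unfold accepts in Hcor.
      assert (Eg : env g).
      { destruct Qe; unfold g; constructor; rs; assumption. }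
      assert (Hans : runs w answer_cmd R2 M2 5 (query_inv c Mb (S idx))).
      { unfold answer_cmd; apply (runs_le (2 + 2 + 1)); [lia|].
        apply runs_seq, runs_if.
        cbn [holds]; rewrite (Sg 17%nat), (g_zero g Eg) by lia.
        replace (R2 40%nat) with (regs c' 0%nat) by (symmetry; apply (Sr 0%nat); lia).
        assert (Hsy : (forall a, (a < H \/ 5 * H <= a)%Z -> M2 a = Mb a) /\
                      (forall a, fits W a -> (0 <= M2 (a + Q) <= Z.of_nat (S idx))%Z)).
        { destruct Sy as (_ & Y2 & Y3); split; [exact Y2|].
          intros a Hfa; specialize (Y3 a Hfa); unfold g in Y3; rewrite upd_same in Y3.
          fold Q in Y3; lia. }
        destruct Hsy as [Hsy1 Hsy2].
        assert (E13 : R2 13%nat = Z.of_nat idx) by (rewrite Sg by lia; unfold g; now rs).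
        assert (E14 : R2 14%nat = R 14%nat) by (rewrite Sg by lia; unfold g; now rs).
        assert (E19 : R2 19%nat = R 19%nat) by (rewrite Sg by lia; unfold g; now rs).
        assert (E1 : R2 1%nat = 1%Z) by (rewrite Sg by lia; apply (g_one g Eg)).
        assert (E2 : env R2).
        { destruct Eg; constructor; rewrite Sg by lia; assumption. }
        assert (HN : (Z.of_nat N <= U)%Z) by (rewrite N_Z; exact HUt).
        destruct (Z.eqb_spec (regs c' 0%nat) 0) as [Ez|Ez].
        - apply (runs_le 0); [lia|]; nop.
          apply (runs_le (1 + 0)); [lia|]; apply runs_seq, runs_bin; nop.
          rewrite E13, E1; cbn [eval_binop].
          rewrite wrap_id by (try lia; unfold fits; lia).
          constructor; rs; auto.
          + destruct E2; constructor; rs; assumption.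
          + lia.
          + rewrite E14; exact Qr.
          + rewrite E14, Qa; split; intros (i & Hi & Hm).
            * exists i; split; [lia | exact Hm].
            * destruct (Nat.eq_dec i idx) as [->|]; [|exists i; split; [lia | exact Hm]].
              exfalso; apply Hcor in Hm; contradiction.
          + rewrite E19; exact Ql.
        - eapply runs_le; cycle 1; [konst; nop | lia].
          apply (runs_le (1 + 0)); [lia|]; apply runs_seq, runs_bin; nop.
          rs; rewrite E13, E1; cbn [eval_binop].
          rewrite wrap_id by (try lia; unfold fits; lia).
          constructor; rs; auto.
          + destruct E2; constructor; rs; assumption.
          + lia.
          + split; [intros _ | lia].
            exists idx; split; [lia | now apply Hcor].
          + rewrite E19; exact Ql. }
      eapply good_runs; [exact Hans | exact Hc3 | lra|].
      intros R3 M3 HI3.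
      eapply good_reach; [apply reach_1| exact HG |].
      { eapply halted_at; rewrite <- Hd; f_equal; unfold body; cbn [size]; lia. }
      { intros b; apply step_goto; rewrite <- Hd; f_equal; unfold body; cbn [size]; lia. }
      apply IH; [lia | exact HI3].
Qed.

Definition setup_cost : nat :=
  ((k + 6) * Z.to_nat B + 3 * lg + cJ + 60 + (n * 7 + 3) +
   (nb * (Z.to_nat L * 5 + 11 * k + 40) + 4) + (nr + 2))%nat.

(** Here the continuation cost does depend on the simulated configuration: the queries run on the
    memory that the coins of preprocessing have produced. *)
Lemma conv_good t :
  good P w (conv3sum xs) t (input_config xs)
    (INR setup_cost + (INR (length pre * 3 + 11) * mean_steps pre W t (pre_config T) + 2 +
     coin_mean t (fun bs => let c := exec pre W bs (pre_config T) in
       if halted pre c then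
         INR 3 + (INR (N * query_overhead) +
                  INR (length qry * 3 + 11) * queries_steps t c N 0 + 3)
       else 0))).
Proof.
  pose proof s_lt as (Hs1 & Hs2 & Hs3 & Hs4).
  assert (Hcode : code_at P 0 (conv_cmd k cJ nr pre qry)) by apply comp_code_at_0.
  assert (HlP : length P = size (conv_cmd k cJ nr pre qry)) by apply size_comp.
  destruct Hcode as (Ha & Hb & Hc & Hd & He & Hf & Hg).
  unfold conv_cmd in HlP; cbn [size] in HlP.
  pose proof T_text as [HTl HTa].
  set (G := fun c : config => INR 3 + (INR (N * query_overhead) +
                  INR (length qry * 3 + 11) * queries_steps t c N 0 + 3)).
  assert (HG : forall c, 0 <= G c).
  { intros c; unfold G.
    pose proof (Rmult_le_pos _ _ (pos_INR (length qry * 3 + 11)) (queries_steps_nonneg t c N 0)).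
    pose proof (pos_INR (N * query_overhead)); pose proof (pos_INR 3); lra. }
  set (v := INR (length pre * 3 + 11) * mean_steps pre W t (pre_config T) + 2 +
     coin_mean t (fun bs => let c := exec pre W bs (pre_config T) in
       if halted pre c then G c else 0)).
  assert (Hv : 0 <= v).
  { unfold v.
    pose proof (Rmult_le_pos _ _ (pos_INR (length pre * 3 + 11))
                  (mean_steps_nonneg pre W t (pre_config T))).
    assert (0 <= coin_mean t (fun bs => let c := exec pre W bs (pre_config T) in
       if halted pre c then G c else 0)).
    { apply coin_mean_nonneg; intros bs; cbv zeta.
      destruct (halted pre _); [apply HG | lra]. }
    lra. }
  change (good P w (conv3sum xs) t (input_config xs) (INR setup_cost + v)).
  unfold setup_cost; rewrite 3!(plus_INR (_ + _)), !Rplus_assoc.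
  pose proof (pos_INR (n * 7 + 3)).
  pose proof (pos_INR (nb * (Z.to_nat L * 5 + 11 * k + 40) + 4)).
  pose proof (pos_INR (nr + 2)).
  eapply good_runs; [apply (init_runs (length pre)) | exact Ha | lra |]; auto.
  intros R1 M1 (-> & Hg1 & H19); set (g := R1) in Hg1, H19.
  assert (HgR1 : glob g R1) by (intros i _; reflexivity).
  eapply good_runs; [apply (copy_runs g) | exact Hb | lra |]; auto.
  intros R2 M2 (HgR2 & HM2).
  eapply good_runs; [apply (text_runs g) | exact Hc | lra |]; auto.
  intros R3 M3 (HgR3 & HM3); fold T in HM3.
  eapply good_runs; [apply (pre_runs nr g) | exact Hd | lra |]; auto; [lia|].
  intros R4 M4 (-> & HgR4 & Hpc & Hreg).
  assert (Hsim : sim false nr W (length pre) g M3 (pre_config T) R4 M3).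
  { constructor; unfold pre_config, input_config, start; cbn [pc regs mem].
    - exact HgR4.
    - rewrite Hpc; reflexivity.
    - intros i Hi; rewrite Hreg, length_map, HTl by lia; reflexivity.
    - intros i; apply fits_H; unfold upd_reg; rewrite length_map, HTl.
      destruct (Nat.eqb i 0); lia.
    - intros a Ha'; apply fits_H.
      destruct (Z.leb_spec 0 a) as [Ha0|Ha0]; [|rewrite input_mem_neg; lia].
      replace a with (Z.of_nat (Z.to_nat a)) by lia; rewrite input_mem_nth.
      destruct (Nat.lt_ge_cases (Z.to_nat a) (length T)) as [Hl|Hl].
      + rewrite (nth_indep _ 0%Z (Z.of_nat 0)) by (rewrite length_map; exact Hl).
        rewrite map_nth.
        rewrite Forall_forall in HTa; specialize (HTa _ (nth_In T 0%nat Hl)); lia.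
      + rewrite nth_overflow by (rewrite length_map; exact Hl); lia.
    - split; [|auto].
      intros a Ha'; rewrite fits_H in Ha'; rewrite HM3, (input_mem_neg xs) by lia; apply Z.add_0_r. }
  eapply (sim_loop_good false nr W w g pre M3); [..|exact He|exact Hsim|exact HG|].
  - unfold W; nia.
  - exact HWw.
  - lia.
  - exact Hpre.
  - apply (g_Q g Hg1).
  - apply (g_H g Hg1).
  - exact H19.
  - discriminate.
  - intros bs R5 M5 c Hc' [Sg Sp Sr Sf Sm (Y1 & Y2)].
    unfold G.
    assert (Hg5 : env R5) by (destruct Hg1; constructor; rewrite Sg by lia; assumption).
    assert (Hmid : runs w (mid_cmd (length qry)) R5 M5 3 (query_inv c M5 0)).
    { unfold mid_cmd; konst; konst; konst; nop.
      constructor; rs; auto.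
      - destruct Hg5; constructor; rs; assumption.
      - split; [lia | intros (i & Hi & _); lia].
      (* The stamp cells lie between the text and the copied input, where the memory is still 0. *)
      - intros a Ha'; rewrite fits_H in Ha'; rewrite Y2 by (rewrite fits_H; lia).
        rewrite HM3, input_mem_big, input_mem_neg by (rewrite ?length_map; lia); lia. }
    eapply good_runs; [exact Hmid | exact Hf | |].
    { specialize (HG c); unfold G in HG; pose proof (pos_INR 3).
      pose proof (Rmult_le_pos _ _ (pos_INR (length qry * 3 + 11)) (queries_steps_nonneg t c N 0)).
      pose proof (pos_INR (N * query_overhead)); lra. }
    intros R6 M6 HI.
    eapply (query_loop_good t bs M5); [exact Hc' | exact Hg | | | | reflexivity | exact HI].
    + cbn [size]; rewrite HlP; lia.
    + intros a Ha'; split; [apply Sm; exact Ha' | apply Y1; exact Ha'].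
    + intros i; rewrite Y2 by (rewrite fits_H; lia).
      apply (mem_app_input _ _ _ HM3); lia.
Qed.

(** The bound [qt] holds only after averaging over the coins of preprocessing too, so the sum over
    the queries is exchanged with that mean. As [expected_query_time] cuts off both coin sequences
    at the same [t], each summand is one of the terms of its supremum. *)
Lemma conv_time t (pt qt : R) :
  Rbar_le (preprocessing_time (k + 3) J s) (Finite pt) ->
  Rbar_le (query_time (k + 3) J s) (Finite qt) ->
  mean_steps P w t (input_config xs) <=
    INR setup_cost + 8 + INR (N * query_overhead) +
    INR (length pre * 3 + 11) * pt + INR (length qry * 3 + 11) * (INR N * qt).
Proof.
  intros Hpt Hqt; destruct (conv_good t) as [Hle _]; eapply Rle_trans; [exact Hle|]; clear Hle.
  assert (H1 : mean_steps pre W t (pre_config T) <= pt).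
  { change (Rbar_le (Finite (mean_steps pre W t (pre_config T))) (Finite pt)).
    eapply Rbar_le_trans; [|exact Hpt].
    eapply Rbar_le_trans; [|exact (worst_case_ub _ _ T T_text)].
    rewrite index_word; apply (Sup_seq_ub (fun t => mean_steps pre W t (pre_config T))). }
  set (q := fun i => coin_mean t (fun bs => let c := exec pre W bs (pre_config T) in
              if halted pre c then query_steps t c i else 0)).
  assert (H2 : forall i, (i < N)%nat -> q i <= qt).
  { intros i Hi; change (Rbar_le (Finite (q i)) (Finite qt)).
    eapply Rbar_le_trans; [|exact Hqt].
    eapply Rbar_le_trans;
      [|exact (worst_case_ub _ _ (T, nth_query i) (conj T_text (nth_query_vector i Hi)))].
    unfold expected_query_time; cbv zeta; rewrite index_word.
    apply (Sup_seq_ub (fun t => coin_mean t (fun bs =>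
      if halted pre (exec pre W bs (pre_config T))
      then query_steps t (exec pre W bs (pre_config T)) i else 0))). }
  assert (H3 : forall j idx, (idx + j <= N)%nat ->
     coin_mean t (fun bs => let c := exec pre W bs (pre_config T) in
       if halted pre c then queries_steps t c j idx else 0) <= INR j * qt).
  { induction j as [|j IH]; intros idx Hj.
    - apply Req_le; simpl INR; rewrite Rmult_0_l.
      rewrite (coin_mean_ext _ _ (fun _ => 0)); [apply coin_mean_const|].
      intros bs; cbv zeta; destruct (halted pre _); reflexivity.
    - rewrite (coin_mean_ext _ _ (fun bs =>
        (let c := exec pre W bs (pre_config T) in
           if halted pre c then query_steps t c idx else 0) +
        (let c := exec pre W bs (pre_config T) in
           if halted pre c then queries_steps t c j (S idx) else 0))).
      + rewrite coin_mean_plus, S_INR; specialize (IH (S idx) ltac:(lia)).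
        specialize (H2 idx ltac:(lia)); unfold q in H2; cbv zeta in H2, IH |- *; lra.
      + intros bs; cbv zeta; destruct (halted pre _); cbn [queries_steps]; lra. }
  specialize (H3 N 0%nat ltac:(lia)).
  (* [a] is the cost after preprocessing that is independent of the index; it is paid with
     probability at most 1. *)
  set (a := INR 3 + (INR (N * query_overhead) + 3)).
  rewrite (coin_mean_ext _ _ (fun bs =>
     a * (let c := exec pre W bs (pre_config T) in if halted pre c then 1 else 0) +
     INR (length qry * 3 + 11) * (let c := exec pre W bs (pre_config T) in
       if halted pre c then queries_steps t c N 0 else 0))).
  2: { intros bs; cbv zeta; unfold a; destruct (halted pre _); lra. }
  rewrite coin_mean_plus, !coin_mean_scal.
  assert (H4 : coin_mean t (fun bs => let c := exec pre W bs (pre_config T) in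
                 if halted pre c then 1 else 0) <= 1).
  { eapply Rle_trans; [|apply Req_le, (coin_mean_const t 1)].
    apply coin_mean_le; intros bs; cbv zeta; destruct (halted pre _); lra. }
  assert (Ha : 0 <= a)
    by (unfold a; pose proof (pos_INR (N * query_overhead)); pose proof (pos_INR 3); lra).
  pose proof (Rmult_le_compat_l _ _ _ (pos_INR (length pre * 3 + 11)) H1).
  pose proof (Rmult_le_compat_l _ _ _ (pos_INR (length qry * 3 + 11)) H3).
  pose proof (Rmult_le_compat_l _ _ _ Ha H4) as Hb.
  assert (Ea : a = 6 + INR (N * query_overhead)) by (unfold a; simpl (INR 3); lra).
  rewrite Ea in *; lra.
Qed.

End Phases.

Local Open Scope R_scope.

(** * Choice of base and word size *)

Definition reg_bound (r : nat) (J : index_algorithm) : nat :=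
  (S (list_max (flat_map instr_regs (pre_code J ++ query_code J))) + r)%nat.

(** In the word constant, the product covers the word size of the index, as lg + 1 <= (k + 8) (log n
    + 1). The other terms cover constants depending on [k] and the two program lengths, which occur
    as simulated program counters. *)
Definition conv_algorithm (k : nat) (J : index_algorithm) : algorithm :=
  Algorithm
    (comp 0 (conv_cmd k (index_word_const J) (reg_bound (k + 3) J) (pre_code J) (query_code J)))
    (index_word_const J * (k + 8) + 2 * k + 20 + length (pre_code J) + length (query_code J)).

Lemma reg_bound_uses r J J' :
  (forall I, In I J' -> In I (pre_code J ++ query_code J)) -> uses_regs (reg_bound r J) J'.
Proof.
  intros HI; apply Forall_forall; intros I Hin; apply Forall_forall; intros i Hi.
  pose proof (proj1 (list_max_le _ _) (Nat.le_refl
    (list_max (flat_map instr_regs (pre_code J ++ query_code J))))) as Hm.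
  rewrite Forall_forall in Hm.
  assert (i <= list_max (flat_map instr_regs (pre_code J ++ query_code J)))%nat
    by (apply Hm, in_flat_map; eauto).
  unfold reg_bound; lia.
Qed.

(** Enough digits are needed to represent the inputs, minimality to keep the text short. The search
    ends by n + 1, as (n + 1)^(k+1) > n. *)
Lemma least_base (k n : nat) : exists B : Z,
  (0 < B)%Z /\ (Z.of_nat n <= B ^ Z.of_nat (S k))%Z /\
  (forall b, (1 <= b < B)%Z -> (b ^ Z.of_nat (S k) < Z.of_nat n)%Z).
Proof.
  assert (Hex : forall m : nat,
    (forall b, (1 <= b <= Z.of_nat m)%Z -> (b ^ Z.of_nat (S k) < Z.of_nat n)%Z) \/
    exists B : Z, (0 < B)%Z /\ (Z.of_nat n <= B ^ Z.of_nat (S k))%Z /\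
      (forall b, (1 <= b < B)%Z -> (b ^ Z.of_nat (S k) < Z.of_nat n)%Z)).
  { induction m as [|m [IH|IH]]; [left; intros; lia | | right; exact IH].
    destruct (Z.lt_ge_cases (Z.of_nat (S m) ^ Z.of_nat (S k)) (Z.of_nat n)) as [Hl|Hg].
    - left; intros b Hb; destruct (Z.eq_dec b (Z.of_nat (S m))) as [->|]; [exact Hl|].
      apply IH; lia.
    - right; exists (Z.of_nat (S m)); split; [lia | split; [exact Hg|]].
      intros b Hb; apply IH; lia. }
  destruct (Hex (S n)) as [Hall|]; [exfalso|assumption].
  specialize (Hall (Z.of_nat (S n)) ltac:(lia)).
  assert (Z.of_nat (S n) ^ 1 <= Z.of_nat (S n) ^ Z.of_nat (S k))%Z by (apply Z.pow_le_mono_r; lia).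
  rewrite Z.pow_1_r in *; lia.
Qed.

Definition sum_text_length (B : Z) (k n : nat) : nat :=
  ((n - 1) * S (Z.to_nat (body_length B k)))%nat.

Lemma base_le (k n : nat) (B : Z) : (0 < B)%Z ->
  (forall b, (1 <= b < B)%Z -> (b ^ Z.of_nat (S k) < Z.of_nat n)%Z) ->
  (B <= Z.of_nat n + 1)%Z.
Proof.
  intros HB Hmin; destruct (Z.le_gt_cases B 1); [lia|].
  specialize (Hmin (B - 1)%Z ltac:(lia)).
  assert ((B - 1) ^ 1 <= (B - 1) ^ Z.of_nat (S k))%Z by (apply Z.pow_le_mono_r; lia).
  rewrite Z.pow_1_r in *; lia.
Qed.

Lemma succ_le_pow2 (m : nat) : (Z.of_nat m + 1 <= 2 ^ Z.of_nat m)%Z.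
Proof.
  induction m as [|m IH]; [simpl; lia|].
  rewrite Nat2Z.inj_succ, Z.pow_succ_r by lia; lia.
Qed.

Section Bounds.

Variables (k n : nat) (B : Z) (J : index_algorithm).
Let l := (Nat.log2 n + 1)%nat.
Let w := word_size (word_const (conv_algorithm k J)) n.
Let U := (2 ^ (Z.of_nat w - 5))%Z.
Let s := sum_text_length B k n.
Let lg := Nat.log2 (s + (k + 3)).
Let cJ := index_word_const J.
Hypothesis HcJ : (2 <= cJ)%nat.
Hypothesis HB : (0 < B)%Z.
Hypothesis HBmin : forall b, (1 <= b < B)%Z -> (b ^ Z.of_nat (S k) < Z.of_nat n)%Z.

Lemma w_eq : w = ((cJ * (k + 8) + 2 * k + 20 + length (pre_code J) + length (query_code J)) * l)%nat.
Proof. reflexivity. Qed.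

Lemma n_lt_pow : (Z.of_nat n + 1 <= 2 ^ Z.of_nat l)%Z.
Proof.
  destruct (Nat.eq_dec n 0) as [->|Hn]; [simpl; lia|].
  pose proof (Nat.log2_spec n ltac:(lia)) as [_ Hl].
  apply Nat2Z.inj_lt in Hl; rewrite Nat2Z.inj_pow in Hl.
  replace (S (Nat.log2 n)) with l in Hl by (unfold l; lia).
  change (Z.of_nat 2) with 2%Z in Hl; lia.
Qed.

Lemma pow_le_U (x : Z) (e : nat) : (x <= 2 ^ Z.of_nat e)%Z -> (e + 5 <= w)%nat -> (x <= U)%Z.
Proof.
  intros Hx He; etransitivity; [exact Hx|]; apply Z.pow_le_mono_r; lia.
Qed.

Lemma l_pos : (1 <= l)%nat.
Proof. unfold l; lia. Qed.

Lemma B_le_pow : (B <= 2 ^ Z.of_nat l)%Z.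
Proof. pose proof (base_le k n B HB HBmin); pose proof n_lt_pow; lia. Qed.

Lemma L_le_pow : (body_length B k + 1 <= 2 ^ Z.of_nat (k + 3 + l))%Z.
Proof.
  pose proof B_le_pow as Hb; pose proof (succ_le_pow2 k) as Hk.
  rewrite !Nat2Z.inj_add, !Z.pow_add_r by lia.
  change (2 ^ Z.of_nat 3)%Z with 8%Z.
  set (x := (2 ^ Z.of_nat k)%Z) in *; set (y := (2 ^ Z.of_nat l)%Z) in *.
  unfold body_length.
  assert (H1 : ((Z.of_nat k + 1) * B <= x * y)%Z) by (apply Z.mul_le_mono_nonneg; lia).
  assert (1 * 1 <= x * y)%Z by (apply Z.mul_le_mono_nonneg; lia).
  lia.
Qed.

Lemma s_le_pow : (Z.of_nat s + Z.of_nat k + 4 <= 2 ^ Z.of_nat (2 * l + k + 4))%Z.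
Proof.
  pose proof L_le_pow as HL; pose proof n_lt_pow as Hn; pose proof (succ_le_pow2 (k + 3)) as Hk.
  assert (HLp : (0 < body_length B k)%Z) by (unfold body_length; nia).
  assert (Hs : (Z.of_nat s <= 2 ^ Z.of_nat (2 * l + k + 3))%Z).
  { unfold s, sum_text_length; rewrite Nat2Z.inj_mul, Nat2Z.inj_succ, Z2Nat.id by lia.
    replace (2 * l + k + 3)%nat with (l + (k + 3 + l))%nat by lia.
    rewrite (Nat2Z.inj_add l), Z.pow_add_r by lia.
    apply Z.mul_le_mono_nonneg; lia. }
  assert (2 ^ Z.of_nat (k + 3) <= 2 ^ Z.of_nat (2 * l + k + 3))%Z
    by (apply Z.pow_le_mono_r; lia).
  replace (2 * l + k + 4)%nat with (S (2 * l + k + 3)) by lia.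
  rewrite (Nat2Z.inj_succ (2 * l + k + 3)), Z.pow_succ_r by lia; lia.
Qed.

Lemma lg_le : (lg + 1 <= 2 * l + k + 4)%nat.
Proof.
  pose proof s_le_pow as Hs.
  assert (lg < 2 * l + k + 4)%nat; [|lia].
  apply Nat.log2_lt_pow2; [lia|].
  apply Nat2Z.inj_lt; rewrite Nat2Z.inj_pow; change (Z.of_nat 2) with 2%Z; lia.
Qed.

Lemma W_le : (cJ * (lg + 1) <= cJ * (k + 8) * l)%nat.
Proof.
  pose proof lg_le; pose proof l_pos.
  rewrite <- Nat.mul_assoc; apply Nat.mul_le_mono_l; nia.
Qed.

Lemma w_ge (a : nat) :
  (a <= 2 * k + 20 + length (pre_code J) + length (query_code J))%nat ->
  (cJ * (k + 8) * l + a * l <= w)%nat.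
Proof. intros Ha; rewrite w_eq; pose proof l_pos; nia. Qed.

(** The choice U = 2^(w-5) meets the factor 16 exactly. The other quantities below [U] are at most
    2^e for some exponent with e + 5 <= w, found by comparing multiples of l = log n + 1. *)
Lemma conv_bounds :
  (8 <= U)%Z /\ (16 * U <= 2 ^ (Z.of_nat w - 1))%Z /\ (B ^ Z.of_nat (S k) <= U)%Z /\
  (body_length B k + 1 <= U)%Z /\ (Z.of_nat s + Z.of_nat k + 4 <= U)%Z /\
  (2 ^ Z.of_nat (lg + 1) <= U)%Z /\ (2 ^ Z.of_nat (cJ * (lg + 1)) <= U)%Z /\
  (Z.of_nat (n - 1) * 2 ^ Z.of_nat k <= U)%Z /\ (2 ^ Z.of_nat k <= U)%Z /\
  (6 * (Z.of_nat k + 1) <= U)%Z /\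
  (Z.of_nat (length (pre_code J)) <= U)%Z /\ (Z.of_nat (length (query_code J)) <= U)%Z /\
  (cJ * (lg + 1) + 4 <= w)%nat.
Proof.
  pose proof l_pos as Hl; pose proof lg_le as Hlg; pose proof W_le as HW.
  pose proof (w_ge _ (Nat.le_refl _)) as Hw.
  pose proof n_lt_pow as Hn; pose proof B_le_pow as Hb; pose proof (succ_le_pow2 k) as Hk.
  set (p := length (pre_code J)) in *; set (q := length (query_code J)) in *.
  assert (Hw' : (2 * l * (k + 8) + (2 * k + 20 + p + q) * l <= w)%nat) by nia.
  assert (Hpl : (p <= p * l)%nat) by nia; assert (Hql : (q <= q * l)%nat) by nia.
  assert (Hkl : (k <= k * l)%nat) by nia.
  repeat apply conj.
  - apply (pow_le_U _ 3); [simpl; lia | lia].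
  - unfold U; change 16%Z with (2 ^ 4)%Z; rewrite <- Z.pow_add_r by lia.
    apply Z.pow_le_mono_r; lia.
  - apply (pow_le_U _ (l * S k)); [|lia].
    rewrite Nat2Z.inj_mul, Z.pow_mul_r by lia; apply Z.pow_le_mono_l; lia.
  - apply (pow_le_U _ (k + 3 + l)); [exact L_le_pow | lia].
  - apply (pow_le_U _ (2 * l + k + 4)); [exact s_le_pow | lia].
  - apply (pow_le_U _ (lg + 1)); [lia | lia].
  - apply (pow_le_U _ (cJ * (lg + 1))); [lia | lia].
  - apply (pow_le_U _ (l + k)); [|lia].
    rewrite Nat2Z.inj_add, Z.pow_add_r by lia.
    apply Z.mul_le_mono_nonneg_r; lia.
  - apply (pow_le_U _ k); [lia | lia].
  - apply (pow_le_U _ (k + 3)); [|lia].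
    rewrite Nat2Z.inj_add, Z.pow_add_r by lia; change (2 ^ Z.of_nat 3)%Z with 8%Z; lia.
  - apply (pow_le_U _ p); [pose proof (succ_le_pow2 p); lia | lia].
  - apply (pow_le_U _ q); [pose proof (succ_le_pow2 q); lia | lia].
  - lia.
Qed.

End Bounds.

(** Correctness comes with an unspecified cost [v], because it must hold for every index, even one
    with infinite expected time; only the second part assumes time bounds. *)
Lemma conv_algorithm_spec (k n : nat) (J : index_algorithm) (xs : list Z) :
  solves_jumbled_indexing (k + 3) J -> conv3sum_input n xs ->
  exists B : Z, (0 < B)%Z /\ (Z.of_nat n <= B ^ Z.of_nat (S k))%Z /\
  (forall b, (1 <= b < B)%Z -> (b ^ Z.of_nat (S k) < Z.of_nat n)%Z) /\
  let A := conv_algorithm k J in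
  let w := word_size (word_const A) n in
  let s := sum_text_length B k n in
  let N := ((n - 1) * 2 ^ k)%nat in
  let nr := reg_bound (k + 3) J in
  (forall t, exists v, good (code A) w (conv3sum xs) t (input_config xs) v) /\
  (forall t pt qt,
     Rbar_le (preprocessing_time (k + 3) J s) (Finite pt) ->
     Rbar_le (query_time (k + 3) J s) (Finite qt) ->
     mean_steps (code A) w t (input_config xs) <=
       INR (setup_cost k (index_word_const J) xs B nr) + 8 + INR (N * query_overhead k nr) +
       INR (length (pre_code J) * 3 + 11) * pt +
       INR (length (query_code J) * 3 + 11) * (INR N * qt)).
Proof.
  intros HJ [Hn Hxs]; subst n.
  destruct (least_base k (length xs)) as (B & HB & HBn & HBmin).
  exists B; repeat split; auto.
  all: pose proof (conv_bounds k (length xs) B J (proj1 HJ) HB HBmin)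
    as (U1 & U2 & U3 & U4 & U5 & U6 & U7 & U8 & U9 & U10 & U11 & U12 & U13).
  all: assert (Hpre : uses_regs (reg_bound (k + 3) J) (pre_code J))
    by (apply reg_bound_uses; intros; apply in_app_iff; auto).
  all: assert (Hqry : uses_regs (reg_bound (k + 3) J) (query_code J))
    by (apply reg_bound_uses; intros; apply in_app_iff; auto).
  all: assert (Hnr : (k + 3 <= reg_bound (k + 3) J)%nat) by (unfold reg_bound; lia).
  all: assert (Hw : (1 <= word_size (word_const (conv_algorithm k J)) (length xs))%nat)
    by (unfold word_size, conv_algorithm; cbn [word_const]; lia).
  - intros t; eexists.
    apply (conv_good k (index_word_const J) _ xs B _ Hw (proj1 HJ) HB HBn HBmin Hxs
             U1 U2 U3 U4 U5 U6 U7 U8 U9 U10 J (reg_bound (k + 3) J) eq_refl HJ Hpre Hqry Hnr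
             U11 U12 U13).
  - intros t pt qt.
    apply (conv_time k (index_word_const J) _ xs B _ Hw (proj1 HJ) HB HBn HBmin Hxs
             U1 U2 U3 U4 U5 U6 U7 U8 U9 U10 J (reg_bound (k + 3) J) eq_refl HJ Hpre Hqry Hnr
             U11 U12 U13).
Qed.

Lemma conv_algorithm_solves (k : nat) (J : index_algorithm) :
  solves_jumbled_indexing (k + 3) J -> solves_conv3sum (conv_algorithm k J).
Proof.
  intros HJ; split; [simpl; lia|].
  intros n xs bs Hin c Hc.
  destruct (conv_algorithm_spec k n J xs HJ Hin) as (B & _ & _ & _ & HG & _).
  (* Any halting run is seen by the cutoff equal to its number of coins. *)
  destruct (HG (length bs)) as (v & _ & Hg); now apply Hg.
Qed.

Local Open Scope R_scope.

(** * Asymptotics *)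

Lemma not_is_Omega (f : nat -> Rbar) (g : nat -> R) :
  ~ is_Omega f g -> exists s0, forall s, (s0 <= s)%nat -> Rbar_le (f s) (Finite (g s)).
Proof.
  intros Hno; apply NNPP; intros Hn; apply Hno.
  (* Failure for the single constant 1 is enough. *)
  exists 1; split; [lra|]; intros s0.
  apply NNPP; intros Hs; apply Hn; exists s0; intros s Hs0.
  destruct (Rbar_le_lt_dec (f s) (Finite (g s))) as [H|H]; [exact H|].
  exfalso; apply Hs; exists s; split; [exact Hs0|].
  rewrite Rmult_1_l; now apply Rbar_lt_le.
Qed.

Lemma Sup_seq_lub (u : nat -> R) (b : R) :
  (forall t, u t <= b) -> Rbar_le (Sup_seq (fun t => Finite (u t))) (Finite b).
Proof.
  intros Hu; apply (proj2 (is_sup_seq_lub _ _ (Sup_seq_correct (fun t => Finite (u t))))).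
  intros y [t Ey]; rewrite Ey; apply Hu.
Qed.

Lemma Rpower_ge_1 (x e : R) : 1 <= x -> 0 <= e -> 1 <= Rpower x e.
Proof. intros Hx He; rewrite <- (Rpower_O x) by lra; apply Rle_Rpower; lra. Qed.

(** Minimality gives (B - 1)^(k+1) < n, hence B <= 1 + n^(1/(k+1)), and the 1 is absorbed by the
    power. *)
Lemma base_Rpower (k n : nat) (B : Z) : (1 <= n)%nat -> (0 < B)%Z ->
  (forall b, (1 <= b < B)%Z -> (b ^ Z.of_nat (S k) < Z.of_nat n)%Z) ->
  IZR B <= 2 * Rpower (INR n) (/ INR (S k)).
Proof.
  intros Hn HB Hmin.
  assert (Hn1 : 1 <= INR n) by (apply (le_INR 1); exact Hn).
  assert (Hm : 0 < / INR (S k)) by (apply Rinv_0_lt_compat, lt_0_INR; lia).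
  pose proof (Rpower_ge_1 _ _ Hn1 (Rlt_le _ _ Hm)) as H1.
  destruct (Z.le_gt_cases B 1) as [Hb|Hb].
  - apply IZR_le in Hb; lra.
  - specialize (Hmin (B - 1)%Z ltac:(lia)); apply IZR_lt in Hmin.
    rewrite <- INR_IZR_INZ, <- pow_IZR in Hmin.
    assert (Hb1 : 1 <= IZR (B - 1)) by (apply IZR_le; lia).
    assert (IZR (B - 1) <= Rpower (INR n) (/ INR (S k))).
    { replace (IZR (B - 1)) with (Rpower (IZR (B - 1) ^ S k) (/ INR (S k))).
      - apply Rle_Rpower_l; [lra|]; split; [apply pow_lt|]; lra.
      - rewrite <- Rpower_pow, Rpower_mult, Rinv_r, Rpower_1 by (try lra; apply not_0_INR; lia).
        reflexivity. }
    rewrite minus_IZR in *; lra.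
Qed.

(** A block has length 6 (k+1) B + 1 <= 7 (k+1) B, and [base_Rpower] contributes the factor 2 of
    14. *)
Lemma sum_text_length_Rpower (k n : nat) (B : Z) : (1 <= n)%nat -> (0 < B)%Z ->
  (forall b, (1 <= b < B)%Z -> (b ^ Z.of_nat (S k) < Z.of_nat n)%Z) ->
  INR (sum_text_length B k n) <= 14 * INR (S k) * Rpower (INR n) (1 + / INR (S k)).
Proof.
  intros Hn HB Hmin; pose proof (base_Rpower k n B Hn HB Hmin) as Hb.
  assert (Hn1 : 1 <= INR n) by (apply (le_INR 1); exact Hn).
  assert (HL : (0 < body_length B k)%Z) by (unfold body_length; nia).
  rewrite Rpower_plus, Rpower_1 by lra.
  assert (Hs : (Z.of_nat (sum_text_length B k n) <= Z.of_nat n * (7 * Z.of_nat (S k) * B))%Z).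
  { unfold sum_text_length; rewrite Nat2Z.inj_mul, Nat2Z.inj_succ, Z2Nat.id by lia.
    apply Z.mul_le_mono_nonneg; try lia; unfold body_length; nia. }
  apply IZR_le in Hs; rewrite !mult_IZR, <- !INR_IZR_INZ in Hs.
  assert (Hk : 0 <= INR n * (7 * INR (S k)))
    by (pose proof (pos_INR (S k)); nra).
  pose proof (Rmult_le_compat_l _ _ _ Hk Hb); lra.
Qed.

Lemma setup_cost_le (k cJ nr : nat) (xs : list Z) (B : Z) :
  (0 < B)%Z -> (B <= Z.of_nat (length xs) + 1)%Z ->
  (setup_cost k cJ xs B nr <=
   (15 * k + cJ + nr + 160) * (sum_text_length B k (length xs) + length xs + 1))%nat.
Proof.
  intros HB HBn; unfold setup_cost, sum_text_length.
  set (n := length xs) in *; set (L := Z.to_nat (body_length B k)).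
  set (s := ((n - 1) * S L)%nat).
  pose proof (Nat.log2_le_lin (s + (k + 3)) ltac:(lia)) as Hlg.
  set (lg := Nat.log2 (s + (k + 3))) in *.
  assert (H1 : ((n - 1) * L <= s)%nat) by (unfold s; nia).
  assert (H2 : ((n - 1) * (L * 5 + 11 * k + 40) <= 5 * s + (11 * k + 40) * n)%nat) by nia.
  assert (H3 : ((k + 6) * Z.to_nat B <= (k + 6) * (n + 1))%nat)
    by (apply Nat.mul_le_mono_l; lia).
  assert (H4 : (cJ + nr <= (cJ + nr) * (s + n + 1))%nat) by nia.
  assert (H5 : (0 <= k * s)%nat) by lia.
  lia.
Qed.

(** The cap on [e] keeps the exponents [e1] and [e2] nonnegative, so that s may be replaced by its
    upper bound, and keeps the time n^b for writing the text below n^(2-e). *)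
Lemma conv_algorithm_time (k : nat) (J : index_algorithm) (e : R) (s0 : nat) :
  (1 <= k)%nat -> solves_jumbled_indexing (k + 3) J -> 0 < e <= 1 / 10 ->
  (forall s, (s0 <= s)%nat -> Rbar_le (preprocessing_time (k + 3) J s)
     (Finite (Rpower (INR s) (2 - 2 / INR (k + 2) - e)))) ->
  (forall s, (s0 <= s)%nat -> Rbar_le (query_time (k + 3) J s)
     (Finite (Rpower (INR s) (1 - 1 / INR (k + 2) - e)))) ->
  exists C : R, forall n, (s0 + 2 <= n)%nat ->
    Rbar_le (conv3sum_time (conv_algorithm k J) n) (Finite (C * Rpower (INR n) (2 - e))).
Proof.
  intros Hk HJ He Hpre Hqry.
  set (nr := reg_bound (k + 3) J); set (m := INR (S k)).
  set (C0 := 14 * m).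
  set (C1 := INR (15 * k + index_word_const J + nr + 160)).
  set (e1 := 2 - 2 / INR (k + 2) - e); set (e2 := 1 - 1 / INR (k + 2) - e).
  (* Here [r >= 4] enters: it gives b <= 3/2 below, whereas m = 1 would give b = 2 and only a
     quadratic bound on the text. *)
  assert (Hm : 2 <= m) by (apply (le_INR 2); lia).
  assert (Em : INR (k + 2) = m + 1) by (unfold m; rewrite plus_INR, (S_INR k); simpl; lra).
  assert (Hinv : 0 < / (m + 1) <= / 3)
    by (split; [apply Rinv_0_lt_compat; lra | apply Rinv_le_contravar; lra]).
  assert (Hinvm : 0 < / m <= / 2)
    by (split; [apply Rinv_0_lt_compat; lra | apply Rinv_le_contravar; lra]).
  set (b := 1 + / m).
  assert (Eb1 : b * e1 = 2 - b * e) by (unfold b, e1; rewrite Em; field; lra).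
  assert (Eb2 : b * e2 = 1 - b * e) by (unfold b, e2; rewrite Em; field; lra).
  assert (He1 : 0 <= e1) by (unfold e1, Rdiv; rewrite Em; lra).
  assert (He2 : 0 <= e2) by (unfold e2, Rdiv; rewrite Em; lra).
  set (K1 := INR (length (pre_code J) * 3 + 11)).
  set (K2 := INR (length (query_code J) * 3 + 11)).
  set (D := INR (2 ^ k)); set (O := INR (query_overhead k nr)).
  exists (C1 * (C0 + 2) + 8 + D * O + K1 * Rpower C0 e1 + K2 * (D * Rpower C0 e2)).
  intros n Hn; apply worst_case_le; intros xs Hin.
  destruct (conv_algorithm_spec k n J xs HJ Hin) as (B & HB & HBn & HBmin & _ & HT).
  cbv zeta in HT; fold nr K1 K2 in HT.
  pose proof (sum_text_length_Rpower k n B ltac:(lia) HB HBmin) as Hs.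
  fold m b in Hs; fold C0 in Hs.
  pose proof (setup_cost_le k (index_word_const J) nr xs B HB) as Hset.
  destruct Hin as [Hlen _]; rewrite Hlen in Hset.
  specialize (Hset (base_le k n B HB HBmin)).
  apply le_INR in Hset; rewrite mult_INR, !plus_INR in Hset.
  rewrite <- !plus_INR in Hset.
  set (s := sum_text_length B k n) in *.
  assert (HL : (0 < body_length B k)%Z) by (unfold body_length; nia).
  (* A lower bound on the text length brings [s] into the range where the assumed time bounds
     hold. *)
  assert (Hs0 : (n - 1 <= s)%nat) by (unfold s, sum_text_length; nia).
  assert (Hn1 : 1 <= INR n) by (apply (le_INR 1); lia).
  assert (Hs1 : 1 <= INR s) by (apply (le_INR 1); lia).
  set (Z := Rpower (INR n) (2 - e)).
  assert (HZb : Rpower (INR n) b <= Z) by (apply Rle_Rpower; unfold b; lra).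
  assert (HZ1 : INR n <= Z) by (rewrite <- (Rpower_1 (INR n)) at 1 by lra; apply Rle_Rpower; lra).
  assert (Hbe : e <= b * e) by (unfold b; nra).
  assert (HC0 : 1 <= C0) by (unfold C0; lra).
  assert (Hnb : 0 < Rpower (INR n) b) by apply exp_pos.
  assert (Hpow : forall f, 0 <= f -> Rpower (INR s) f <= Rpower C0 f * Rpower (INR n) (b * f)).
  { intros f Hf; rewrite <- Rpower_mult, Rpower_mult_distr by lra.
    apply Rle_Rpower_l; lra. }
  assert (Hp1 : Rpower (INR s) e1 <= Rpower C0 e1 * Z).
  { eapply Rle_trans; [apply Hpow; exact He1|].
    apply Rmult_le_compat_l; [apply Rlt_le, exp_pos|].
    apply Rle_Rpower; [lra|]; rewrite Eb1; lra. }
  assert (Hp2 : INR n * Rpower (INR s) e2 <= Rpower C0 e2 * Z).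
  { eapply Rle_trans; [apply Rmult_le_compat_l; [lra | apply Hpow; exact He2]|].
    replace (INR n * (Rpower C0 e2 * Rpower (INR n) (b * e2)))
      with (Rpower C0 e2 * (Rpower (INR n) 1 * Rpower (INR n) (b * e2)))
      by (rewrite Rpower_1 by lra; ring).
    rewrite <- Rpower_plus.
    apply Rmult_le_compat_l; [apply Rlt_le, exp_pos|].
    apply Rle_Rpower; [lra|]; rewrite Eb2; lra. }
  assert (HT' : forall t, mean_steps (code (conv_algorithm k J))
      (word_size (word_const (conv_algorithm k J)) n) t (input_config xs) <=
    (C1 * (C0 + 2) + 8 + D * O + K1 * Rpower C0 e1 + K2 * (D * Rpower C0 e2)) * Z).
  { intros t; eapply Rle_trans; [apply HT; [apply Hpre; lia | apply Hqry; lia]|].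
    assert (HC1 : 0 <= C1) by apply pos_INR.
    assert (HK1 : 0 <= K1) by apply pos_INR.
    assert (HK2 : 0 <= K2) by apply pos_INR.
    assert (HD : 0 <= D) by apply pos_INR.
    assert (HO : 0 <= O) by apply pos_INR.
    assert (G1 : INR (setup_cost k (index_word_const J) xs B nr) <= C1 * (C0 + 2) * Z).
    { eapply Rle_trans; [exact Hset|].
      fold C1; rewrite Rmult_assoc; apply Rmult_le_compat_l; [exact HC1|].
      rewrite !plus_INR; simpl (INR 1); nra. }
    assert (HN : INR ((n - 1) * 2 ^ k) <= INR n * D).
    { rewrite mult_INR; apply Rmult_le_compat_r; [exact HD | apply le_INR; lia]. }
    assert (G2 : INR ((n - 1) * 2 ^ k * query_overhead k nr) <= D * O * Z).
    { rewrite mult_INR; fold O.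
      eapply Rle_trans; [apply Rmult_le_compat_r; [exact HO | exact HN]|].
      assert (0 <= D * O) by (apply Rmult_le_pos; auto).
      replace (INR n * D * O) with (D * O * INR n) by ring.
      apply Rmult_le_compat_l; auto. }
    assert (G3 : K1 * Rpower (INR s) e1 <= K1 * Rpower C0 e1 * Z)
      by (rewrite Rmult_assoc; apply Rmult_le_compat_l; auto).
    assert (G4 : K2 * (INR ((n - 1) * 2 ^ k) * Rpower (INR s) e2) <= K2 * (D * Rpower C0 e2) * Z).
    { rewrite Rmult_assoc; apply Rmult_le_compat_l; [exact HK2|].
      eapply Rle_trans; [apply Rmult_le_compat_r; [apply Rlt_le, exp_pos | exact HN]|].
      replace (INR n * D * Rpower (INR s) e2) with (D * (INR n * Rpower (INR s) e2)) by ring.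
      rewrite Rmult_assoc; apply Rmult_le_compat_l; auto. }
    fold e1 e2; lra. }
  exact (Sup_seq_lub _ _ HT').
Qed.

Theorem theorem2 (r : nat) (eps : R) (J : index_algorithm) :
  strong_3SUM_hardness ->
  (4 <= r)%nat ->
  0 < eps ->
  solves_jumbled_indexing r J ->
  is_Omega (preprocessing_time r J)
           (fun s => Rpower (INR s) (2 - 2 / (INR r - 1) - eps)) \/
  is_Omega (query_time r J)
           (fun s => Rpower (INR s) (1 - 1 / (INR r - 1) - eps)).
Proof.
  intros Hhard Hr Heps HJ.
  apply NNPP; intros Hno; apply not_or_and in Hno; destruct Hno as [Hn1 Hn2].
  apply not_is_Omega in Hn1; apply not_is_Omega in Hn2.
  destruct Hn1 as [s1 Hs1], Hn2 as [s2 Hs2].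
  replace r with (r - 3 + 3)%nat in HJ, Hs1, Hs2 by lia.
  set (k := (r - 3)%nat) in *.
  assert (Hk : (1 <= k)%nat) by (unfold k; lia).
  assert (Er : INR (k + 3) - 1 = INR (k + 2))
    by (rewrite !plus_INR; simpl; lra).
  rewrite Er in Hs1, Hs2.
  (* Shrinking the exponent loss only weakens the assumed upper bounds. *)
  set (e := Rmin eps (1 / 10)).
  assert (He : 0 < e <= 1 / 10)
    by (unfold e; split; [apply Rmin_glb_lt; lra | apply Rmin_r]).
  assert (Hee : e <= eps) by apply Rmin_l.
  destruct (conv_algorithm_time k J e (s1 + s2 + 1) Hk HJ He) as [C HC].
  - intros s Hs; eapply Rbar_le_trans; [apply Hs1; lia|].
    apply Rle_Rpower; [apply (le_INR 1); lia | lra].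
  - intros s Hs; eapply Rbar_le_trans; [apply Hs2; lia|].
    apply Rle_Rpower; [apply (le_INR 1); lia | lra].
  - destruct (Hhard _ (conv_algorithm_solves k J HJ)) as (h & Hh & Hlow).
    apply is_lim_seq_spec in Hh.
    destruct (Hh (mkposreal (e / 2) ltac:(lra))) as [n1 Hn1]; simpl in Hn1.
    (* Half of the gain n^e beats the constant C once n > x; the other half pays for the o(1) term
       [h]. *)
    set (x := Rpower (Rmax C 1) (2 / e)).
    destruct (INR_unbounded x) as [n2 Hn2].
    destruct (Hlow (s1 + s2 + 3 + n1 + n2)%nat) as (n & Hn & Hle).
    specialize (Hn1 n ltac:(lia)); rewrite Rminus_0_r in Hn1; apply Rabs_def2 in Hn1.
    specialize (HC n ltac:(lia)).
    pose proof (Rbar_le_trans _ _ _ Hle HC) as Hfin; simpl in Hfin.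
    assert (Hn3 : 1 <= INR n) by (apply (le_INR 1); lia).
    assert (Hn4 : x < INR n) by (eapply Rlt_le_trans; [exact Hn2 | apply le_INR; lia]).
    assert (Hx : 0 < x) by apply exp_pos.
    assert (Hgt : Rmax C 1 < Rpower (INR n) (e / 2)).
    { replace (Rmax C 1) with (Rpower x (e / 2)).
      - apply Rlt_Rpower_l; lra.
      - unfold x; rewrite Rpower_mult.
        replace (2 / e * (e / 2)) with 1 by (field; lra).
        apply Rpower_1; pose proof (Rmax_r C 1); lra. }
    assert (Hs : Rpower (INR n) (2 - e) * Rpower (INR n) (e / 2) <= Rpower (INR n) (2 - h n)).
    { rewrite <- Rpower_plus; apply Rle_Rpower; lra. }
    pose proof (Rmax_l C 1).
    assert (0 < Rpower (INR n) (2 - e)) by apply exp_pos.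
    nra.
Qed.
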